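(* Let $(V_k)_{k\ge 1}$ be i.i.d. real random variables with mean zero and finite variance $\sigma^2>0$. Let $(k_n)_{n\ge1}$ be a sequence of positive numbers increasing to infinity with $k_n=o(n)$, let $\gamma_1,\gamma_2>0$, and put $\theta_n=1+\gamma_1/k_n$, $\rho_n=1+\gamma_2/k_n$. For each $n\ge 1$ let $X_{0,n}=\varepsilon_{0,n}=0$ and, for $k=1,\dots,n$, $$X_{k,n}=\theta_nX_{k-1,n}+\varepsilon_{k,n},\qquad \varepsilon_{k,n}=\rho_n\varepsilon_{k-1,n}+V_k,$$ and let $\hat\theta_n=\dfrac{\sum_{k=1}^nX_{k,n}X_{k-1,n}}{\sum_{k=1}^nX_{k-1,n}^2}$. Then, as $n\to\infty$ (with $\stackrel{\mathcal L}{\longrightarrow}$ denoting convergence in distribution): (1) if $\gamma_1>\gamma_2>0$, then $$\frac{\gamma_1+\gamma_2}{2\gamma_1(\gamma_1-\gamma_2)}\,k_n\theta_n^n\rho_n^{-n}(\hat\theta_n-\theta_n)\stackrel{\mathcal L}{\longrightarrow}\frac{\xi_\rho}{\xi_\theta};$$ (2) if $\gamma_2>\gamma_1>0$, then $$\frac{\gamma_1+\gamma_2}{2\gamma_2(\gamma_2-\gamma_1)}\,\rho_n^n\theta_n^{-n}\bigl(k_n(\hat\theta_n-\theta_n)-(\gamma_2-\gamma_1)\bigr)\stackrel{\mathcal L}{\longrightarrow}\frac{\xi_\theta}{\xi_\rho};$$ where in (1) and (2) $(\xi_\theta,\xi_\rho)$ is a centered Gaussian vector with covariance matrix $$\Lambda=\begin{pmatrix}\frac{\sigma^2}{2\gamma_1}&\frac{\sigma^2}{\gamma_1+\gamma_2}\\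 \frac{\sigma^2}{\gamma_1+\gamma_2}&\frac{\sigma^2}{2\gamma_2}\end{pmatrix};$$ (3) if $\gamma_1=\gamma_2=\gamma>0$, then $$\frac{n}{k_n}\bigl(n(\hat\theta_n-\theta_n)-\theta_n\bigr)\stackrel{\mathcal L}{\longrightarrow}\frac{\zeta_\theta}{\varphi_\theta},$$ where $(\varphi_\theta,\zeta_\theta)$ is a centered Gaussian vector with covariance matrix $$\Xi=\begin{pmatrix}\frac{\sigma^2}{2\gamma}&\frac{\sigma^2}{2\gamma^2}\\ \frac{\sigma^2}{2\gamma^2}&\frac{5\sigma^2}{8\gamma^3}\end{pmatrix}.$$
   Context: $\hat\theta_n$ is the least squares estimator of $\theta_n$ based on $(X_{k,n})_{1\le k\le n}$. On the event that its denominator vanishes, $\hat\theta_n$ may be given an arbitrary value. *)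

(* Defs.v *)
From HB Require Import structures.
From mathcomp Require Import all_boot all_order all_algebra.
From mathcomp Require Import finmap.
From mathcomp Require Import all_classical all_reals all_analysis.

Set Implicit Arguments.
Unset Strict Implicit.
Unset Printing Implicit Defensive.

Import Order.TTheory GRing.Theory Num.Theory.
Import numFieldNormedType.Exports.

Local Open Scope classical_set_scope.
Local Open Scope ring_scope.

Definition mutually_independent d (T : measurableType d) (R : realType)
    (P : probability T R) (I : set nat) (X : nat -> {RV P >-> R}) : Prop :=
  forall (J : {fset nat}) (A : nat -> set R),
    [set` J] `<=` I -> (forall i, measurable (A i)) ->
    P (\bigcap_(i in [set` J]) (X i @^-1` A i)) =
    (\prod_(i <- J) P (X i @^-1` A i))%E.

Definition identically_distributed d (T : measurableType d) (R : realType)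
    (P : probability T R) (I : set nat) (X : nat -> {RV P >-> R}) : Prop :=
  forall i j, I i -> I j -> forall A : set R, measurable A ->
    distribution P (X i) A = distribution P (X j) A.

Definition iid d (T : measurableType d) (R : realType)
    (P : probability T R) (I : set nat) (X : nat -> {RV P >-> R}) : Prop :=
  mutually_independent I X /\ identically_distributed I X.

(* The library's [normal_prob m 0] is the uniform law on [0, 1]; the degenerate
   Gaussian law N(m, 0) is the Dirac mass at m. *)
Definition gaussian_law (R : realType) (m s : R) (A : set R) : \bar R :=
  if s == 0 then (\d_m A)%E else normal_prob m s A.

Definition gaussian_vector d (T : measurableType d) (R : realType)
    (P : probability T R) (n : nat) (X : 'I_n -> {RV P >-> R}) : Prop :=
  forall a : 'I_n -> R, exists m s : R, forall A : set R, measurable A ->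
    P ((fun w => \sum_(i < n) a i * X i w) @^-1` A) = gaussian_law m s A.

Definition centered_gaussian_vector d (T : measurableType d) (R : realType)
    (P : probability T R) (n : nat) (X : 'I_n -> {RV P >-> R})
    (S : 'M[R]_n) : Prop :=
  [/\ gaussian_vector X,
      forall i, ('E_P[X i] = 0)%E &
      forall i j, covariance P (X i) (X j) = (S i j)%:E].

Definition pair2 (U : Type) (x y : U) : 'I_2 -> U :=
  fun i => if i == ord0 then x else y.

Definition mx2 (R : Type) (a b c e : R) : 'M[R]_2 :=
  \matrix_(i < 2, j < 2) pair2 (pair2 a b) (pair2 c e) i j.

(* Weak convergence of laws. The variables are plain functions so that
   pointwise expressions can be used directly; it is meant for measurable ones,
   and the limit may live on another probability space. *)
Definition cvg_in_distribution d (T : measurableType d) d'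
    (T' : measurableType d') (R : realType) (P : probability T R)
    (Q : probability T' R) (Y : nat -> T -> R) (Z : T' -> R) : Prop :=
  forall f : R -> R, continuous f -> bounded_fun f ->
    'E_P[f \o Y n]%E @[n --> \oo] --> 'E_Q[f \o Z]%E.

(* Main.v *)
(* Write theta = 1 + g / k_n. A near-explosive autoregression with root theta is
   theta^k R - e_k, where R = sum_(j <= n) theta^-j V_j and e_k only involves the V_j with
   j > k; R and e_k both have second moment O(k_n). Eliminating one lag,
   Y_k = X_k - rho X_(k-1) is an autoregression with root theta driven by V, and
   X_(k-1) = (Y_k - eps_k) / (theta - rho); hence the normalized error of the estimator is a
   ratio of quadratic forms in two autoregressions driven by the same V. Replacing every
   autoregression by its exploding part theta^k R costs an error that vanishes in L1, and
   geometric sums turn the ratio into (U W + o(1)) / (W^2 + o(1)) with U and W normalized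
   weighted sums of V. When the roots coincide, X_(k-1) involves theta^k (k R - J) with
   J = sum_(j <= n) j theta^-j V_j instead; the leading terms of numerator and denominator
   cancel, and the surviving one is (W / (2 g) + H) W, with H the normalized J.

   Lindeberg's argument gives the convergence of E cos (s U + t W + b), averaging over s
   and t gives that of E f (U, W) for continuous f with bounded support, and since the limit
   of W has no atom at 0 the ratio converges in distribution to the ratio of the limits. *)
Require Import Defs.
From HB Require Import structures.
From mathcomp Require Import all_boot all_order all_algebra.
From mathcomp Require Import finmap.
From mathcomp Require Import all_classical all_reals all_analysis.
From mathcomp Require Import measurable_realfun zify ring lra.

Set Implicit Arguments.
Unset Strict Implicit.
Unset Printing Implicit Defensive.

Import Order.TTheory GRing.Theory Num.Theory.
Import numFieldNormedType.Exports.

Local Open Scope classical_set_scope.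
Local Open Scope ring_scope.


(** * The normal law *)

(** Division is discontinuous at 0, so the convergence of (U, W) cannot simply be composed with it.
    Only numerator and denominator are compared in L1, with U W and W^2; the quotient is formed
    where W is bounded away from 0 and U, W are bounded, and the mass outside is controlled by the
    limit. Where the denominator vanishes, the estimator enters only through a bound on the test
    function.

    Everything stays real: the phase b covers cosine and sine at once and makes products of cosines
    linear in such expressions.

    The normalisations come from the sum of (theta rho)^k, about k_n (theta rho)^n / (g + h) for
    roots 1 + g / k_n and 1 + h / k_n: one factor k_n from this sum, one from a product of two sums
    of size sqrt k_n. At equal roots, with Z_k = theta X_(k-1), the centred error n (thetahat -
    theta) - theta is theta times sum (n eps_k - Z_k) Z_k / sum Z_k^2, and n eps_k - Z_k is to
    leading order theta^k ((n - k) R + J). As n - k is of order k_n where theta^k matters, the rate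
    is n / k_n. *)

Lemma expR_sqr_bound (R : realType) (z : R) : z ^+ 2 <= 4 * (expR z + expR (- z)).
Proof.
have key (y : R) : 0 <= y -> y ^+ 2 <= 4 * expR y.
  move=> y0; have := expR_ge1Dx (y / 2).
  have -> : expR y = expR (y / 2) ^+ 2 by rewrite -expRM_natr mulfVK.
  by nra.
have := expR_gt0 z; have := expR_gt0 (- z).
have [z0|/ltW z0] := leP 0 z; first by have := key z z0; lra.
by have := key (- z); rewrite oppr_ge0 sqrrN => /(_ z0); lra.
Qed.

Section normal.
Context {R : realType}.
Implicit Types m s t b x : R.
Local Notation mu := (@lebesgue_measure R).

(** Completing the square: an exponential tilt only shifts the mean. Moment bounds then follow from
    the normalisation of the density alone. *)
Lemma normal_pdf_tilt m s (h x : R) : s != 0 ->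
  expR (h * (x - m)) * normal_pdf m s x =
  expR (h ^+ 2 * s ^+ 2 / 2) * normal_pdf (m + h * s ^+ 2) s x.
Proof.
move=> s0; rewrite !normal_pdfE// mulrCA [RHS]mulrCA; congr (_ * _).
rewrite /normal_fun -!expRD; congr expR.
by field.
Qed.

(** [expR_sqr_bound] at z = (x - m) / s: the two exponentials are tilts with h = 1 / s and h = - 1 /
    s, which move the mean by s and - s and cost a factor exp (1 / 2). *)
Lemma normal_sqr_le m s x : s != 0 ->
  (x - m) ^+ 2 * normal_pdf m s x <=
  4 * s ^+ 2 * expR 2^-1 * (normal_pdf (m + s) s x + normal_pdf (m - s) s x).
Proof.
move=> s0.
have := normal_pdf_tilt m s^-1 x s0; have := normal_pdf_tilt m (- s^-1) x s0.
have -> : m + s^-1 * s ^+ 2 = m + s by field.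
have -> : m + - s^-1 * s ^+ 2 = m - s by field.
have -> : s^-1 ^+ 2 * s ^+ 2 / 2 = 2^-1 by field.
have -> : (- s^-1) ^+ 2 * s ^+ 2 / 2 = 2^-1 by field.
rewrite mulNr => H1 H2.
rewrite -mulrA mulrDr -H1 -H2.
have := expR_sqr_bound (s^-1 * (x - m)).
have -> : (s^-1 * (x - m)) ^+ 2 = s^-2 * (x - m) ^+ 2 by rewrite exprMn exprVn.
rewrite ler_pdivrMl ?exprn_even_gt0// => H.
have := ler_wpM2r (normal_pdf_ge0 m s x) H.
by nra.
Qed.

(** The constant is not sharp; only the order s^2 matters, when the width of a smoothing kernel is
    made small. *)
Lemma normal_sqr_integral m s : s != 0 ->
  (\int[mu]_x ((x - m) ^+ 2 * normal_pdf m s x)%:E <=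
   (8 * s ^+ 2 * expR 2^-1)%:E)%E.
Proof.
move=> s0.
have mn m' : measurable_fun setT (normal_pdf m' s) by exact: measurable_normal_pdf.
have c0 : 0 <= 4 * s ^+ 2 * expR 2^-1.
  by apply: mulr_ge0; [apply: mulr_ge0 => //; exact: sqr_ge0|exact: expR_ge0].
apply: (@le_trans _ _ (\int[mu]_x ((4 * s ^+ 2 * expR 2^-1)%:E *
   ((normal_pdf (m + s) s x)%:E + (normal_pdf (m - s) s x)%:E))))%E.
  apply: ge0_le_integral => //=.
  - by move=> x _; rewrite lee_fin mulr_ge0 ?sqr_ge0 ?normal_pdf_ge0.
  - apply/measurable_EFinP; apply: measurable_funM; last exact: mn.
    by apply: measurable_funX; exact: measurable_funB.
  - by apply: measurable_funeM; apply: emeasurable_funD; apply/measurable_EFinP; exact: mn.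
  - by move=> x _; rewrite -EFinD -EFinM lee_fin normal_sqr_le.
rewrite ge0_integralZl//=; last 2 first.
- by apply: emeasurable_funD; apply/measurable_EFinP; exact: mn.
- by move=> x _; rewrite lee_fin addr_ge0 ?normal_pdf_ge0.
rewrite ge0_integralD//=; last 4 first.
- by move=> x _; rewrite lee_fin normal_pdf_ge0.
- by apply/measurable_EFinP; exact: mn.
- by move=> x _; rewrite lee_fin normal_pdf_ge0.
- by apply/measurable_EFinP; exact: mn.
by rewrite !integral_normal_pdf -EFinD -EFinM lee_fin; lra.
Qed.

(** Integration by parts on the line with vanishing boundary terms: the fundamental theorem on
    growing symmetric intervals, then dominated convergence. *)
Lemma integral_derive_eq0 (G g : R -> R) :
  (forall x, is_derive x 1 G (g x)) -> continuous g ->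
  mu.-integrable setT (EFin \o g) ->
  G n%:R @[n --> \oo] --> 0 -> G (- n%:R) @[n --> \oo] --> 0 ->
  \int[mu]_x g x = 0.
Proof.
move=> dG cg ig Gp Gn.
have mg : measurable_fun setT g by exact: continuous_measurable_fun.
(* The shift to n + 1 makes the interval nondegenerate also for n = 0. *)
have E (n : nat) : \int[mu]_x (g \_ `[- n.+1%:R, n.+1%:R]) x = G n.+1%:R - G (- n.+1%:R).
  rewrite -Rintegral_mkcond /Rintegral (@continuous_FTC2 _ g G)//.
  - by rewrite (@lt_trans _ _ 0)// ?oppr_lt0 ltr0n.
  - exact: continuous_subspaceT.
  - have cG : continuous G by move=> x; apply: differentiable_continuous; apply/derivable1_diffP; exact: ex_derive.
    split; first by move=> x _; exact: ex_derive.
    + exact/cvg_at_right_filter/cG.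
    + exact/cvg_at_left_filter/cG.
  - by move=> x _; rewrite derive1E derive_val.
have cv : \int[mu]_x (g \_ `[- n.+1%:R, n.+1%:R]) x @[n --> \oo] --> \int[mu]_x g x.
  apply: fine_cvg; rewrite fineK; last exact: integrable_fin_num.
  apply: (@dominated_cvg _ _ _ mu setT measurableT _ _ (fun x => (`|g x|)%:E)) => //=.
  - by move=> n; apply/measurable_EFinP; apply/(measurable_restrictT _ _).1 => //; exact: (measurable_funTS mg).
  - move=> x _; apply: (@cvg_near_cst _ (\bar R)%E (g x)%:E); near=> n; congr EFin.
    rewrite /= patchE mem_set//= in_itv/= -ler_norml.
    near: n; exists (Num.trunc `|x|) => // n /= xn.
    apply: (le_trans (ltW (truncnS_gt _))); by rewrite ler_nat ltnS.
  - exact: (integrable_norm ig).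
  - move=> n x _; rewrite patchE; case: ifP => _; rewrite ?lee_fin//= normr0.
    exact: normr_ge0.
have cv0 : \int[mu]_x (g \_ `[- n.+1%:R, n.+1%:R]) x @[n --> \oo] --> (0 : R).
  have Gp1 : G n.+1%:R @[n --> \oo] --> 0 by rewrite (cvg_shiftS (fun n => G n%:R)).
  have Gn1 : G (- n.+1%:R) @[n --> \oo] --> 0.
    by rewrite (cvg_shiftS (fun n => G (- n%:R))).
  have h : (G n.+1%:R - G (- n.+1%:R)) @[n --> \oo] --> (0 - 0 : R) by exact: cvgB.
  by rewrite subr0 in h; rewrite (eq_cvg _ _ E).
exact: (cvg_unique (@Rhausdorff R) cv cv0).
Unshelve. all: by end_near. Qed.

(** (x - m)^2 times the density is bounded, so the density decays at least like the inverse square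
    of the distance to m. *)
Lemma normal_pdf_cvg0 m s (u : nat -> R) : s != 0 ->
  (forall K : R, \forall n \near \oo, K <= `|u n|) ->
  normal_pdf m s (u n) @[n --> \oo] --> 0.
Proof.
move=> s0 uy; set K := 8 * s ^+ 2 * expR 2^-1 * normal_peak s.
have K0 : 0 <= K.
  by do 3?apply: mulr_ge0; rewrite ?sqr_ge0 ?expR_ge0 ?normal_peak_ge0.
have ub x : (x - m) ^+ 2 * normal_pdf m s x <= K.
  apply: (le_trans (normal_sqr_le m x s0)).
  have -> : K = 4 * s ^+ 2 * expR 2^-1 * (normal_peak s + normal_peak s) by rewrite /K; ring.
  apply: ler_wpM2l; first by do 2?apply: mulr_ge0; rewrite ?sqr_ge0 ?expR_ge0.
  by rewrite lerD ?normal_pdf_ub.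
apply/cvgrPdist_le => e e0; near=> n.
rewrite sub0r normrN ger0_norm ?normal_pdf_ge0//.
have h : 1 + K / e <= `|u n - m|.
  have : 1 + K / e + `|m| <= `|u n| by near: n; exact: uy.
  have := ler_normB (u n - m) (- m); rewrite opprK subrK normrN; lra.
have Ke : 0 <= K / e by rewrite divr_ge0// ltW.
have h2 : K / e <= (u n - m) ^+ 2.
  by rewrite -real_normK ?num_real//; nra.
have h3 : 0 < (u n - m) ^+ 2 by rewrite -real_normK ?num_real//; nra.
rewrite -(ler_pM2l h3) (le_trans (ub _))//.
by rewrite -ler_pdivrMr.
Unshelve. all: by end_near. Qed.

(** The majorant is a multiple of the sum of three normal densities, with means m, m + s and m -
    s. *)
Lemma integrable_dominated_normal m s (f : R -> R) (c : R) : s != 0 ->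
  measurable_fun setT f -> (forall x, `|f x| <= c * (1 + (x - m) ^+ 2) * normal_pdf m s x) ->
  mu.-integrable setT (EFin \o f).
Proof.
move=> s0 mf fc.
have c0 : 0 <= c.
  have := le_trans (normr_ge0 _) (fc 0); rewrite -mulrA pmulr_lge0//.
  rewrite mulr_gt0//; first by rewrite ltr_pwDl// sqr_ge0.
  by rewrite normal_pdfE// mulr_gt0 ?normal_peak_gt0 ?expR_gt0.
pose K := c * (1 + 4 * s ^+ 2 * expR 2^-1).
have cK : c <= K by rewrite /K ler_peMr// lerDl; do 2?apply: mulr_ge0; rewrite ?sqr_ge0 ?expR_ge0.
pose g x := K * (normal_pdf m s x + (normal_pdf (m + s) s x + normal_pdf (m - s) s x)).
have ig : mu.-integrable setT (EFin \o g).
  have : mu.-integrable setT (fun x => K%:E * ((normal_pdf m s x)%:E +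
      ((normal_pdf (m + s) s x)%:E + (normal_pdf (m - s) s x)%:E)))%E.
    have i m' := integrable_normal_pdf m' s.
    by apply: integrableZl => //; apply: integrableD => //; apply: integrableD.
  by [].
apply: le_integrable ig => //; first by apply/measurable_EFinP.
move=> x _; rewrite /= lee_fin (le_trans (fc x))//.
rewrite [leRHS]ger0_norm; last first.
  by apply: mulr_ge0; [exact: le_trans cK|rewrite !addr_ge0 ?normal_pdf_ge0].
have h := normal_sqr_le m x s0.
have := normal_pdf_ge0 m s x; have := normal_pdf_ge0 (m + s) s x.
have := normal_pdf_ge0 (m - s) s x.
rewrite /g /K; move: h; set e := 4 * s ^+ 2 * expR 2^-1.
have e0 : 0 <= e by do 2?apply: mulr_ge0; rewrite ?sqr_ge0 ?expR_ge0.
set a := normal_pdf _ _ _; set a1 := normal_pdf _ _ _; set a2 := normal_pdf _ _ _.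
move=> h a20 a10 a0; rewrite -!mulrA ler_wpM2l//.
rewrite mulrDl mul1r [leRHS]mulrDl mul1r lerD//.
  by rewrite lerDl addr_ge0.
rewrite (le_trans h)// ler_wpM2l// lerDr//.
Qed.

Lemma measurable_affine_cos m t b :
  measurable_fun setT (fun x : R => cos (t * (x - m) + b)) *
  measurable_fun setT (fun x : R => sin (t * (x - m) + b)).
Proof.
have ma : measurable_fun setT (fun x => t * (x - m) + b).
  by apply: measurable_funD => //; apply: measurable_funM => //; exact: measurable_funB.
split; (apply: measurableT_comp; last exact: ma); apply: continuous_measurable_fun.
  exact: continuous_cos.
exact: continuous_sin.
Qed.

Lemma le_abs_1Dsqr (x : R) : `|x| <= 1 + x ^+ 2.
Proof. by rewrite ler_norml; nra. Qed.

Lemma is_derive_normal_pdf m s x : s != 0 ->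
  is_derive x 1 (normal_pdf m s) (- (x - m) / s ^+ 2 * normal_pdf m s x).
Proof.
move=> s0; rewrite normal_pdfE// /normal_fun.
apply: is_derive_eq; rewrite /= /GRing.scale/=.
by field.
Qed.

(** Integrate the derivative of the sine times the density; the boundary terms vanish since the sine
    is bounded and the density tends to 0. *)
Lemma normal_stein m s t b : s != 0 ->
  \int[mu]_x ((x - m) * sin (t * (x - m) + b) * normal_pdf m s x) =
  s ^+ 2 * t * \int[mu]_x (cos (t * (x - m) + b) * normal_pdf m s x).
Proof.
move=> s0.
have [mc ms] := measurable_affine_cos m t b.
have mx : measurable_fun setT (fun x : R => x - m) by exact: measurable_funB.
have mn : measurable_fun setT (normal_pdf m s) by exact: measurable_normal_pdf.
have ic : mu.-integrable setT (EFin \o (fun x => cos (t * (x - m) + b) * normal_pdf m s x)).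
  apply: (@integrable_dominated_normal m s _ 1) => //; first exact: measurable_funM.
  move=> x; rewrite normrM (ger0_norm (normal_pdf_ge0 _ _ _)) mul1r.
  rewrite ler_wpM2r ?normal_pdf_ge0// (@le_trans _ _ 1)// ?lerDl ?sqr_ge0//.
  by rewrite ler_norml cos_le1 cos_geN1.
have is_ : mu.-integrable setT (EFin \o (fun x => (x - m) * sin (t * (x - m) + b) * normal_pdf m s x)).
  apply: (@integrable_dominated_normal m s _ 1) => //.
    by apply: measurable_funM => //; exact: measurable_funM.
  move=> x; rewrite normrM (ger0_norm (normal_pdf_ge0 _ _ _)) mul1r.
  rewrite ler_wpM2r ?normal_pdf_ge0// (le_trans _ (le_abs_1Dsqr _))// normrM.
  by rewrite ler_piMr// ler_norml sin_le1 sin_geN1.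
pose G x := sin (t * (x - m) + b) * normal_pdf m s x.
pose g x := t * (cos (t * (x - m) + b) * normal_pdf m s x) -
  s ^- 2 * ((x - m) * sin (t * (x - m) + b) * normal_pdf m s x).
have dG x : is_derive x 1 G (g x).
  have := is_derive_normal_pdf m x s0 => ?.
  apply: is_derive_eq; rewrite /g /= /GRing.scale/=.
  by field.
have cg : continuous g.
  move=> x; apply: differentiable_continuous; apply/derivable1_diffP.
  have ? := is_derive_normal_pdf m x s0.
  by rewrite /g; exact: ex_derive.
have iZ1 : mu.-integrable setT
    (EFin \o (fun x => t * (cos (t * (x - m) + b) * normal_pdf m s x))).
  by have := integrableZl measurableT t ic.
have iZ2 : mu.-integrable setT
    (EFin \o (fun x => s ^- 2 * ((x - m) * sin (t * (x - m) + b) * normal_pdf m s x))).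
  by have := integrableZl measurableT (s ^- 2) is_.
have G0 (u : nat -> R) : (forall K : R, \forall n \near \oo, K <= `|u n|) ->
    G (u n) @[n --> \oo] --> 0.
  move=> uy; apply/norm_cvg0P; apply: (@squeeze_cvgr _ _ _ _ (fun=> 0) (fun n => normal_pdf m s (u n))).
  - apply: nearW => n; rewrite normr_ge0/= /G normrM (ger0_norm (normal_pdf_ge0 _ _ _)).
    by rewrite ler_piMl ?normal_pdf_ge0// ler_norml sin_le1 sin_geN1.
  - exact: cvg_cst.
  - exact: normal_pdf_cvg0.
have nbig (K : R) : \forall n \near \oo, K <= n%:R.
  near=> n; apply: (@le_trans _ _ (Num.truncn `|K|).+1%:R).
    by rewrite (le_trans (ler_norm _))// ltW// truncnS_gt.
  by rewrite ler_nat; near: n; exact: nbhs_infty_ge.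
have := @integral_derive_eq0 G g dG cg.
have -> : \int[mu]_x g x = t * \int[mu]_x (cos (t * (x - m) + b) * normal_pdf m s x) -
    s ^- 2 * \int[mu]_x ((x - m) * sin (t * (x - m) + b) * normal_pdf m s x).
  by rewrite /g RintegralB// RintegralZl// RintegralZl.
move=> h; have /subr0_eq : t * \int[mu]_x (cos (t * (x - m) + b) * normal_pdf m s x) -
    s ^- 2 * \int[mu]_x ((x - m) * sin (t * (x - m) + b) * normal_pdf m s x) = 0.
  apply: h.
  - by have := integrableB measurableT iZ1 iZ2.
  - by apply: G0 => K; near=> n; rewrite ger0_norm//; near: n; exact: nbig.
  - by apply: G0 => K; near=> n; rewrite normrN ger0_norm//; near: n; exact: nbig.
move=> E; rewrite -mulrA E mulrA mulfV ?mul1r// expf_neq0//.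
Unshelve. all: by end_near. Qed.

(** The real form of the characteristic function. Differentiating in t under the integral and
    applying [normal_stein] gives F' = - s^2 t F, so exp (s^2 t^2 / 2) F is constant, with value cos
    b at t = 0. *)
Lemma normal_cos m s t b : s != 0 ->
  \int[mu]_x (cos (t * (x - m) + b) * normal_pdf m s x) =
  expR (- (s ^+ 2 * t ^+ 2 / 2)) * cos b.
Proof.
move=> s0.
pose f t x := cos (t * (x - m) + b) * normal_pdf m s x.
pose F t := \int[mu]_x f t x.
have df t' x : is_derive t' 1 (f ^~ x) (- (x - m) * sin (t' * (x - m) + b) * normal_pdf m s x).
  by apply: is_derive_eq; rewrite /= /GRing.scale/=; ring.
have mx : measurable_fun setT (fun x : R => x - m) by exact: measurable_funB.
have mn : measurable_fun setT (normal_pdf m s) by exact: measurable_normal_pdf.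
have d1f t' x : partial1of2 f t' x = - (x - m) * sin (t' * (x - m) + b) * normal_pdf m s x.
  by rewrite partial1of2E derive_val.
have intf t' : mu.-integrable setT (EFin \o f t').
  have [mc _] := measurable_affine_cos m t' b.
  apply: (@integrable_dominated_normal m s _ 1) => //; first exact: measurable_funM.
  move=> x; rewrite normrM (ger0_norm (normal_pdf_ge0 _ _ _)) mul1r.
  rewrite ler_wpM2r ?normal_pdf_ge0// (@le_trans _ _ 1)// ?lerDl ?sqr_ge0//.
  by rewrite ler_norml cos_le1 cos_geN1.
pose G x := `|x - m| * normal_pdf m s x.
have intG : mu.-integrable setT (EFin \o G).
  apply: (@integrable_dominated_normal m s _ 1) => //.
    by apply: measurable_funM => //; apply: measurableT_comp => //.
  move=> x; rewrite normrM normr_id (ger0_norm (normal_pdf_ge0 _ _ _)) mul1r.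
  by rewrite ler_wpM2r ?normal_pdf_ge0// le_abs_1Dsqr.
have dF t' : is_derive t' 1 F (- (s ^+ 2 * t') * F t').
  have I : `](t' - 1), (t' + 1)[%classic t' by rewrite /= in_itv/=; lra.
  have intf' x : `](t' - 1), (t' + 1)[%classic x -> mu.-integrable setT (EFin \o f x) by [].
  have derf1 x y : `](t' - 1), (t' + 1)[%classic x -> setT y -> derivable (f ^~ y) x 1.
    by move=> _ _; exact: ex_derive.
  have G0 y : 0 <= G y by rewrite mulr_ge0 ?normal_pdf_ge0.
  have Gub x y : `](t' - 1), (t' + 1)[%classic x -> setT y -> `|partial1of2 f x y| <= G y.
    move=> _ _; rewrite d1f !normrM normrN (ger0_norm (normal_pdf_ge0 _ _ _)).
    by rewrite ler_wpM2r ?normal_pdf_ge0// ler_piMr// ler_norml sin_le1 sin_geN1.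
  have dvF := derivable_under_integral measurableT I intf' derf1 G0 intG Gub.
  have dvE := differentiation_under_integral measurableT I intf' derf1 G0 intG Gub.
  apply: DeriveDef => //; rewrite -derive1E dvE.
  rewrite /F /f mulNr -normal_stein//.
  rewrite -mulN1r -RintegralZl//.
    by apply: eq_Rintegral => x _; rewrite d1f; ring.
  have [_ ms] := measurable_affine_cos m t' b.
  apply: (@integrable_dominated_normal m s _ 1) => //.
    by apply: measurable_funM => //; exact: measurable_funM.
  move=> x; rewrite normrM (ger0_norm (normal_pdf_ge0 _ _ _)) mul1r.
  rewrite ler_wpM2r ?normal_pdf_ge0// (le_trans _ (le_abs_1Dsqr _))// normrM.
  by rewrite ler_piMr// ler_norml sin_le1 sin_geN1.
pose H t := expR (s ^+ 2 * t ^+ 2 / 2) * F t.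
have dH t' : is_derive t' 1 H 0.
  by apply: is_derive_eq; rewrite /= /GRing.scale/=; field.
have : H t = H 0 by exact: is_derive_0_is_cst.
rewrite /H expr0n/= mulr0 mul0r expR0 mul1r.
have -> : F 0 = cos b.
  rewrite /F /f; under eq_Rintegral do rewrite mul0r add0r.
  rewrite RintegralZl//; last exact: integrable_normal_pdf.
  by rewrite /Rintegral integral_normal_pdf mulr1.
by move=> <-; rewrite mulrA -expRD addNr expR0 mul1r.
Qed.


End normal.

(** * Averages of test functions *)

Lemma integrable_bounded d (T : measurableType d) (R : realType)
    (P : {finite_measure set T -> \bar R}) (f : T -> R) (c : R) :
  measurable_fun setT f -> (forall x, `|f x| <= c) -> P.-integrable setT (EFin \o f).
Proof.
move=> mf fc; apply: (@le_integrable _ _ _ P setT measurableT _ (cst c%:E)) => //.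
- exact/measurable_EFinP.
- move=> x _ /=; rewrite lee_fin (le_trans (fc x))// ler_norm//.
- exact: finite_measure_integrable_cst.
Qed.

Lemma Rintegral_probability_cst d (T : measurableType d) (R : realType)
    (P : probability T R) (c : R) : \int[P]_w c = c.
Proof.
rewrite Rintegral_cst// [X in fine X](_ : _ = 1%E) ?mulr1//.
exact: probability_setT.
Qed.

Lemma Rintegral_swap d1 d2 (T1 : measurableType d1) (T2 : measurableType d2)
    (R : realType) (m1 : {sigma_finite_measure set T1 -> \bar R})
    (m2 : {sigma_finite_measure set T2 -> \bar R}) (f : T1 * T2 -> R) :
  (m1 \x m2)%E.-integrable setT (EFin \o f) ->
  (forall x, m2.-integrable setT (fun y => (f (x, y))%:E)) ->
  (forall y, m1.-integrable setT (fun x => (f (x, y))%:E)) ->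
  \int[m1]_x \int[m2]_y f (x, y) = \int[m2]_y \int[m1]_x f (x, y).
Proof.
move=> i12 i2 i1; rewrite /Rintegral; congr fine.
under eq_integral do rewrite fineK ?integrable_fin_num//.
under [RHS]eq_integral do rewrite fineK ?integrable_fin_num//.
exact: (Fubini i12).
Qed.

Lemma integrable_prod d1 d2 (T1 : measurableType d1) (T2 : measurableType d2)
    (R : realType) (m1 : {sigma_finite_measure set T1 -> \bar R})
    (m2 : {sigma_finite_measure set T2 -> \bar R}) (f : T1 -> R) (g : T2 -> R) :
  m1.-integrable setT (EFin \o f) -> m2.-integrable setT (EFin \o g) ->
  (m1 \x m2)%E.-integrable setT (fun p => (f p.1 * g p.2)%:E).
Proof.
move=> intf intg.
have /measurable_EFinP mf := measurable_int _ intf.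
have /measurable_EFinP mg := measurable_int _ intg.
apply/integrable12ltyP.
  by apply/measurable_EFinP; apply: measurable_funM; apply: measurableT_comp.
have -> : (\int[m1]_x \int[m2]_y `|(f (x, y).1 * g (x, y).2)%:E| =
    (\int[m1]_x `|(f x)%:E|) * (\int[m2]_y `|(g y)%:E|))%E.
  rewrite -ge0_integralZr//=.
  - apply: eq_integral => x _; rewrite -ge0_integralZl//=.
    + by apply: eq_integral => y _; rewrite normrM EFinM.
    + by apply/measurable_EFinP; exact: measurableT_comp.
  - by apply/measurable_EFinP; exact: measurableT_comp.
  - exact: integral_ge0.
by move: intf intg => /integrableP[_ ?] /integrableP[_ ?]; rewrite lte_mul_pinfty ?integral_ge0// ge0_fin_numE ?integral_ge0.
Qed.

Lemma Rintegral_prod d1 d2 (T1 : measurableType d1) (T2 : measurableType d2)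
    (R : realType) (m1 : {sigma_finite_measure set T1 -> \bar R})
    (m2 : {sigma_finite_measure set T2 -> \bar R}) (f : T1 -> R) (g : T2 -> R) :
  m1.-integrable setT (EFin \o f) -> m2.-integrable setT (EFin \o g) ->
  \int[(m1 \x m2)%E]_p (f p.1 * g p.2) = (\int[m1]_x f x) * (\int[m2]_y g y).
Proof.
move=> intf intg; rewrite {1}/Rintegral -(integral12_prod_meas1 (integrable_prod intf intg))/=.
rewrite /fubini_F/=.
under eq_integral => x _.
  rewrite (_ : (\int[m2]_y (f x * g y)%:E = (f x)%:E * (\int[m2]_y g y)%:E)%E); last first.
    rewrite /Rintegral fineK ?integrable_fin_num// -integralZl//.
  over.
rewrite integralZr// fineM// ?integrable_fin_num//.
Qed.

(** Since P has mass 1, a bound h y uniform in the second argument dominates over the product space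
    and also bounds the P-averages. The measurability and bound clauses are what dominated
    convergence in y will ask for. *)
Lemma Rintegral_dominated_swap d (T : measurableType d) dE (E : measurableType dE)
    dY (Y : measurableType dY) (R : realType) (P : probability T R)
    (nu : {sigma_finite_measure set Y -> \bar R})
    (z : T -> E) (g : Y -> E -> R) (h : Y -> R) :
  measurable_fun setT z ->
  measurable_fun setT (fun p : Y * E => g p.1 p.2) ->
  nu.-integrable setT (EFin \o h) -> (forall y e, `|g y e| <= h y) ->
  [/\ measurable_fun setT (fun y => \int[P]_w g y (z w)),
    forall y, `|\int[P]_w g y (z w)| <= h y,
    measurable_fun setT (fun w => \int[nu]_y g y (z w)) &
    \int[P]_w (\int[nu]_y g y (z w)) = \int[nu]_y (\int[P]_w g y (z w))].
Proof.
move=> mz mg ih gh.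
have mG : measurable_fun setT (fun p : Y * T => g p.1 (z p.2)).
  have mp : measurable_fun setT (fun p : Y * T => (p.1, z p.2)).
    by apply: measurable_fun_pair => //; exact: measurableT_comp.
  exact: (measurableT_comp mg mp).
have iG : (nu \x P)%E.-integrable setT (fun p : Y * T => (g p.1 (z p.2))%:E).
  have i1 : P.-integrable setT (EFin \o cst 1) by exact: finite_measure_integrable_cst.
  apply: le_integrable (integrable_prod ih i1) => //.
    exact/measurable_EFinP.
  by move=> p _; rewrite /= lee_fin mulr1 (le_trans (gh _ _))// ler_norm.
have iw y : P.-integrable setT (fun w => (g y (z w))%:E).
  apply: (@integrable_bounded _ _ _ P (fun w => g y (z w)) (h y)) => //.
  exact: (measurableT_comp mG (pair1_measurable y)).
have iy w : nu.-integrable setT (fun y => (g y (z w))%:E).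
  apply: le_integrable ih => //.
    by apply/measurable_EFinP; exact: (measurableT_comp mG (measurable_pair2 w)).
  by move=> y _; rewrite /= lee_fin (le_trans (gh _ _))// ler_norm.
split.
- have := measurable_fubini_F iG; rewrite /fubini_F => m.
  exact: (measurableT_comp (fine_measurable measurableT) m).
- move=> y; rewrite (le_trans (le_normr_Rintegral measurableT (iw y)))//.
  apply: (@le_trans _ _ (\int[P]_w h y)).
    apply: le_Rintegral => //.
    + exact: (integrable_norm (iw y)).
    + exact: finite_measure_integrable_cst.
  by rewrite Rintegral_probability_cst.
- have := measurable_fubini_G iG; rewrite /fubini_G => m.
  exact: (measurableT_comp (fine_measurable measurableT) m).
- have := @Rintegral_swap _ _ _ _ _ nu P (fun p => g p.1 (z p.2)) iG iw iy.
  by move=> /= ->.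
Qed.

(* Fubini moves the average outside, where dominated convergence with respect to
   the averaging measure applies. *)
Lemma cvg_expectation_average d (T : measurableType d) d' (T' : measurableType d')
    dE (E : measurableType dE) dY (Y : measurableType dY) (R : realType)
    (P : probability T R) (Q : probability T' R)
    (nu : {sigma_finite_measure set Y -> \bar R})
    (Z : nat -> T -> E) (z : T' -> E) (g : Y -> E -> R) (h : Y -> R) :
  (forall n, measurable_fun setT (Z n)) -> measurable_fun setT z ->
  measurable_fun setT (fun p : Y * E => g p.1 p.2) ->
  nu.-integrable setT (EFin \o h) -> (forall y e, `|g y e| <= h y) ->
  (forall y, \int[P]_w g y (Z n w) @[n --> \oo] --> \int[Q]_w g y (z w)) ->
  \int[P]_w (\int[nu]_y g y (Z n w)) @[n --> \oo] --> \int[Q]_w (\int[nu]_y g y (z w)).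
Proof.
move=> mZ mz mg ih gh gcv.
have sP n := Rintegral_dominated_swap P (mZ n) mg ih gh.
have [mQ bQ _ EQ] := Rintegral_dominated_swap Q mz mg ih gh.
have EP n : \int[P]_w (\int[nu]_y g y (Z n w)) = \int[nu]_y (\int[P]_w g y (Z n w)).
  by have [_ _ _ ->] := sP n.
rewrite EQ (eq_cvg _ _ EP).
have iQ : nu.-integrable setT (fun y => (\int[Q]_w g y (z w))%:E).
  apply: le_integrable ih => //; first exact/measurable_EFinP.
  by move=> y _; rewrite /= lee_fin (le_trans (bQ _))// ler_norm.
apply: fine_cvg; rewrite fineK; last exact: integrable_fin_num.
apply: (@dominated_cvg _ _ _ nu setT measurableT _ _ (EFin \o h)) => //=.
- by move=> n; apply/measurable_EFinP; have [] := sP n.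
- by move=> y _; apply: cvg_EFin; [exact: nearW|exact: gcv].
- by move=> n y _; rewrite lee_fin; have [_ + _ _] := sP n; exact.
Qed.

(** * Lebesgue measure on the plane *)

Section plane_measure.
Context (R : realType).
Local Notation mu := (@lebesgue_measure R).

(** Named so that the product carries its own sigma-finite structure, which the averaging lemmas
    require of the measure they integrate against. *)
Definition plane_measure := (mu \x mu)%E.

HB.instance Definition _ := Measure.on plane_measure.

Lemma plane_measure_sigma_finite : sigma_finite setT plane_measure.
Proof.
exists (fun n => `[- n%:R, n%:R]%classic `*` `[- n%:R, n%:R]%classic).
  apply/esym; rewrite -subTset => -[x y] _.
  pose K := Num.max `|x| `|y|.
  have [n Kn] : exists n, K <= n%:R by exists (Num.truncn K).+1; rewrite ltW ?truncnS_gt.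
  exists n => //=; rewrite !in_itv/= -!ler_norml.
  by move: Kn; rewrite ge_max => /andP[].
move=> n; split; first exact: measurableX.
have mn : (mu `[(- n%:R)%R, n%:R%R]%classic < +oo)%E.
  by rewrite lebesgue_measure_itv; case: ifPn => // _; rewrite -EFinB ltry.
rewrite /plane_measure product_measure1E//.
by rewrite lte_mul_pinfty// ge0_fin_numE.
Qed.

HB.instance Definition _ := Measure_isSigmaFinite.Build _ _ _ plane_measure
  plane_measure_sigma_finite.

End plane_measure.

(** * From cosines to test functions with bounded support *)

(** Fourier self-duality: by [normal_cos] the cosine transform of N(0, 1 / s^2) at e - y is exp (-
    (e - y)^2 / (2 s^2)), and [normal_peak s] restores the normalisation. A Gaussian bump thus
    becomes an average of cosines. *)
Lemma normal_pdf_gauss_kernel (R : realType) (s e y t : R) : s != 0 ->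
  \int[@lebesgue_measure R]_x (cos (x * (e - y)) * (normal_peak s * normal_pdf 0 s^-1 x))
  = normal_pdf e s y.
Proof.
move=> s0.
have si0 : s^-1 != 0 by rewrite invr_eq0.
transitivity (normal_peak s * \int[@lebesgue_measure R]_x (cos ((e - y) * (x - 0) + 0) * normal_pdf 0 s^-1 x)).
  rewrite -RintegralZl//.
    by apply: eq_Rintegral => x _; rewrite subr0 addr0 (mulrC x) mulrCA.
  have [mc _] := measurable_affine_cos 0 (e - y) 0.
  apply: (@integrable_dominated_normal _ 0 s^-1 _ 1) => //.
    by apply: measurable_funM => //; exact: measurable_normal_pdf.
  move=> x; rewrite normrM (ger0_norm (normal_pdf_ge0 _ _ _)) mul1r.
  rewrite ler_wpM2r ?normal_pdf_ge0// (@le_trans _ _ 1)// ?lerDl ?sqr_ge0//.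
  by rewrite ler_norml cos_le1 cos_geN1.
rewrite normal_cos// cos0 mulr1 (normal_pdfE _ s0) /normal_fun; congr (_ * expR _).
by field.
Qed.

Lemma measurable_cos (R : realType) : measurable_fun setT (@cos R).
Proof. by apply: continuous_measurable_fun; exact: continuous_cos. Qed.

Lemma integrable_cos_normal (R : realType) (s z c : R) : s != 0 ->
  (@lebesgue_measure R).-integrable setT (EFin \o (fun x => cos (x * z) * (c * normal_pdf 0 s x))).
Proof.
move=> s0; apply: (@integrable_dominated_normal _ 0 s _ `|c|) => //.
  apply: measurable_funM.
    by apply: (measurableT_comp (@measurable_cos R)); exact: measurable_funM.
  by apply: measurable_funM => //; exact: measurable_normal_pdf.
move=> x; rewrite !normrM (ger0_norm (normal_pdf_ge0 _ _ _)) subr0 mulrA.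
rewrite ler_wpM2r ?normal_pdf_ge0// mulrC ler_wpM2l//.
by rewrite (@le_trans _ _ 1)// ?lerDl ?sqr_ge0// ler_norml cos_le1 cos_geN1.
Qed.

Section vague.
Context d (T : measurableType d) d' (T' : measurableType d') (R : realType)
  (P : probability T R) (Q : probability T' R)
  (U W : nat -> T -> R) (xi eta : T' -> R).
Hypothesis mU : forall n, measurable_fun setT (U n).
Hypothesis mW : forall n, measurable_fun setT (W n).
Hypothesis mxi : measurable_fun setT xi.
Hypothesis meta : measurable_fun setT eta.
Hypothesis cos_cvg : forall t1 t2 b : R,
  \int[P]_w cos (t1 * U n w + t2 * W n w + b) @[n --> \oo] -->
  \int[Q]_w cos (t1 * xi w + t2 * eta w + b).

Local Notation mu := (@lebesgue_measure R).
Local Notation mR := (measurableTypeR R).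

Let Z n w : (mR * mR)%type := (U n w, W n w).
Let z w : (mR * mR)%type := (xi w, eta w).

Let mZ n : measurable_fun setT (Z n).
Proof. by apply: measurable_fun_pair; [exact: mU|exact: mW]. Qed.

Let mz : measurable_fun setT z.
Proof. by apply: measurable_fun_pair; [exact: mxi|exact: meta]. Qed.

Let integrable_cosf d0 (T0 : measurableType d0) (P0 : probability T0 R) (u v : T0 -> R) t1 t2 b :
  measurable_fun setT u -> measurable_fun setT v ->
  P0.-integrable setT (EFin \o (fun w => cos (t1 * u w + t2 * v w + b))).
Proof.
move=> mu_ mv; apply: (@integrable_bounded _ _ _ _ _ 1).
  apply: (measurableT_comp (@measurable_cos R)).
  by do !apply: measurable_funD => //; apply: measurable_funM.
by move=> x; rewrite ler_norml cos_le1 cos_geN1.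
Qed.

(** A product of cosines is half the sum of two cosines, of the sum and of the difference; the
    shifts y1 and y2 are absorbed by the phase in [cos_cvg]. *)
Let cos_cos_cvg (t1 t2 y1 y2 : R) :
  \int[P]_w (cos (t1 * (U n w - y1)) * cos (t2 * (W n w - y2))) @[n --> \oo] -->
  \int[Q]_w (cos (t1 * (xi w - y1)) * cos (t2 * (eta w - y2))).
Proof.
have E d0 (T0 : measurableType d0) (P0 : probability T0 R) (u v : T0 -> R) :
    measurable_fun setT u -> measurable_fun setT v ->
    \int[P0]_w (cos (t1 * (u w - y1)) * cos (t2 * (v w - y2))) =
    2^-1 * (\int[P0]_w cos (t1 * u w + t2 * v w + - (t1 * y1 + t2 * y2)) +
            \int[P0]_w cos (t1 * u w + (- t2) * v w + (t2 * y2 - t1 * y1))).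
  move=> mu_ mv; rewrite -RintegralD//; try exact: integrable_cosf.
  rewrite -RintegralZl//.
    apply: eq_Rintegral => w _.
    have -> : t1 * u w + t2 * v w + - (t1 * y1 + t2 * y2) = t1 * (u w - y1) + t2 * (v w - y2) by ring.
    have -> : t1 * u w + (- t2) * v w + (t2 * y2 - t1 * y1) = t1 * (u w - y1) - t2 * (v w - y2) by ring.
    by rewrite cosD cosB; field.
  have := integrableD measurableT (integrable_cosf P0 t1 t2 (- (t1 * y1 + t2 * y2)) mu_ mv)
   (integrable_cosf P0 t1 (- t2) (t2 * y2 - t1 * y1) mu_ mv).
  by [].
rewrite E// (eq_cvg _ _ (fun n => E _ _ P _ _ (mU n) (mW n))).
by apply: cvgM; [exact: cvg_cst|apply: cvgD; exact: cos_cvg].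
Qed.

Let kernel s (y e : mR * mR) := normal_pdf e.1 s y.1 * normal_pdf e.2 s y.2.

(** First averaging, over frequencies: in each coordinate the kernel is a normal average of cosines
    in e. *)
Let kernel_cvg (s : R) y : s != 0 ->
  \int[P]_w kernel s y (Z n w) @[n --> \oo] --> \int[Q]_w kernel s y (z w).
Proof.
move=> s0; have si0 : s^-1 != 0 by rewrite invr_eq0.
pose N := fun x : R => normal_peak s * normal_pdf 0 s^-1 x.
pose g (t e : mR * mR) := (cos (t.1 * (e.1 - y.1)) * N t.1) * (cos (t.2 * (e.2 - y.2)) * N t.2).
have gE e : kernel s y e = \int[@plane_measure R]_t g t e.
  have := Rintegral_prod (integrable_cos_normal (e.1 - y.1) (normal_peak s) si0)
    (integrable_cos_normal (e.2 - y.2) (normal_peak s) si0).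
  by rewrite !normal_pdf_gauss_kernel.
have EQ : \int[Q]_w kernel s y (z w) = \int[Q]_w \int[@plane_measure R]_t g t (z w).
  by apply: eq_Rintegral => w _; exact: gE.
have EP n : \int[P]_w kernel s y (Z n w) = \int[P]_w \int[@plane_measure R]_t g t (Z n w).
  by apply: eq_Rintegral => w _; exact: gE.
suff H : \int[P]_w \int[@plane_measure R]_t g t (Z n w) @[n --> \oo] --> \int[Q]_w \int[@plane_measure R]_t g t (z w).
  by rewrite EQ (eq_cvg _ _ EP); exact: H.
have iN : mu.-integrable setT (EFin \o N).
  have := integrable_cos_normal 0 (normal_peak s) si0.
  by congr integrable; apply/funext => x /=; rewrite mulr0 cos0 mul1r.
have N0 x : 0 <= N x by rewrite mulr_ge0 ?normal_peak_ge0 ?normal_pdf_ge0.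
have HH := (@cvg_expectation_average _ _ _ _ _ _ _ _ _ _ _ (@plane_measure R) Z z g (fun t => N t.1 * N t.2)).
apply: HH => //.
- have mN : measurable_fun setT N by apply: measurable_funM => //; exact: measurable_normal_pdf.
  have m1 : measurable_fun setT (fst : mR * mR -> mR) by exact: measurable_fst.
  have m2 : measurable_fun setT (snd : mR * mR -> mR) by exact: measurable_snd.
  have m3 : measurable_fun setT (fst : (mR * mR) * (mR * mR) -> mR * mR) by exact: measurable_fst.
  have m4 : measurable_fun setT (snd : (mR * mR) * (mR * mR) -> mR * mR) by exact: measurable_snd.
  apply: measurable_funM; apply: measurable_funM.
  + apply: (measurableT_comp (@measurable_cos R)); apply: measurable_funM; first exact: (measurableT_comp m1 m3).
    by apply: measurable_funB => //; exact: (measurableT_comp m1 m4).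
  + exact: (measurableT_comp mN (measurableT_comp m1 m3)).
  + apply: (measurableT_comp (@measurable_cos R)); apply: measurable_funM; first exact: (measurableT_comp m2 m3).
    by apply: measurable_funB => //; exact: (measurableT_comp m2 m4).
  + exact: (measurableT_comp mN (measurableT_comp m2 m3)).
- exact: integrable_prod.
- move=> t e; rewrite /g mulrACA normrM (ger0_norm (mulr_ge0 (N0 _) (N0 _))).
  apply: ler_piMl; first exact: (mulr_ge0 (N0 _) (N0 _)).
  by rewrite normrM mulr_ile1// ler_norml cos_le1 cos_geN1.
- move=> t.
  have E d0 (T0 : measurableType d0) (P0 : probability T0 R) (v : T0 -> mR * mR) :
      measurable_fun setT v ->
      \int[P0]_w g t (v w) = N t.1 * N t.2 *
       \int[P0]_w (cos (t.1 * ((v w).1 - y.1)) * cos (t.2 * ((v w).2 - y.2))).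
    move=> mv; rewrite -RintegralZl//.
      by apply: eq_Rintegral => w _; rewrite /g; ring.
    apply: (@integrable_bounded _ _ _ _ _ 1).
      apply: measurable_funM; apply: (measurableT_comp (@measurable_cos R)).
        apply: measurable_funM => //; apply: measurable_funB => //.
        exact: (measurableT_comp measurable_fst mv).
      apply: measurable_funM => //; apply: measurable_funB => //.
      exact: (measurableT_comp measurable_snd mv).
    by move=> w; rewrite normrM mulr_ile1// ler_norml cos_le1 cos_geN1.
  rewrite E// (eq_cvg _ _ (fun n => E _ _ P _ (mZ n))).
  by apply: cvgM; [exact: cvg_cst|exact: cos_cos_cvg].
Qed.

Section test_function.
Variables (f : mR * mR -> R) (M L : R).
Hypothesis mf : measurable_fun setT f.
Hypothesis fM : forall p, `|f p| <= M.
Hypothesis fL : forall p, f p != 0 -> `|p.1| <= L /\ `|p.2| <= L.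
Hypothesis f_uc : forall e : R, 0 < e -> exists2 del : R, 0 < del &
  forall p q : mR * mR, `|p.1 - q.1| <= del -> `|p.2 - q.2| <= del -> `|f p - f q| <= e.

Let M0 : 0 <= M.
Proof. exact: le_trans (normr_ge0 _) (fM (0, 0)). Qed.

(** The convolution of f with a Gaussian of width s, written as an integral over the centre y so
    that averaging applies a second time. *)
Let smooth s (e : mR * mR) := \int[@plane_measure R]_y (f y * kernel s y e).

Let kernel_ge0 s y e : 0 <= kernel s y e.
Proof. by rewrite mulr_ge0 ?normal_pdf_ge0. Qed.

Let integrable_kernel s e : (@plane_measure R).-integrable setT (EFin \o (kernel s ^~ e)).
Proof. by apply: integrable_prod; exact: integrable_normal_pdf. Qed.

Let Rint_pdf m s : \int[mu]_y normal_pdf m s y = 1.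
Proof. by rewrite /Rintegral integral_normal_pdf. Qed.

Let Rint_kernel s e : \int[@plane_measure R]_y kernel s y e = 1.
Proof.
have := Rintegral_prod (integrable_normal_pdf e.1 s) (integrable_normal_pdf e.2 s).
by rewrite !Rint_pdf mulr1.
Qed.

Let sqr_pdf_integrable m s : s != 0 ->
  mu.-integrable setT (EFin \o (fun y => (y - m) ^+ 2 * normal_pdf m s y)).
Proof.
move=> s0; apply: (@integrable_dominated_normal _ m s _ 1) => //.
  apply: measurable_funM; last exact: measurable_normal_pdf.
  by apply: measurable_funX; exact: measurable_funB.
move=> y; rewrite mul1r ger0_norm; last first.
  by apply: mulr_ge0; [exact: sqr_ge0|exact: normal_pdf_ge0].
by rewrite ler_wpM2r ?normal_pdf_ge0// lerDr.
Qed.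

Let sqr_pdf_le m (s : R) : s != 0 ->
  \int[mu]_y ((y - m) ^+ 2 * normal_pdf m s y) <= 8 * s ^+ 2 * expR 2^-1.
Proof.
move=> s0; rewrite -lee_fin /Rintegral fineK; first exact: normal_sqr_integral.
by apply: integrable_fin_num => //; exact: sqr_pdf_integrable.
Qed.

(** Close points contribute at most e / 2 and distant ones at most 2 M, so the difference of two
    values of f is at most e / 2 plus a multiple of the squared distance, whose Gaussian average is
    of order s^2. The width s works for all p at once. *)
Let smooth_close (e : R) : 0 < e -> exists2 s : R, s != 0 & forall p, `|smooth s p - f p| <= e.
Proof.
move=> e0.
have combine (c i1 i2 t E : R) : 16 * c * E * t <= e / 2 -> c * i1 <= c * (8 * t * E) ->
  c * i2 <= c * (8 * t * E) -> e / 2 + c * i1 + c * i2 <= e by lra.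
have e20 : 0 < e / 2 by rewrite divr_gt0.
have [del del0 fdel] := f_uc e20.
(* As soon as one coordinate differs by more than del, C times its squared difference is at least 2
   M. *)
pose C := 2 * M / del ^+ 2.
have C0 : 0 <= C by apply: divr_ge0; [exact: mulr_ge0|exact: sqr_ge0].
have fC (p q : mR * mR) : `|f p - f q| <= e / 2 + C * ((p.1 - q.1) ^+ 2 + (p.2 - q.2) ^+ 2).
  have [h|h] := leP (`|p.1 - q.1|) del; last first.
    have : `|f p - f q| <= 2 * M.
      by rewrite (le_trans (ler_normB _ _))// mulr2n mulrDl mul1r lerD.
    have : 2 * M <= C * (p.1 - q.1) ^+ 2.
      rewrite /C -mulrA ler_peMr ?mulr_ge0// mulrC ler_pdivlMr ?exprn_gt0// mul1r.
      by rewrite -[leRHS]real_normK ?num_real//; nra.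
    have : 0 <= C * (p.2 - q.2) ^+ 2 by rewrite mulr_ge0 ?sqr_ge0.
    by rewrite mulrDr; lra.
  have [h'|h'] := leP (`|p.2 - q.2|) del; last first.
    have : `|f p - f q| <= 2 * M.
      by rewrite (le_trans (ler_normB _ _))// mulr2n mulrDl mul1r lerD.
    have : 2 * M <= C * (p.2 - q.2) ^+ 2.
      rewrite /C -mulrA ler_peMr ?mulr_ge0// mulrC ler_pdivlMr ?exprn_gt0// mul1r.
      by rewrite -[leRHS]real_normK ?num_real//; nra.
    have : 0 <= C * (p.1 - q.1) ^+ 2 by rewrite mulr_ge0 ?sqr_ge0.
    by rewrite mulrDr; lra.
  rewrite (le_trans (fdel _ _ h h'))// lerDl mulr_ge0// addr_ge0 ?sqr_ge0//.
(* Two coordinates, each with second moment at most 8 exp (1 / 2) s^2. *)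
pose B := 16 * C * expR 2^-1.
have B0 : 0 <= B by rewrite mulr_ge0 ?expR_ge0// mulr_ge0.
have [s s0 hs] : exists2 s : R, s != 0 & B * s ^+ 2 <= e / 2.
  (* The denominator 1 + B rather than B guards against B = 0. *)
  have BK : 0 < e / 2 / (1 + B) by rewrite divr_gt0// ltr_pwDl.
  exists (Num.sqrt (e / 2 / (1 + B))); first by rewrite gt_eqF// sqrtr_gt0.
  rewrite sqr_sqrtr ?ltW//.
  have B1 : 1 + B != 0 by rewrite gt_eqF// ltr_pwDl.
  by have := divfK B1 (e / 2); move: BK; set K := _ / (1 + B); nra.
exists s => // p.
have ik := integrable_kernel s p.
have ifk : (@plane_measure R).-integrable setT (EFin \o (fun y => f y * kernel s y p)).
  have iM : (@plane_measure R).-integrable setT (fun y => M%:E * (kernel s y p)%:E)%E.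
    exact: integrableZl.
  apply: le_integrable iM => //.
    apply/measurable_EFinP; apply: measurable_funM => //.
    by apply/measurable_EFinP; exact: measurable_int ik.
  move=> y _; rewrite /= lee_fin normrM [in leRHS]normrM ler_wpM2r//.
  by rewrite (le_trans (fM _))// ler_norm.
have ick : (@plane_measure R).-integrable setT (EFin \o (fun y => f p * kernel s y p)).
  by have := integrableZl measurableT (f p) ik.
pose g y := e / 2 * kernel s y p + C * ((y.1 - p.1) ^+ 2 * normal_pdf p.1 s y.1 * normal_pdf p.2 s y.2)
   + C * (normal_pdf p.1 s y.1 * ((y.2 - p.2) ^+ 2 * normal_pdf p.2 s y.2)).
have i1 := integrable_prod (sqr_pdf_integrable p.1 s0) (integrable_normal_pdf p.2 s).
have i2 := integrable_prod (integrable_normal_pdf p.1 s) (sqr_pdf_integrable p.2 s0).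
have v1 := Rintegral_prod (sqr_pdf_integrable p.1 s0) (integrable_normal_pdf p.2 s).
have v2 := Rintegral_prod (integrable_normal_pdf p.1 s) (sqr_pdf_integrable p.2 s0).
have j0 : (@plane_measure R).-integrable setT (EFin \o (fun y => e / 2 * kernel s y p)).
  by have := integrableZl measurableT (e / 2) ik.
have j1 : (@plane_measure R).-integrable setT (EFin \o (fun y : mR * mR => C * ((y.1 - p.1) ^+ 2 * normal_pdf p.1 s y.1 * normal_pdf p.2 s y.2))).
  by have := integrableZl measurableT C i1.
have j2 : (@plane_measure R).-integrable setT (EFin \o (fun y : mR * mR => C * (normal_pdf p.1 s y.1 * ((y.2 - p.2) ^+ 2 * normal_pdf p.2 s y.2)))).
  by have := integrableZl measurableT C i2.
have j01 : (@plane_measure R).-integrable setT (EFin \o (fun y : mR * mR => e / 2 * kernel s y p + C * ((y.1 - p.1) ^+ 2 * normal_pdf p.1 s y.1 * normal_pdf p.2 s y.2))).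
  by have := integrableD measurableT j0 j1.
have ig : (@plane_measure R).-integrable setT (EFin \o g).
  by have := integrableD measurableT j01 j2.
have -> : smooth s p - f p = \int[@plane_measure R]_y ((f y - f p) * kernel s y p).
  under [RHS]eq_Rintegral do rewrite mulrBl.
  rewrite RintegralB//; congr (_ - _).
  transitivity (f p * \int[@plane_measure R]_y kernel s y p); first by rewrite Rint_kernel mulr1.
  by rewrite -RintegralZl.
have id : (@plane_measure R).-integrable setT (EFin \o (fun y => (f y - f p) * kernel s y p)).
  have := integrableB measurableT ifk ick; congr integrable; apply/funext => y /=.
  by rewrite mulrBl EFinB.
apply: (le_trans (le_normr_Rintegral measurableT id)).
apply: (@le_trans _ _ (\int[@plane_measure R]_y g y)).
  apply: le_Rintegral => //; first exact: (integrable_norm id).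
  move=> y _; rewrite normrM (ger0_norm (kernel_ge0 _ _ _)).
  rewrite (le_trans (ler_wpM2r (kernel_ge0 _ _ _) (fC y p)))//.
  by rewrite /g /kernel le_eqVlt; apply/orP; left; apply/eqP; ring.
rewrite /g RintegralD// RintegralD// !RintegralZl// Rint_kernel.
have -> : \int[@plane_measure R]_x ((x.1 - p.1) ^+ 2 * normal_pdf p.1 s x.1 * normal_pdf p.2 s x.2) =
  \int[mu]_x ((x - p.1) ^+ 2 * normal_pdf p.1 s x) by rewrite -[RHS]mulr1 -(Rint_pdf p.2 s) -v1.
have -> : \int[@plane_measure R]_x (normal_pdf p.1 s x.1 * ((x.2 - p.2) ^+ 2 * normal_pdf p.2 s x.2)) =
  \int[mu]_x ((x - p.2) ^+ 2 * normal_pdf p.2 s x) by rewrite -[RHS]mul1r -(Rint_pdf p.1 s) -v2.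
have h1 := ler_wpM2l C0 (sqr_pdf_le p.1 s0).
have h2 := ler_wpM2l C0 (sqr_pdf_le p.2 s0).
move: hs h1 h2; rewrite /B mulr1.
move: (\int[mu]_x ((x - p.1) ^+ 2 * normal_pdf p.1 s x)) => I1.
move: (\int[mu]_x ((x - p.2) ^+ 2 * normal_pdf p.2 s x)) => I2.
exact: combine.
Qed.

(** A majorant in y that does not depend on e. The bounded support of f makes it integrable over the
    plane. *)
Let bound s (y : mR * mR) : R :=
  (M * normal_peak s ^+ 2 * \1_(`[- L, L]%classic) y.1) * \1_(`[- L, L]%classic) y.2.

Let integrable_itv : mu.-integrable setT (EFin \o (\1_(`[- L, L]%classic) : R -> R)).
Proof.
apply/integrableP; split; first by apply/measurable_EFinP; exact: measurable_indic.
under eq_integral do rewrite /= ger0_norm//.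
rewrite integral_indic// setIT.
change (mu `[(- L)%R, L%R]%classic < +oo)%E; rewrite lebesgue_measure_itv.
by case: ifPn => // _; rewrite -EFinB ltry.
Qed.

Let integrable_bound s : (@plane_measure R).-integrable setT (EFin \o bound s).
Proof.
have i1 : mu.-integrable setT (EFin \o (fun x => M * normal_peak s ^+ 2 * \1_(`[- L, L]%classic) x)).
  by have := integrableZl measurableT (M * normal_peak s ^+ 2) integrable_itv.
exact: (integrable_prod i1 integrable_itv).
Qed.

Let smooth_bound (s : R) y e : s != 0 -> `|f y * kernel s y e| <= bound s y.
Proof.
move=> s0; rewrite normrM (ger0_norm (kernel_ge0 _ _ _)).
have b0 : 0 <= bound s y.
  by rewrite /bound !indicE; apply: mulr_ge0 => //; apply: mulr_ge0 => //; apply: mulr_ge0 => //; exact: sqr_ge0.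
have [->|/fL[y1 y2]] := eqVneq (f y) 0; first by rewrite normr0 mul0r.
rewrite /bound !indicE !mem_set/= ?in_itv/= -?ler_norml// !mulr1 ler_pM//.
by rewrite expr2 ler_pM ?normal_pdf_ge0 ?normal_pdf_ub.
Qed.

Let measurable_smooth_fun (s : R) : s != 0 ->
  measurable_fun setT (fun p : (mR * mR) * (mR * mR) => f p.1 * kernel s p.1 p.2).
Proof.
move=> s0.
have mN : measurable_fun setT (normal_pdf (0 : R) s) by exact: measurable_normal_pdf.
have kE y e : kernel s y e = normal_pdf 0 s (y.1 - e.1) * normal_pdf 0 s (y.2 - e.2).
  by rewrite /kernel !normal_pdfE// /normal_fun !subr0.
have m1 : measurable_fun setT (fst : mR * mR -> mR) by exact: measurable_fst.
have m2 : measurable_fun setT (snd : mR * mR -> mR) by exact: measurable_snd.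
have m3 : measurable_fun setT (fst : (mR * mR) * (mR * mR) -> mR * mR) by exact: measurable_fst.
have m4 : measurable_fun setT (snd : (mR * mR) * (mR * mR) -> mR * mR) by exact: measurable_snd.
apply: measurable_funM; first exact: (measurableT_comp mf m3).
have mk : measurable_fun setT (fun p : (mR * mR) * (mR * mR) =>
    normal_pdf 0 s (p.1.1 - p.2.1) * normal_pdf 0 s (p.1.2 - p.2.2)).
  apply: measurable_funM; apply: (measurableT_comp mN); apply: measurable_funB.
  - exact: (measurableT_comp m1 m3).
  - exact: (measurableT_comp m1 m4).
  - exact: (measurableT_comp m2 m3).
  - exact: (measurableT_comp m2 m4).
by move: mk; congr measurable_fun; apply/funext => p; rewrite kE.
Qed.

(** Second averaging, over the centres y of the kernels, with weight f y. *)
Let smooth_cvg (s : R) : s != 0 ->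
  \int[P]_w smooth s (Z n w) @[n --> \oo] --> \int[Q]_w smooth s (z w).
Proof.
move=> s0.
have HH := @cvg_expectation_average _ _ _ _ _ _ _ _ _ P Q (@plane_measure R) Z z
  (fun y e => f y * kernel s y e) (bound s).
apply: HH => //.
- exact: measurable_smooth_fun.
- by move=> y e; exact: smooth_bound.
- move=> y.
  have E d0 (T0 : measurableType d0) (P0 : probability T0 R) (v : T0 -> mR * mR) :
      measurable_fun setT v ->
      \int[P0]_w (f y * kernel s y (v w)) = f y * \int[P0]_w kernel s y (v w).
    move=> mv; rewrite RintegralZl//.
    apply: (@integrable_bounded _ _ _ _ _ (normal_peak s ^+ 2)).
      have mN : measurable_fun setT (normal_pdf (0 : R) s) by exact: measurable_normal_pdf.
      have mk : measurable_fun setT (fun w => normal_pdf 0 s (y.1 - (v w).1) * normal_pdf 0 s (y.2 - (v w).2)).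
        apply: measurable_funM; apply: (measurableT_comp mN); apply: measurable_funB => //.
        - exact: (measurableT_comp measurable_fst mv).
        - exact: (measurableT_comp measurable_snd mv).
      move: mk; congr measurable_fun; apply/funext => w.
      by rewrite /kernel !normal_pdfE// /normal_fun !subr0.
    move=> w; rewrite (ger0_norm (kernel_ge0 _ _ _)).
    by rewrite expr2 ler_pM ?normal_pdf_ge0 ?normal_pdf_ub.
  rewrite E// (eq_cvg _ _ (fun n => E _ _ P _ (mZ n))).
  by apply: cvgM; [exact: cvg_cst|exact: kernel_cvg].
Qed.

(* The class of [g] for which the expectations converge contains the cosines; it is
   stable under averaging, hence contains Gaussian kernels (averages of cosines) and
   their convolutions with [f], which are uniformly close to [f]. *)
Lemma cvg_expectation_of_cos :
  \int[P]_w f (U n w, W n w) @[n --> \oo] --> \int[Q]_w f (xi w, eta w).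
Proof.
apply/cvgrPdist_le => e e0.
have e40 : 0 < e / 4 by rewrite divr_gt0.
have [s s0 hs] := smooth_close e40.
(* The same uniform bound serves under P and under Q; with the convergence for [smooth] this makes
   three errors of e / 4. *)
have close d0 (T0 : measurableType d0) (P0 : probability T0 R) (v : T0 -> mR * mR) :
    measurable_fun setT v ->
    `|\int[P0]_w smooth s (v w) - \int[P0]_w f (v w)| <= e / 4.
  move=> mv.
  have [_ _ ms _] := Rintegral_dominated_swap P0 mv (measurable_smooth_fun s0)
     (integrable_bound s) (fun y e => smooth_bound y e s0).
  have i1 : P0.-integrable setT (EFin \o (fun w => f (v w))).
    by apply: (@integrable_bounded _ _ _ _ _ M) => //; exact: (measurableT_comp mf mv).
  have i2 : P0.-integrable setT (EFin \o (fun w => smooth s (v w))).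
    apply: (@integrable_bounded _ _ _ _ _ (M + e / 4)) => //.
    move=> w; have := hs (v w); have := fM (v w).
    have := ler_normD (smooth s (v w) - f (v w)) (f (v w)); rewrite subrK; lra.
  rewrite -RintegralB//.
  have i3 : P0.-integrable setT (EFin \o (fun w => smooth s (v w) - f (v w))).
    by have := integrableB measurableT i2 i1.
  rewrite (le_trans (le_normr_Rintegral measurableT i3))//.
  rewrite -[leRHS](Rintegral_probability_cst P0) le_Rintegral//.
  - exact: (integrable_norm i3).
  - exact: finite_measure_integrable_cst.
have cQ := close _ _ Q z mz.
have /cvgrPdist_le/(_ _ e40) := smooth_cvg s0.
apply: filterS => n hn.
have cP := close _ _ P (Z n) (mZ n).
have := ler_normD (\int[Q]_w smooth s (z w) - \int[P]_w smooth s (Z n w))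
  ((\int[P]_w smooth s (Z n w) - \int[P]_w f (Z n w)) - (\int[Q]_w smooth s (z w) - \int[Q]_w f (z w))).
have := ler_normB (\int[P]_w smooth s (Z n w) - \int[P]_w f (Z n w)) (\int[Q]_w smooth s (z w) - \int[Q]_w f (z w)).
have -> : \int[Q]_w smooth s (z w) - \int[P]_w smooth s (Z n w) +
  (\int[P]_w smooth s (Z n w) - \int[P]_w f (Z n w) - (\int[Q]_w smooth s (z w) - \int[Q]_w f (z w))) =
  \int[Q]_w f (z w) - \int[P]_w f (Z n w) by ring.
move: hn cP cQ; rewrite /Z /z/=; lra.
Qed.

End test_function.
End vague.

(** * Weighted sums of independent variables *)

(** Rectangles form a generating pi-system that contains the whole space, where the mass is
    finite. *)
Lemma finite_measure_prod_eq d1 d2 (T1 : measurableType d1) (T2 : measurableType d2)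
    (R : realType) (m1 m2 : {measure set (T1 * T2) -> \bar R}) :
  (m1 setT < +oo)%E ->
  (forall A B, measurable A -> measurable B -> m1 (A `*` B) = m2 (A `*` B)) ->
  forall X, measurable X -> m1 X = m2 X.
Proof.
move=> m1oo h X mX.
pose C : set (set (T1 * T2)) :=
  [set A1 `*` A2 | A1 in measurable & A2 in measurable].
apply: (measure_unique C (fun=> setT)) => //.
- by rewrite measurable_prod_measurableType.
- move=> _ _ [A1 mA1 [A2 mA2 <-]] [B1 mB1 [B2 mB2 <-]].
  rewrite -setXI; exists (A1 `&` B1); first exact: measurableI.
  by exists (A2 `&` B2) => //; exact: measurableI.
- by move=> n; exists setT => //; exists setT => //; rewrite setXTT.
- by rewrite bigcup_const.
- by move=> _ [A1 mA1 [A2 mA2 <-]]; exact: h.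
Qed.

Section partial_sums.
Context d (T : measurableType d) (R : realType) (P : probability T R)
  (V : nat -> {RV P >-> R}).
Hypothesis indepV : mutually_independent [set i | (1 <= i)%N] V.

Definition weighted_sum (a : nat -> R) (m : nat) (w : T) : R :=
  \sum_(1 <= j < m.+1) a j * V j w.

Lemma weighted_sumS a m w :
  weighted_sum a m.+1 w = weighted_sum a m w + a m.+1 * V m.+1 w.
Proof. by rewrite /weighted_sum big_nat_recr. Qed.

Lemma measurable_weighted_sum a m : measurable_fun setT (weighted_sum a m).
Proof.
rewrite (_ : weighted_sum a m = (fun w => \sum_(1 <= j < m.+1) a j * V j w))//.
by apply: measurable_sum => j; apply: measurable_funM.
Qed.

HB.instance Definition _ a m := isMeasurableFun.Build _ _ _ _ (weighted_sum a m)
  (measurable_weighted_sum a m).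

Definition future_event (A : nat -> set R) (m N : nat) : set T :=
  \big[setI/setT]_(m.+1 <= i < N.+1) (V i @^-1` A i).

Lemma measurable_future_event A m N : (forall i, measurable (A i)) ->
  measurable (future_event A m N).
Proof.
move=> mA; rewrite /future_event; elim/big_ind : _ => //.
- exact: measurableI.
- by move=> i _; rewrite -[X in measurable X]setTI; exact: measurable_funPT.
Qed.

Lemma future_event_prob0 A N : (forall i, measurable (A i)) ->
  P (future_event A 0 N) = (\prod_(1 <= i < N.+1) P (V i @^-1` A i))%E.
Proof.
move=> mA.
pose J : {fset nat} := [fset x in index_iota 1 N.+1]%fset.
have pJ : perm_eq J (index_iota 1 N.+1).
  by apply: uniq_perm; rewrite ?iota_uniq ?fset_uniq// => x; rewrite in_fset.
rewrite -(perm_big _ pJ)/= -(indepV (J := J)) //.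
- rewrite /future_event -(perm_big _ pJ)/=; congr (P _).
  by rewrite bigcap_fset.
- by move=> i /=; rewrite in_fset mem_index_iota => /andP[].
Qed.

Lemma future_eventS A m N : (m < N)%N ->
  future_event A m N = (V m.+1 @^-1` A m.+1) `&` future_event A m.+1 N.
Proof. by move=> mN; rewrite /future_event big_ltn. Qed.

Lemma eq_future_event A A' m N : (forall i, (m < i)%N -> A i = A' i) ->
  future_event A m N = future_event A' m N.
Proof. by move=> AA'; apply: eq_big_nat => i /andP[mi _]; rewrite AA'. Qed.

(* Carrying the future events along is what makes the induction on [m] work with
   finite-dimensional product rules only, without generated sigma-algebras. *)
Lemma weighted_sum_joint_future a (m : nat) :
  (forall A N U, (m <= N)%N -> measurable U -> (forall i, measurable (A i)) ->
    P ((weighted_sum a m @^-1` U) `&` future_event A m N) =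
    (P (weighted_sum a m @^-1` U) * \prod_(m.+1 <= i < N.+1) P (V i @^-1` A i))%E) ->
  forall A N (X : set (R * R)), (m < N)%N -> (forall i, measurable (A i)) -> measurable X ->
    P ([set w | X (weighted_sum a m w, V m.+1 w)] `&` future_event A m.+1 N) =
    ((\prod_(m.+2 <= i < N.+1) P (V i @^-1` A i)) *
     (distribution P (weighted_sum a m) \x distribution P (V m.+1)) X)%E.
Proof.
move=> IH A N X mN mA mX.
have mB := measurable_future_event m.+1 N mA.
have mf : measurable_fun setT (fun w => (weighted_sum a m w, V m.+1 w)).
  by apply: measurable_fun_pair => //; exact: measurable_weighted_sum.
pose f : {mfun T >-> (R * R)%type} := mfun_Sub (mem_set mf).
have PE (U1 U2 : set R) : measurable U1 -> measurable U2 ->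
    P ([set w | (U1 `*` U2) (weighted_sum a m w, V m.+1 w)] `&` future_event A m.+1 N) =
    (P (weighted_sum a m @^-1` U1) * (P (V m.+1 @^-1` U2) *
       \prod_(m.+2 <= i < N.+1) P (V i @^-1` A i)))%E.
  (* Overriding slot m + 1 makes the constraint on [V m.+1] part of the future event, so the
     induction hypothesis factorises rectangles. *)
  move=> mU1 mU2; pose A' i := if i == m.+1 then U2 else A i.
  have mA' i : measurable (A' i) by rewrite /A'; case: ifP.
  have A'E i : (m.+1 < i)%N -> A' i = A i by rewrite /A'; case: eqP => // ->; rewrite ltnn.
  have := IH A' N U1 (ltnW mN) mU1 mA'.
  rewrite future_eventS// big_ltn// (eq_future_event _ A'E) {1 2}/A' eqxx.
  have -> : (\prod_(m.+2 <= i < N.+1) P (V i @^-1` A' i) =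
      \prod_(m.+2 <= i < N.+1) P (V i @^-1` A i))%E.
    by apply: eq_big_nat => i /andP[mi _]; rewrite A'E.
  by move=> <-; congr (P _); rewrite setIA.
pose k : {nonneg R} := NngNum (fine_ge0 (measure_ge0 P (future_event A m.+1 N))).
have PB : P (future_event A m.+1 N) = (\prod_(m.+2 <= i < N.+1) P (V i @^-1` A i))%E.
  have := PE setT setT measurableT measurableT.
  rewrite !preimage_setT !probability_setT !mul1e => <-; congr (P _).
  by apply/seteqP; split => w //= [].
have kE : (k%:num%:E = \prod_(m.+2 <= i < N.+1) P (V i @^-1` A i))%E.
  by rewrite -PB /k/= fineK// fin_num_measure.
rewrite -kE.
(* The law of the pair restricted to the future event, against the product law scaled by the
   probability of that event: two measures that agree on rectangles. *)
pose m1 := pushforward (mrestr P mB) f.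
pose m2 := mscale k (distribution P (weighted_sum a m) \x distribution P (V m.+1))%E.
have := @finite_measure_prod_eq _ _ _ _ R m1 m2; apply => //.
- apply: (@le_lt_trans _ _ 1%E); last exact: ltry.
  apply: probability_le1; apply: measurableI => //.
  exact: measurableT.
- move=> U1 U2 mU1 mU2.
  apply: (@etrans _ _ (k%:num%:E *
      (P (weighted_sum a m @^-1` U1) * P (V m.+1 @^-1` U2)))%E).
    by apply: (etrans (PE U1 U2 mU1 mU2)); rewrite kE muleA; exact: muleC.
  by apply/esym; congr (_ * _)%E; exact: product_measure1E.
Qed.

(** Induction on m: the next partial sum lying in U is an event about the pair formed by the current
    partial sum and the next variable, whose law together with the future is given by
    [weighted_sum_joint_future]. *)
Lemma weighted_sum_future a (m : nat) A N U : (m <= N)%N ->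
  measurable U -> (forall i, measurable (A i)) ->
    P ((weighted_sum a m @^-1` U) `&` future_event A m N) =
    (P (weighted_sum a m @^-1` U) * \prod_(m.+1 <= i < N.+1) P (V i @^-1` A i))%E.
Proof.
elim: m A N U => [|m IH] A N U mN mU mA.
  have E w : weighted_sum a 0 w = 0 by rewrite /weighted_sum big_geq.
  have [U0|U0] := pselect (U 0).
    have -> : weighted_sum a 0 @^-1` U = setT.
      by apply/seteqP; split => w // _; rewrite /preimage/= E.
    by rewrite setTI probability_setT mul1e future_event_prob0.
  have -> : weighted_sum a 0 @^-1` U = set0.
    by apply/seteqP; split => w //; rewrite /preimage/= E.
  by rewrite set0I measure0 mul0e.
pose X : set (R * R) := [set p | U (p.1 + a m.+1 * p.2)].
have mX : measurable X.
  rewrite -[X in measurable X]setTI; apply: (_ : measurable_fun setT (fun p : R * R => p.1 + a m.+1 * p.2)) => //.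
  by apply: measurable_funD => //; apply: measurable_funM.
have XE : weighted_sum a m.+1 @^-1` U = [set w | X (weighted_sum a m w, V m.+1 w)].
  by apply/seteqP; split => w; rewrite /preimage/= weighted_sumS.
have J := weighted_sum_joint_future IH.
rewrite XE J// muleC; congr (_ * _)%E.
(* The case N = m + 1, without any future constraint, turns the product measure of X back into a
   probability. *)
have := J A m.+1 X (leqnn _) mA mX.
by rewrite big_geq// mul1e => <-; rewrite /future_event big_geq// setIT.
Qed.

Lemma weighted_sum_joint a m (X : set (R * R)) : measurable X ->
  P [set w | X (weighted_sum a m w, V m.+1 w)] =
  (distribution P (weighted_sum a m) \x distribution P (V m.+1))%E X.
Proof.
move=> mX.
have := @weighted_sum_joint_future a m (@weighted_sum_future a m) (fun=> setT) m.+1 X (leqnn _) (fun=> measurableT) mX.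
by rewrite big_geq// mul1e => <-; rewrite /future_event big_geq// setIT.
Qed.

(** Tonelli for the product law. With [w] frozen, [V m.+1] at [w'] plays the role of an independent
    copy, so conditioning on the past is an iterated integral over the same space. *)
Lemma ge0_integral_indep_copy a m (h : R * R -> R) :
  measurable_fun setT h -> (forall p, 0 <= h p) ->
  (\int[P]_w (h (weighted_sum a m w, V m.+1 w))%:E =
   \int[P]_w \int[P]_w' (h (weighted_sum a m w, V m.+1 w'))%:E)%E.
Proof.
move=> mh h0.
have mf : measurable_fun setT (fun w => (weighted_sum a m w, V m.+1 w)).
  by apply: measurable_fun_pair => //; exact: measurable_weighted_sum.
pose f : {mfun T >-> (R * R)%type} := mfun_Sub (mem_set mf).
have mhE : measurable_fun setT (EFin \o h) by exact/measurable_EFinP.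
have mh1 s : measurable_fun setT (fun v => (h (s, v))%:E).
  by apply/measurable_EFinP; exact: (measurableT_comp mh (pair1_measurable s)).
transitivity (\int[pushforward P f]_p (h p)%:E)%E.
  by rewrite ge0_integral_pushforward//= => p _; rewrite lee_fin.
transitivity (\int[(distribution P (weighted_sum a m) \x distribution P (V m.+1))%E]_p (h p)%:E)%E.
  by apply: eq_measure_integral => X mX _; exact: weighted_sum_joint.
rewrite fubini_tonelli1//=.
rewrite /fubini_F/= ge0_integral_distribution//=.
- apply: eq_integral => w _; rewrite ge0_integral_distribution//=.
  by move=> v; rewrite lee_fin.
- by apply: (measurable_fun_fubini_tonelli_F (EFin \o h)).
- by move=> s; apply: integral_ge0 => v _; rewrite lee_fin.
Qed.

Lemma integrable_indep_copy a m (h : R * R -> R) (c : R) :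
  measurable_fun setT h -> (forall p, `|h p| <= c) ->
  P.-integrable setT (EFin \o (fun w => \int[P]_w' h (weighted_sum a m w, V m.+1 w'))).
Proof.
move=> mh hc.
have icst : P.-integrable setT (EFin \o cst c) by exact: finite_measure_integrable_cst.
have i2 s : P.-integrable setT (EFin \o (fun w => h (s, V m.+1 w))).
  apply: (@integrable_bounded _ _ _ _ _ c) => //.
  by apply: (measurableT_comp mh); apply: measurable_fun_pair.
have hc0 p : 0 <= h p + c by have := hc p; rewrite ler_norml => /andP[]; lra.
have E s : (\int[P]_w' (h (s, V m.+1 w') + c)%:E = (\int[P]_w' h (s, V m.+1 w') + c)%:E)%E.
  rewrite -[in RHS](Rintegral_probability_cst P c) -RintegralD// fineK//.
  apply: integrable_fin_num => //.
  by have := integrableD measurableT (i2 s) icst.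
have mhs : measurable_fun setT (fun s => \int[P]_w' (h (s, V m.+1 w') + c)%:E)%E.
  have mg : measurable_fun setT (fun p : R * T => (h (p.1, V m.+1 p.2) + c)%:E).
    apply/measurable_EFinP; apply: measurable_funD => //; apply: (measurableT_comp mh).
    by apply: measurable_fun_pair => //; apply: measurableT_comp.
  by apply: (measurable_fun_fubini_tonelli_F _ mg) => p; rewrite lee_fin.
have mI : measurable_fun setT (fun w => \int[P]_w' h (weighted_sum a m w, V m.+1 w')).
  have mk : measurable_fun setT (fun w => fine (\int[P]_w' (h (weighted_sum a m w, V m.+1 w') + c)%:E) - c).
    apply: measurable_funB => //; apply: (measurableT_comp (fine_measurable measurableT)).
    exact: (measurableT_comp mhs (measurable_weighted_sum a m)).
  by move: mk; congr measurable_fun; apply/funext => w; rewrite E/= addrK.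
apply: (@integrable_bounded _ _ _ _ _ c) => // w.
rewrite (le_trans (le_normr_Rintegral measurableT (i2 _)))//.
rewrite -[leRHS](Rintegral_probability_cst P) le_Rintegral//.
exact: (integrable_norm (i2 _)).
Qed.

Lemma Rintegral_indep_copy a m (h : R * R -> R) (c : R) :
  measurable_fun setT h -> (forall p, `|h p| <= c) ->
  \int[P]_w h (weighted_sum a m w, V m.+1 w) =
  \int[P]_w \int[P]_w' h (weighted_sum a m w, V m.+1 w').
Proof.
move=> mh hc.
have mf : measurable_fun setT (fun w => (weighted_sum a m w, V m.+1 w)).
  by apply: measurable_fun_pair => //; exact: measurable_weighted_sum.
have mhf : measurable_fun setT (fun w => h (weighted_sum a m w, V m.+1 w)).
  exact: (measurableT_comp mh mf).
have icst : P.-integrable setT (EFin \o cst c) by exact: finite_measure_integrable_cst.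
have i1 : P.-integrable setT (EFin \o (fun w => h (weighted_sum a m w, V m.+1 w))).
  exact: (@integrable_bounded _ _ _ _ _ c).
have i2 s : P.-integrable setT (EFin \o (fun w => h (s, V m.+1 w))).
  apply: (@integrable_bounded _ _ _ _ _ c) => //.
  by apply: (measurableT_comp mh); apply: measurable_fun_pair.
(* Adding c makes the bounded integrand nonnegative, which reduces to the Tonelli version. *)
have hc0 p : 0 <= h p + c by have := hc p; rewrite ler_norml => /andP[]; lra.
have mhc : measurable_fun setT (fun p => h p + c) by exact: measurable_funD.
have := @ge0_integral_indep_copy a m (fun p => h p + c) mhc hc0.
move=> /(congr1 fine).
have -> : fine (\int[P]_w (h (weighted_sum a m w, V m.+1 w) + c)%:E)%E =
    \int[P]_w h (weighted_sum a m w, V m.+1 w) + c.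
  by rewrite -[fine _]/(\int[P]_w _) RintegralD// Rintegral_probability_cst.
have E s : (\int[P]_w' (h (s, V m.+1 w') + c)%:E = (\int[P]_w' h (s, V m.+1 w') + c)%:E)%E.
  rewrite -[in RHS](Rintegral_probability_cst P c) -RintegralD// fineK//.
  apply: integrable_fin_num => //.
  by have := integrableD measurableT (i2 s) icst.
under eq_integral do rewrite E.
have i3 := integrable_indep_copy a m mh hc.
rewrite -[X in _ = X]/(\int[P]_w _) RintegralD// Rintegral_probability_cst.
by move=> /addIr.
Qed.

(** * Variance of weighted sums *)

Section second_moment.
Variable s2 : R.
Hypothesis iV : forall i, (1 <= i)%N -> P.-integrable setT (EFin \o V i).
Hypothesis iV2 : forall i, (1 <= i)%N -> P.-integrable setT (EFin \o (fun w => V i w ^+ 2)).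
Hypothesis EV : forall i, (1 <= i)%N -> \int[P]_w V i w = 0.
Hypothesis EV2 : forall i, (1 <= i)%N -> \int[P]_w (V i w ^+ 2) = s2.

(** Induction with the last variable replaced by its copy: centring removes the cross term in the
    inner integral, so the variances add. *)
Lemma weighted_sum_sqr a m :
  (\int[P]_w (weighted_sum a m w ^+ 2)%:E = (s2 * \sum_(1 <= j < m.+1) a j ^+ 2)%:E)%E.
Proof.
elim: m => [|m IH].
  rewrite big_geq// mulr0; under eq_integral do rewrite /weighted_sum big_geq// expr0n/=.
  exact: integral0.
pose h (p : R * R) := (p.1 + a m.+1 * p.2) ^+ 2.
have mh : measurable_fun setT h.
  by apply: measurable_funX; apply: measurable_funD => //; apply: measurable_funM.
under eq_integral do rewrite weighted_sumS.
rewrite (@ge0_integral_indep_copy a m h mh) ?/h/=; last by move=> p; exact: sqr_ge0.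
have i1 := iV (ltn0Sn m); have i2 := iV2 (ltn0Sn m).
have E s : (\int[P]_w' ((s + a m.+1 * V m.+1 w') ^+ 2)%:E = (s ^+ 2)%:E + (s2 * a m.+1 ^+ 2)%:E)%E.
  have j1 : P.-integrable setT (EFin \o (fun w => 2 * s * a m.+1 * V m.+1 w)).
    by have := integrableZl measurableT (2 * s * a m.+1) i1.
  have j2 : P.-integrable setT (EFin \o (fun w => a m.+1 ^+ 2 * V m.+1 w ^+ 2)).
    by have := integrableZl measurableT (a m.+1 ^+ 2) i2.
  have j0 : P.-integrable setT (EFin \o cst (s ^+ 2)) by exact: finite_measure_integrable_cst.
  have j12 : P.-integrable setT (EFin \o (fun w => 2 * s * a m.+1 * V m.+1 w + a m.+1 ^+ 2 * V m.+1 w ^+ 2)).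
    by have := integrableD measurableT j1 j2.
  have -> : (\int[P]_w' ((s + a m.+1 * V m.+1 w') ^+ 2)%:E = \int[P]_w' (s ^+ 2 + (2 * s * a m.+1 * V m.+1 w' + a m.+1 ^+ 2 * V m.+1 w' ^+ 2))%:E)%E.
    by apply: eq_integral => w _; congr EFin; ring.
  rewrite -[LHS]fineK.
    rewrite -[fine _]/(\int[P]_w _) RintegralD// Rintegral_probability_cst RintegralD// !RintegralZl// EV// EV2//.
    by rewrite mulr0 add0r EFinD mulrC.
  apply: integrable_fin_num => //.
  by have := integrableD measurableT j0 j12.
under eq_integral do rewrite E.
rewrite ge0_integralD//=.
- have -> : (\int[P]__ (s2 * a m.+1 ^+ 2)%:E = (s2 * a m.+1 ^+ 2)%:E)%E.
    rewrite integral_cst// [X in (_ * X)%E](_ : _ = 1%E) ?mule1//.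
    exact: probability_setT.
  rewrite IH -EFinD -mulrDr.
  by rewrite [in RHS]big_nat_recr.
- by move=> w _; rewrite lee_fin sqr_ge0.
- by apply/measurable_EFinP; apply: measurable_funX; exact: measurable_weighted_sum.
- move=> w _; rewrite lee_fin mulr_ge0// ?sqr_ge0// -(EV2 (ltn0Sn m)).
  by apply: Rintegral_ge0 => x _; exact: sqr_ge0.
Qed.

End second_moment.

End partial_sums.

(** * Lindeberg's central limit theorem *)

Section trigo_bounds.
Context {R : realType}.
Implicit Types x y h u : R.

(** Applied four times in a row: each of the next four functions vanishes at 0 and has the previous
    one as derivative, starting from 1 - cos. *)
Lemma ge0_of_derive_ge0 (f df : R -> R) y :
  (forall x, is_derive x 1 f (df x)) -> (forall x, 0 <= x -> 0 <= df x) ->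
  f 0 = 0 -> 0 <= y -> 0 <= f y.
Proof.
move=> dff df0 f0 y0.
have cf : {within `[0, y], continuous f}.
  apply: continuous_subspaceT => x.
  by apply: differentiable_continuous; apply/derivable1_diffP; exact: ex_derive.
have [c] := @MVT_segment R f df 0 y y0 (fun x _ => dff x) cf.
rewrite in_itv/= => /andP[c0 _]; rewrite f0 !subr0 => ->.
by rewrite mulr_ge0// df0.
Qed.

Lemma sin_le y : 0 <= y -> sin y <= y.
Proof.
move=> y0; rewrite -subr_ge0; move: y0.
apply: (@ge0_of_derive_ge0 (fun y => y - sin y) (fun y => 1 - cos y) y).
- by move=> x _; rewrite subr_ge0 cos_le1.
- by rewrite sin0 subr0.
Qed.

Lemma cos_ge_quadratic y : 0 <= y -> 0 <= y ^+ 2 / 2 - 1 + cos y.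
Proof.
apply: (@ge0_of_derive_ge0 (fun y => y ^+ 2 / 2 - 1 + cos y) (fun y => y - sin y)).
- by move=> x; apply: is_derive_eq; rewrite /GRing.scale/=; field.
- by move=> x x0; rewrite subr_ge0 sin_le.
- by rewrite cos0 expr0n/= mul0r sub0r addNr.
Qed.

Lemma sin_ge_cubic y : 0 <= y -> 0 <= y ^+ 3 / 6 - y + sin y.
Proof.
apply: (@ge0_of_derive_ge0 (fun y => y ^+ 3 / 6 - y + sin y) (fun y => y ^+ 2 / 2 - 1 + cos y)).
- by move=> x; apply: is_derive_eq; rewrite /GRing.scale/=; field.
- by move=> x x0; exact: cos_ge_quadratic.
- by rewrite sin0 expr0n/= mul0r subr0 addr0.
Qed.

Lemma cos_le_quartic y : 0 <= y -> 0 <= y ^+ 4 / 24 - y ^+ 2 / 2 + 1 - cos y.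
Proof.
apply: (@ge0_of_derive_ge0 (fun y => y ^+ 4 / 24 - y ^+ 2 / 2 + 1 - cos y)
  (fun y => y ^+ 3 / 6 - y + sin y)).
- by move=> x; apply: is_derive_eq; rewrite /GRing.scale/=; field.
- by move=> x x0; exact: sin_ge_cubic.
- by rewrite cos0 !expr0n/= !mul0r subr0 add0r subrr.
Qed.

(** The remainder is cubic for small h and only quadratic for large h. Keeping the minimum is what
    lets a finite second moment of the summands suffice. *)
Lemma cos_taylor x h :
  `|cos (x + h) - (cos x - h * sin x - h ^+ 2 / 2 * cos x)| <=
  3 * (h ^+ 2 * Num.min `|h| 1).
Proof.
have -> : cos (x + h) - (cos x - h * sin x - h ^+ 2 / 2 * cos x) =
   cos x * (h ^+ 2 / 2 - 1 + cos h) + sin x * (h - sin h) by rewrite cosD; field.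
set mn := Num.min _ _.
have [h0 hE sE] : [/\ 0 <= `|h|, h ^+ 2 / 2 - 1 + cos h = `|h| ^+ 2 / 2 - 1 + cos `|h| &
    `|h - sin h| = `| `|h| - sin `|h| | ].
  split=> //; first by rewrite real_normK ?num_real//; case: (ger0P h) => _; rewrite ?cosN.
  by case: (ger0P h) => // _; rewrite sinN -opprD normrN.
have key y : 0 <= y -> `|y ^+ 2 / 2 - 1 + cos y| <= y ^+ 2 * Num.min y 1 /\
    `|y - sin y| <= 2 * (y ^+ 2 * Num.min y 1).
  move=> y0; rewrite (ger0_norm (cos_ge_quadratic y0)) ger0_norm ?subr_ge0 ?sin_le//.
  have := cos_le_quartic y0; have := cos_le1 y.
  have := sin_ge_cubic y0; have := sin_geN1 y.
  have y2 := sqr_ge0 y; have y3 : 0 <= y ^+ 3 by exact: exprn_ge0.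
  rewrite minEle; case: ifPn => [y1|]; rewrite -?ltNge => *; split.
  - have : y ^+ 3 * y <= y ^+ 3 * 1 by exact: ler_wpM2l.
    rewrite mulr1 -exprSr -exprSr; lra.
  - rewrite -exprSr; lra.
  - by rewrite mulr1; lra.
  - by rewrite mulr1; nra.
have [b1 b2] := key _ h0.
rewrite -hE -[X in X <= _]/(`|_|) real_normK ?num_real// -/mn in b1.
rewrite -sE real_normK ?num_real// -/mn in b2.
rewrite (le_trans (ler_normD _ _))// !normrM.
have c1 : `|cos x| <= 1 by rewrite ler_norml cos_le1 cos_geN1.
have s1 : `|sin x| <= 1 by rewrite ler_norml sin_le1 sin_geN1.
have d1 := ler_pM (normr_ge0 _) (normr_ge0 _) c1 b1.
have d2 := ler_pM (normr_ge0 _) (normr_ge0 _) s1 b2.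
by move: d1 d2; rewrite !mul1r; lra.
Qed.

Lemma expRN_quadratic u : 0 <= u -> `|1 - u - expR (- u)| <= u ^+ 2.
Proof.
move=> u0; have h1 := expR_ge1Dx (- u).
have h2 : expR (- u) * (1 + u) <= 1.
  have := expR_ge1Dx u; have := expR_gt0 (- u) => e0.
  move=> /(ler_wpM2l (ltW e0)); rewrite -expRD addNr expR0//.
by rewrite ler_norml; apply/andP; split; nra.
Qed.

End trigo_bounds.

(** * Lindeberg replacement for arrays of weights *)

Section central_limit.
Context d (T : measurableType d) (R : realType) (P : probability T R)
  (V : nat -> {RV P >-> R}).
Hypothesis indepV : mutually_independent [set i | (1 <= i)%N] V.
Hypothesis idV : identically_distributed [set i | (1 <= i)%N] V.
Variable s2 : R.
Hypothesis iV : forall i, (1 <= i)%N -> P.-integrable setT (EFin \o V i).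
Hypothesis iV2 : forall i, (1 <= i)%N -> P.-integrable setT (EFin \o (fun w => V i w ^+ 2)).
Hypothesis EV : forall i, (1 <= i)%N -> \int[P]_w V i w = 0.
Hypothesis EV2 : forall i, (1 <= i)%N -> \int[P]_w (V i w ^+ 2) = s2.

Let s2_ge0 : 0 <= s2.
Proof. by rewrite -(EV2 (leqnn 1)); apply: Rintegral_ge0 => w _; exact: sqr_ge0. Qed.

Lemma Rintegral_identically_distributed j (h : R -> R) : (1 <= j)%N ->
  measurable_fun setT h -> (forall x, 0 <= h x) ->
  \int[P]_w h (V j w) = \int[P]_w h (V 1%N w).
Proof.
move=> j1 mh h0; rewrite /Rintegral; congr fine.
have E i : (\int[P]_w (h (V i w))%:E = \int[distribution P (V i)]_x (h x)%:E)%E.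
  by rewrite ge0_integral_distribution//; exact/measurable_EFinP.
rewrite !E; apply: eq_measure_integral => A mA _.
exact: idV.
Qed.

Let trunc (m x : R) := x ^+ 2 * Num.min (m * `|x|) 1.

(** The truncated second moment of the common law in Lindeberg's condition; m is a bound for the
    weights of the sum. *)
Definition lindeberg (m : R) := \int[P]_w trunc m (V 1%N w).

Let measurable_trunc m : measurable_fun setT (trunc m).
Proof.
apply: measurable_funM; first exact: measurable_funX.
by apply: measurable_minr => //; apply: measurable_funM => //; exact: measurableT_comp.
Qed.

Let trunc_ge0 m x : 0 <= m -> 0 <= trunc m x.
Proof. by move=> m0; rewrite mulr_ge0 ?sqr_ge0// le_min ler01 mulr_ge0. Qed.

Let trunc_le m x : trunc m x <= x ^+ 2.
Proof. by rewrite ler_piMr ?sqr_ge0// ge_min lexx orbT. Qed.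

Lemma lindeberg_cvg0 (m : nat -> R) : (forall n, 0 <= m n) ->
  m n @[n --> \oo] --> 0 -> lindeberg (m n) @[n --> \oo] --> 0.
Proof.
move=> m0 mcv.
suff H : (\int[P]_w (trunc (m n) (V 1%N w))%:E)%E @[n --> \oo] --> (0 : R)%:E by exact: fine_cvg H.
have := @dominated_cvg _ _ _ P setT measurableT (fun n w => (trunc (m n) (V 1%N w))%:E)
  (cst 0%E) (fun w => (V 1%N w ^+ 2)%:E).
rewrite integral0; apply => //=.
- by move=> n; apply/measurable_EFinP; exact: (measurableT_comp (measurable_trunc _)).
- move=> w _; apply: cvg_EFin; first exact: nearW.
  apply: (@squeeze_cvgr _ _ _ _ (fun=> 0) (fun n => V 1%N w ^+ 2 * (m n * `|V 1%N w|))).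
  + apply: nearW => n; rewrite /= trunc_ge0//= ler_wpM2l ?sqr_ge0//.
    by rewrite ge_min lexx.
  + exact: cvg_cst.
  + rewrite -[X in _ --> X](mulr0 (V 1%N w ^+ 2)); apply: cvgM; first exact: cvg_cst.
    by rewrite -[X in _ --> X](mul0r `|V 1%N w|); apply: cvgM => //; exact: cvg_cst.
- exact: iV2.
- by move=> n w _; rewrite lee_fin ger0_norm ?trunc_ge0.
Qed.

(* One Lindeberg step: the second-order Taylor expansion of the cosine against the
   factor expR (- s2 alpha^2 / 2) of the limiting Gaussian. *)
Lemma cos_shift_approx j (alpha m x : R) : (1 <= j)%N -> `|alpha| <= m ->
  `|\int[P]_w cos (x + alpha * V j w) - expR (- (s2 * alpha ^+ 2 / 2)) * cos x| <=
  (3 * lindeberg m + s2 ^+ 2 * m ^+ 2) * alpha ^+ 2.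
Proof.
move=> j1 am.
have m0 : 0 <= m by exact: le_trans am.
have i1 : P.-integrable setT (EFin \o (fun w => cos (x + alpha * V j w))).
  apply: (@integrable_bounded _ _ _ _ _ 1).
    apply: measurableT_comp; first by apply: continuous_measurable_fun; exact: continuous_cos.
    by apply: measurable_funD => //; apply: measurable_funM.
  by move=> w; rewrite ler_norml cos_le1 cos_geN1.
have i2 : P.-integrable setT (EFin \o (fun w => (- (alpha * sin x)) * V j w)).
  by have := integrableZl measurableT (- (alpha * sin x)) (iV j1).
have i3 : P.-integrable setT (EFin \o (fun w => (- (alpha ^+ 2 / 2 * cos x)) * V j w ^+ 2)).
  by have := integrableZl measurableT (- (alpha ^+ 2 / 2 * cos x)) (iV2 j1).
have i0 : P.-integrable setT (EFin \o cst (cos x)) by exact: finite_measure_integrable_cst.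
have i02 : P.-integrable setT (EFin \o (fun w => cos x + (- (alpha * sin x)) * V j w)).
  by have := integrableD measurableT i0 i2.
pose q w := cos x + (- (alpha * sin x)) * V j w + (- (alpha ^+ 2 / 2 * cos x)) * V j w ^+ 2.
have iq : P.-integrable setT (EFin \o q).
  by have := integrableD measurableT i02 i3.
have Eq : \int[P]_w q w = (1 - s2 * alpha ^+ 2 / 2) * cos x.
  rewrite /q RintegralD// RintegralD// !RintegralZl// ?EV// ?EV2//; [|exact: iV2|exact: iV].
  by rewrite Rintegral_probability_cst mulr0; field.
have id : P.-integrable setT (EFin \o (fun w => cos (x + alpha * V j w) - q w)).
  by have := integrableB measurableT i1 iq.
have it : P.-integrable setT (EFin \o (fun w => trunc m (V j w))).
  apply: le_integrable (iV2 j1) => //.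
    by apply/measurable_EFinP; exact: (measurableT_comp (measurable_trunc m)).
  by move=> w _; rewrite /= lee_fin !ger0_norm ?trunc_ge0 ?sqr_ge0.
have it3 : P.-integrable setT (EFin \o (fun w => 3 * alpha ^+ 2 * trunc m (V j w))).
  by have := integrableZl measurableT (3 * alpha ^+ 2) it.
have b1 : `|\int[P]_w cos (x + alpha * V j w) - (1 - s2 * alpha ^+ 2 / 2) * cos x| <=
    3 * lindeberg m * alpha ^+ 2.
  rewrite -Eq -RintegralB//.
  apply: (le_trans (le_normr_Rintegral measurableT id)).
  have -> : 3 * lindeberg m * alpha ^+ 2 = \int[P]_w (3 * alpha ^+ 2 * trunc m (V j w)).
    rewrite RintegralZl// (Rintegral_identically_distributed j1 (measurable_trunc m)).
      by rewrite -/(lindeberg m); ring.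
    by move=> y; exact: trunc_ge0.
  apply: le_Rintegral => //; first exact: (integrable_norm id).
  move=> w _.
  have := cos_taylor x (alpha * V j w).
  have -> : cos (x + alpha * V j w) - q w = cos (x + alpha * V j w) -
     (cos x - alpha * V j w * sin x - (alpha * V j w) ^+ 2 / 2 * cos x) by rewrite /q; ring.
  move=> /le_trans; apply; rewrite /trunc -mulrA ler_wpM2l// exprMn -mulrA.
  apply: ler_wpM2l; first exact: sqr_ge0.
  apply: ler_wpM2l; first exact: sqr_ge0.
  rewrite le_min; apply/andP; split; last by rewrite ge_min lexx orbT.
  by rewrite ge_min normrM ler_wpM2r.
have u0 : 0 <= s2 * alpha ^+ 2 / 2 by rewrite divr_ge0// mulr_ge0// sqr_ge0.
have b2 : `|(1 - s2 * alpha ^+ 2 / 2) * cos x - expR (- (s2 * alpha ^+ 2 / 2)) * cos x| <=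
    s2 ^+ 2 * m ^+ 2 * alpha ^+ 2.
  rewrite -mulrBl normrM.
  have c1 : `|cos x| <= 1 by rewrite ler_norml cos_le1 cos_geN1.
  have := ler_pM (normr_ge0 _) (normr_ge0 _) (expRN_quadratic u0) c1.
  rewrite mulr1 => /le_trans; apply.
  have am2 : alpha ^+ 2 <= m ^+ 2.
    by rewrite -[alpha ^+ 2]real_normK ?num_real// lerXn2r// nnegrE.
  have s20 := sqr_ge0 s2; have a20 := sqr_ge0 alpha.
  have := ler_wpM2l s20 (ler_wpM2l a20 am2).
  have := mulr_ge0 s20 (mulr_ge0 a20 a20); lra.
rewrite mulrDl -[X in `|X|](subrKA ((1 - s2 * alpha ^+ 2 / 2) * cos x)).
by rewrite (le_trans (ler_normD _ _))// lerD.
Qed.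

(** Averaging over the last summand alone replaces it by a Gaussian factor g, up to the one-step
    error. Since g <= 1 the earlier errors do not grow, and the total is linear in the sum of
    squared weights. *)
Lemma cos_weighted_sum_approx (a : nat -> R) (m : R) N b :
  (forall j, (1 <= j <= N)%N -> `|a j| <= m) ->
  `|\int[P]_w cos (weighted_sum V a N w + b) -
    expR (- (s2 * (\sum_(1 <= j < N.+1) a j ^+ 2) / 2)) * cos b| <=
  (3 * lindeberg m + s2 ^+ 2 * m ^+ 2) * \sum_(1 <= j < N.+1) a j ^+ 2.
Proof.
elim: N b => [|N IH] b am.
  rewrite big_geq// !mulr0 mul0r oppr0 expR0 mul1r.
  under eq_Rintegral do rewrite /weighted_sum big_geq// add0r.
  by rewrite Rintegral_probability_cst subrr normr0.
have am' j : (1 <= j <= N)%N -> `|a j| <= m.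
  by move=> /andP[j1 jN]; apply: am; rewrite j1 (leq_trans jN).
have {}IH := IH _ am'.
have aN : `|a N.+1| <= m by apply: am; rewrite /= leqnn.
set D := _ + s2 ^+ 2 * m ^+ 2 in IH *.
set g := expR (- (s2 * a N.+1 ^+ 2 / 2)).
have g1 : 0 <= g <= 1.
  rewrite expR_ge0 -[leRHS]expR0 ler_expR oppr_le0 divr_ge0// mulr_ge0// sqr_ge0//.
pose h (p : R * R) := cos (p.1 + a N.+1 * p.2 + b).
have mcos : measurable_fun setT (@cos R) by apply: continuous_measurable_fun; exact: continuous_cos.
have mh : measurable_fun setT h.
  apply: (measurableT_comp mcos); apply: measurable_funD => //.
  by apply: measurable_funD => //; apply: measurable_funM.
have h1 p : `|h p| <= 1 by rewrite ler_norml cos_le1 cos_geN1.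
have mS := measurable_weighted_sum V a N.
have ic : P.-integrable setT (EFin \o (fun w => g * cos (weighted_sum V a N w + b))).
  apply: (@integrable_bounded _ _ _ _ _ 1).
    by apply: measurable_funM => //; apply: (measurableT_comp mcos); exact: measurable_funD.
  move=> w; rewrite normrM mulr_ile1// ?ler_norml ?cos_le1 ?cos_geN1//.
  by move: g1 => /andP[]; lra.
have ic1 : P.-integrable setT (EFin \o (fun w => cos (weighted_sum V a N w + b))).
  apply: (@integrable_bounded _ _ _ _ _ 1).
    by apply: (measurableT_comp mcos); exact: measurable_funD.
  by move=> w; rewrite ler_norml cos_le1 cos_geN1.
have step : `|\int[P]_w cos (weighted_sum V a N.+1 w + b) -
    g * \int[P]_w cos (weighted_sum V a N w + b)| <= D * a N.+1 ^+ 2.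
  under eq_Rintegral do rewrite weighted_sumS.
  rewrite (@Rintegral_indep_copy _ _ _ _ _ indepV a N h 1)// /h/=.
  have iI : P.-integrable setT (EFin \o (fun w => \int[P]_w' cos (weighted_sum V a N w + a N.+1 * V N.+1 w' + b))).
    exact: (@integrable_indep_copy _ _ _ P V a N h 1).
  rewrite -RintegralZl// -RintegralB//.
  have id := integrableB measurableT iI ic.
  apply: (le_trans (le_normr_Rintegral measurableT _)) => //.
  rewrite -[leRHS](Rintegral_probability_cst P) le_Rintegral//.
  + by have := integrable_abse id.
  + exact: finite_measure_integrable_cst.
  move=> w _.
  have := @cos_shift_approx N.+1 (a N.+1) m (weighted_sum V a N w + b) isT aN.
  by rewrite -/D; under eq_Rintegral do rewrite addrAC.
have := IH b.
rewrite (_ : \sum_(1 <= j < N.+2) a j ^+ 2 =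
  \sum_(1 <= j < N.+1) a j ^+ 2 + a N.+1 ^+ 2); last by rewrite big_nat_recr.
set S := \sum_(_ <= _ < _) _.
have -> : expR (- (s2 * (S + a N.+1 ^+ 2) / 2)) = g * expR (- (s2 * S / 2)).
  by rewrite /g -expRD; congr expR; field.
move: step; set E1 := Rintegral _ _ _; set E2 := Rintegral _ _ _; set E0 := expR _ => st ih.
(* One new error, plus the accumulated one damped by g. *)
have -> : E1 - g * E0 * cos b = (E1 - g * E2) + g * (E2 - E0 * cos b) by ring.
have n2 : `|g * (E2 - E0 * cos b)| <= D * S.
  rewrite normrM -[leRHS]mul1r ler_pM//.
  by rewrite ger0_norm; move: g1 => /andP[].
by rewrite (le_trans (ler_normD _ _))// (le_trans (lerD st n2))// addrC -mulrDr.
Qed.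

(** Uniform negligibility of the weights makes the error constant vanish, while the sum of squares
    stays bounded. *)
Lemma cos_weighted_sum_cvg (a : nat -> nat -> R) (m : nat -> R) (v b : R) :
  (\forall n \near \oo, forall j, (1 <= j <= n)%N -> `|a n j| <= m n) ->
  (forall n, 0 <= m n) -> m n @[n --> \oo] --> 0 ->
  \sum_(1 <= j < n.+1) a n j ^+ 2 @[n --> \oo] --> v ->
  \int[P]_w cos (weighted_sum V (a n) n w + b) @[n --> \oo] --> expR (- (s2 * v / 2)) * cos b.
Proof.
move=> am m0 mcv vcv.
have gcv : expR (- (s2 * (\sum_(1 <= j < n.+1) a n j ^+ 2) / 2)) * cos b @[n --> \oo] -->
    expR (- (s2 * v / 2)) * cos b.
  apply: cvgM; last exact: cvg_cst.
  apply: continuous_cvg; first exact: continuous_expR.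
  apply: cvgN; apply: cvgM; last exact: cvg_cst.
  by apply: cvgM => //; exact: cvg_cst.
have ecv : (3 * lindeberg (m n) + s2 ^+ 2 * m n ^+ 2) * \sum_(1 <= j < n.+1) a n j ^+ 2 @[n --> \oo] --> 0.
  rewrite -[X in _ --> X](mul0r v); apply: cvgM => //.
  rewrite -[X in _ --> X](addr0 0); apply: cvgD.
    rewrite -[X in _ --> X](mulr0 3); apply: cvgM; first exact: cvg_cst.
    exact: lindeberg_cvg0.
  rewrite -[X in _ --> X](mulr0 (s2 ^+ 2)); apply: cvgM; first exact: cvg_cst.
  rewrite -[X in _ --> X](mulr0 0); under eq_fun do rewrite expr2; exact: cvgM.
rewrite -[X in _ --> X](add0r _).
have -> : (fun n => \int[P]_w cos (weighted_sum V (a n) n w + b)) = (fun n =>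
  (\int[P]_w cos (weighted_sum V (a n) n w + b) -
   expR (- (s2 * (\sum_(1 <= j < n.+1) a n j ^+ 2) / 2)) * cos b) +
   expR (- (s2 * (\sum_(1 <= j < n.+1) a n j ^+ 2) / 2)) * cos b).
  by apply/funext => n; rewrite subrK.
apply: cvgD => //.
apply/norm_cvg0P; apply: (squeeze_cvgr _ (cvg_cst 0) ecv).
near=> n; rewrite normr_ge0/=; apply: cos_weighted_sum_approx.
by near: n.
Unshelve. all: by end_near. Qed.

End central_limit.

(** * Gaussian vectors *)

Section centered_square_integrable.
Context d (T : measurableType d) (R : realType) (P : probability T R).
Implicit Types X Y : {RV P >-> R}.

Lemma centered_covarianceE X Y : ('E_P[X] = 0)%E -> ('E_P[Y] = 0)%E ->
  covariance P X Y = (\int[P]_w (X w * Y w)%:E)%E.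
Proof.
move=> EX EY; rewrite unlock EX EY/= unlock; apply: eq_integral => w _.
by transitivity ((X w - 0) * (Y w - 0))%:E => //; rewrite !subr0.
Qed.

(** Square integrability is implicit in the covariance: the integral of a nonnegative function that
    equals a real number is finite. *)
Lemma centered_integrable_sqr X (v : R) : ('E_P[X] = 0)%E -> covariance P X X = v%:E ->
  P.-integrable setT (EFin \o (fun w => X w ^+ 2)).
Proof.
move=> EX; rewrite centered_covarianceE// => vX.
have m2 : measurable_fun setT (fun w => X w ^+ 2) by exact: measurable_funX.
apply/integrableP; split; first exact/measurable_EFinP.
rewrite (_ : (\int[P]_w _ = v%:E)%E) ?ltry//; rewrite -vX; apply: eq_integral => w _.
by rewrite /= ger0_norm ?sqr_ge0// expr2.
Qed.

Lemma integrable_of_sqr X : P.-integrable setT (EFin \o (fun w => X w ^+ 2)) ->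
  P.-integrable setT (EFin \o X).
Proof.
move=> iX; have i1 : P.-integrable setT (EFin \o cst 1) by exact: finite_measure_integrable_cst.
apply: le_integrable (integrableD measurableT i1 iX) => //; first exact/measurable_EFinP.
move=> w _; rewrite /= lee_fin [leRHS]ger0_norm ?le_abs_1Dsqr//.
by rewrite addr_ge0// sqr_ge0.
Qed.

Lemma integrable_mul_of_sqr X Y : P.-integrable setT (EFin \o (fun w => X w ^+ 2)) ->
  P.-integrable setT (EFin \o (fun w => Y w ^+ 2)) ->
  P.-integrable setT (EFin \o (fun w => X w * Y w)).
Proof.
move=> iX iY; apply: le_integrable (integrableD measurableT iX iY) => //.
  by apply/measurable_EFinP; exact: measurable_funM.
move=> w _; rewrite /= lee_fin [leRHS]ger0_norm ?addr_ge0 ?sqr_ge0//.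
by rewrite ler_norml; nra.
Qed.

Lemma Rintegral_centered X : ('E_P[X] = 0)%E -> \int[P]_w X w = 0.
Proof. by rewrite unlock /Rintegral => ->. Qed.

Lemma Rintegral_centered_covariance X Y (v : R) : ('E_P[X] = 0)%E -> ('E_P[Y] = 0)%E ->
  covariance P X Y = v%:E -> \int[P]_w (X w * Y w) = v.
Proof. by move=> EX EY; rewrite centered_covarianceE// /Rintegral => ->. Qed.

End centered_square_integrable.

(** Uniqueness of densities identifies the Radon-Nikodym derivative of the normal law with
    [normal_pdf] almost everywhere; the change of variables follows. *)
Lemma ge0_integral_normal_prob (R : realType) (m s : R) (h : R -> R) :
  measurable_fun setT h -> (forall x, 0 <= h x) ->
  (\int[normal_prob m s]_x (h x)%:E =
   \int[@lebesgue_measure R]_x (h x * normal_pdf m s x)%:E)%E.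
Proof.
move=> mh h0.
have dom := normal_prob_dominates m s.
pose f := Radon_Nikodym_SigmaFinite.f (normal_prob m s) (@lebesgue_measure R).
have mhE : measurable_fun setT (EFin \o h) by exact/measurable_EFinP.
have intf : (@lebesgue_measure R).-integrable setT f.
  exact: Radon_Nikodym_SigmaFinite.f_integrable.
have mpdf : measurable_fun setT (EFin \o normal_pdf m s).
  by apply/measurable_EFinP; exact: measurable_normal_pdf.
rewrite -[LHS](Radon_Nikodym_SigmaFinite.change_of_variables dom)//.
apply: ae_eq_integral => //.
- by apply: emeasurable_funM => //; exact: measurable_int intf.
- by apply/measurable_EFinP; apply: measurable_funM => //; exact: measurable_normal_pdf.
have : ae_eq (@lebesgue_measure R) setT f (EFin \o normal_pdf m s).
  apply: integral_ae_eq => // A _ mA.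
  by rewrite -Radon_Nikodym_SigmaFinite.f_integral.
by apply: filterS => x fx _; rewrite -/f fx.
Qed.

Section gaussian_laws.
Context d (T : measurableType d) (R : realType) (Q : probability T R).

Lemma gaussian_law_cos (S : {RV Q >-> R}) (m s t b : R) :
  (forall A, measurable A -> Q (S @^-1` A) = gaussian_law m s A) ->
  \int[Q]_w cos (t * S w + b) = expR (- (s ^+ 2 * t ^+ 2 / 2)) * cos (t * m + b).
Proof.
(* Adding 1 makes the test function nonnegative, as the change of variables asks. *)
move=> SE; pose h (x : R) := cos (t * x + b) + 1.
have mcos : measurable_fun setT (@cos R) by apply: continuous_measurable_fun; exact: continuous_cos.
have mc : measurable_fun setT (fun x : R => cos (t * x + b)).
  by apply: (measurableT_comp mcos); apply: measurable_funD => //; apply: measurable_funM.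
have mh : measurable_fun setT h by exact: measurable_funD.
have h0 x : 0 <= h x by rewrite /h; have := cos_geN1 (t * x + b); lra.
have b1 x : `|cos (t * x + b)| <= 1 by rewrite ler_norml cos_le1 cos_geN1.
have mhE : measurable_fun setT (EFin \o h) by exact/measurable_EFinP.
have i1 d0 (T0 : measurableType d0) (P0 : probability T0 R) : P0.-integrable setT (EFin \o cst 1).
  exact: finite_measure_integrable_cst.
have E1 : \int[Q]_w cos (t * S w + b) = fine (\int[Q]_w (h (S w))%:E)%E - 1.
  have ic0 : Q.-integrable setT (EFin \o (fun w => cos (t * S w + b))).
    apply: (@integrable_bounded _ _ _ _ _ 1) => //.
    exact: (measurableT_comp mc).
  rewrite -[fine _]/(\int[Q]_w h (S w)) /h RintegralD;
    [by rewrite Rintegral_probability_cst addrK|by []|exact: ic0|exact: i1].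
have E2 : (\int[Q]_w (h (S w))%:E = \int[distribution Q S]_x (h x)%:E)%E.
  by rewrite ge0_integral_distribution//; exact/measurable_EFinP.
have [s0|s0] := eqVneq s 0.
  have E3 : (\int[distribution Q S]_x (h x)%:E = \int[\d_m]_x (h x)%:E)%E.
    apply: eq_measure_integral => A mA _.
    by apply: (etrans (SE A mA)); rewrite /gaussian_law s0 eqxx.
  rewrite E1 E2 E3 integral_dirac// [X in (X * _)%E](_ : _ = 1%E); last exact: diracT.
  rewrite mul1e/= /h addrK.
  by rewrite s0 expr0n/= !mul0r oppr0 expR0 mul1r.
have mS : measurable_fun setT (S : T -> measurableTypeR R).
  exact: (measurable_funPT S).
pose S' := @mfun_Sub _ _ T (measurableTypeR R) S (mem_set mS).
have E3 : (\int[Q]_w (h (S w))%:E = \int[normal_prob m s]_x (h x)%:E)%E.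
  transitivity (\int[distribution Q S']_x (h x)%:E)%E.
    by rewrite ge0_integral_distribution//; exact/measurable_EFinP.
  apply: eq_measure_integral => A mA _.
  by apply: (etrans (SE A mA)); rewrite /gaussian_law (negbTE s0).
rewrite E1 E3 ge0_integral_normal_prob//.
rewrite -[fine _]/(\int[lebesgue_measure]_x (h x * normal_pdf m s x)).
have ip := integrable_normal_pdf m s.
have ic : (@lebesgue_measure R).-integrable setT (EFin \o (fun x => cos (t * (x - m) + (t * m + b)) * normal_pdf m s x)).
  have [mc' _] := measurable_affine_cos m t (t * m + b).
  apply: (@integrable_dominated_normal _ m s _ 1) => //.
    by apply: measurable_funM => //; exact: measurable_normal_pdf.
  move=> x; rewrite normrM (ger0_norm (normal_pdf_ge0 _ _ _)) mul1r.
  rewrite ler_wpM2r ?normal_pdf_ge0// (@le_trans _ _ 1)// ?lerDl ?sqr_ge0//.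
  by rewrite ler_norml cos_le1 cos_geN1.
have -> : \int[lebesgue_measure]_x (h x * normal_pdf m s x) =
    \int[lebesgue_measure]_x (cos (t * (x - m) + (t * m + b)) * normal_pdf m s x + normal_pdf m s x).
  apply: eq_Rintegral => x _; rewrite /h mulrDl mul1r; congr (cos _ * _ + _); ring.
rewrite RintegralD// normal_cos//.
have -> : \int[@lebesgue_measure R]_x normal_pdf m s x = 1.
  by rewrite /Rintegral integral_normal_pdf.
by rewrite addrK.
Qed.

(** The parameters are read off near t = 0: the moments of S determine E cos (t S + x) up to o(t^2)
    through the Lindeberg step, while the explicit formula expresses the same quantity by m and
    s. *)
Lemma centered_gaussian_law_cos (S : {RV Q >-> R}) (m s v : R) :
  (forall A, measurable A -> Q (S @^-1` A) = gaussian_law m s A) ->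
  Q.-integrable setT (EFin \o S) ->
  Q.-integrable setT (EFin \o (fun w => S w ^+ 2)) ->
  \int[Q]_w S w = 0 -> \int[Q]_w (S w ^+ 2) = v -> m = 0 /\ s ^+ 2 = v.
Proof.
move=> SE iS iS2 ES ES2.
(* The constant sequence S is identically distributed, so the one-step estimate [cos_shift_approx]
   can be applied to S itself. *)
pose V := fun _ : nat => S.
have idV : identically_distributed [set i | (1 <= i)%N] V by [].
pose L n := 3 * lindeberg V n.+1%:R^-1 + v ^+ 2 * n.+1%:R^-1 ^+ 2.
have h0 : n.+1%:R^-1 @[n --> \oo] --> (0 : R) by exact: cvg_harmonic.
have Lcv : L n @[n --> \oo] --> 0.
  rewrite -[X in _ --> X](addr0 0); apply: cvgD.
    rewrite -[X in _ --> X](mulr0 3); apply: cvgM; first exact: cvg_cst.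
    apply: (@lindeberg_cvg0 _ _ _ _ V) => //.
  rewrite -[X in _ --> X](mulr0 (v ^+ 2)); apply: cvgM; first exact: cvg_cst.
  rewrite -[X in _ --> X](mulr0 0); under eq_fun do rewrite expr2; exact: cvgM.
have key n x : `|expR (- (s ^+ 2 * n.+1%:R^-1 ^+ 2 / 2)) * cos (n.+1%:R^-1 * m + x) -
    expR (- (v * n.+1%:R^-1 ^+ 2 / 2)) * cos x| <= L n * n.+1%:R^-1 ^+ 2.
  rewrite -(gaussian_law_cos _ _ SE).
  have := @cos_shift_approx _ _ _ _ V idV v (fun _ _ => iS) (fun _ _ => iS2) (fun _ _ => ES)
    (fun _ _ => ES2) 1 n.+1%:R^-1 n.+1%:R^-1 x isT.
  have nh : `|n.+1%:R^-1| <= n.+1%:R^-1 :> R by rewrite ger0_norm.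
  move=> /(_ nh).
  by under eq_Rintegral do rewrite addrC.
have h20 : n.+1%:R^-1 ^+ 2 @[n --> \oo] --> (0 : R).
  rewrite -[X in _ --> X](mulr0 0); under eq_fun do rewrite expr2; exact: cvgM.
have ltr0h n : 0 < n.+1%:R^-1 :> R by rewrite invr_gt0.
have m0 : m = 0.
  apply/eqP; rewrite -normr_le0.
  have lcv : expR (- (s ^+ 2 * n.+1%:R^-1 ^+ 2 / 2)) * (`|m| - `|m| ^+ 3 / 6 * n.+1%:R^-1 ^+ 2) @[n --> \oo] --> `|m|.
    rewrite -[X in _ --> X]mul1r; apply: cvgM.
      rewrite -[X in _ --> X]expR0; apply: continuous_cvg; first exact: continuous_expR.
      rewrite -[X in _ --> X]oppr0; apply: cvgN; rewrite -[X in _ --> X](mul0r 2^-1); apply: cvgM; last exact: cvg_cst.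
      by rewrite -[X in _ --> X](mulr0 (s ^+ 2)); apply: cvgM => //; exact: cvg_cst.
    rewrite -[X in _ --> X](subr0 `|m|); apply: cvgB; first exact: cvg_cst.
    by rewrite -[X in _ --> X](mulr0 (`|m| ^+ 3 / 6)); apply: cvgM => //; exact: cvg_cst.
  have rcv : L n * n.+1%:R^-1 @[n --> \oo] --> 0.
    by rewrite -[X in _ --> X](mul0r 0); apply: cvgM.
  apply: (ler_cvg_to lcv rcv); apply: nearW => n.
  (* The phase pi / 2 turns cosines into sines and isolates the first order: sin (t m) against an
     error of order t^2, with t = 1 / (n + 1). *)
  have := key n (pi / 2); rewrite cos_pihalf mulr0 subr0 normrM (ger0_norm (expR_ge0 _)).
  rewrite cosD cos_pihalf sin_pihalf mulr0 mulr1 sub0r normrN.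
  set hh := n.+1%:R^-1; have hp : 0 < hh by exact: ltr0h.
  have -> : `|sin (hh * m)| = `|sin (hh * `|m|)|.
    by case: (ger0P m) => // _; rewrite mulrN sinN normrN.
  have hm : 0 <= hh * `|m| by rewrite mulr_ge0// ltW.
  have := sin_ge_cubic hm; have := ler_norm (sin (hh * `|m|)).
  set E := expR _; have E0 : 0 <= E by exact: expR_ge0.
  set y := `|m|; move=> l1 l2 l3.
  rewrite -(ler_pM2r hp).
  have : E * (hh * y - (hh * y) ^+ 3 / 6) <= E * `|sin (hh * y)|.
    by apply: ler_wpM2l => //; lra.
  move: l3; rewrite -/y; move: (`|sin _|) (L n) => u v1 ; rewrite expr2 !exprMn; nra.
split => //; move: key; rewrite m0 => key.
have v0 : 0 <= v by rewrite -ES2; apply: Rintegral_ge0 => w _; exact: sqr_ge0.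
have s20 := sqr_ge0 s.
apply/eqP; rewrite -subr_eq0 -normr_le0.
have rcv : 2 * (L n + ((s ^+ 2 / 2) ^+ 2 + (v / 2) ^+ 2) * n.+1%:R^-1 ^+ 2) @[n --> \oo] --> 0.
  rewrite -[X in _ --> X](mulr0 2); apply: cvgM; first exact: cvg_cst.
  rewrite -[X in _ --> X](addr0 0); apply: cvgD => //.
  by rewrite -[X in _ --> X](mulr0 ((s ^+ 2 / 2) ^+ 2 + (v / 2) ^+ 2)); apply: cvgM => //; exact: cvg_cst.
apply: (ler_cvg_to (cvg_cst _) rcv); apply: nearW => n.
(* The phase 0 isolates the second order: (v - s^2) t^2 / 2 up to O(t^4), against an error L n t^2
   with L n tending to 0. *)
have := key n 0; rewrite mulr0 addr0 cos0 !mulr1.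
set hh := n.+1%:R^-1; have hp : 0 < hh ^+ 2 by rewrite exprn_gt0//; exact: ltr0h.
have us : 0 <= s ^+ 2 * hh ^+ 2 / 2 by rewrite divr_ge0// mulr_ge0// ltW.
have uv : 0 <= v * hh ^+ 2 / 2 by rewrite divr_ge0// mulr_ge0// ltW.
have := expRN_quadratic us; have := expRN_quadratic uv.
set E1 := expR _; set E2 := expR _.
rewrite !ler_norml.
move=> /andP[a1 a2] /andP[a3 a4] /andP[a5 a6].
have t2 : (v * hh ^+ 2 / 2) ^+ 2 = (v / 2) ^+ 2 * hh ^+ 2 * hh ^+ 2 by ring.
have t1 : (s ^+ 2 * hh ^+ 2 / 2) ^+ 2 = (s ^+ 2 / 2) ^+ 2 * hh ^+ 2 * hh ^+ 2 by ring.
rewrite t1 t2 in a1 a2 a3 a4 *.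
by apply/andP; split; rewrite -(ler_pM2r hp); lra.
Qed.

(** A Gaussian vector only provides some normal law for each combination. Its first two moments,
    read from the covariance matrix, determine the parameters. *)
Lemma centered_gaussian_vector_law (xi eta : {RV Q >-> R}) (A B C t1 t2 : R) :
  centered_gaussian_vector (pair2 xi eta) (mx2 A B B C) ->
  exists2 s : R, s ^+ 2 = t1 ^+ 2 * A + 2 * t1 * t2 * B + t2 ^+ 2 * C &
  forall D : set R, measurable D ->
    Q ((fun w => t1 * xi w + t2 * eta w) @^-1` D) = gaussian_law 0 s D.
Proof.
move=> [gv ev cv].
have ex : ('E_Q[xi] = 0)%E by have := ev ord0.
have ee : ('E_Q[eta] = 0)%E by have := ev ord_max.
have cxx : covariance Q xi xi = A%:E by have := cv ord0 ord0; rewrite !mxE.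
have cxe : covariance Q xi eta = B%:E by have := cv ord0 ord_max; rewrite !mxE.
have cee : covariance Q eta eta = C%:E by have := cv ord_max ord_max; rewrite !mxE.
have ix2 := centered_integrable_sqr ex cxx.
have ie2 := centered_integrable_sqr ee cee.
have ixe := integrable_mul_of_sqr ix2 ie2.
have ix := integrable_of_sqr ix2; have ie := integrable_of_sqr ie2.
have mS : measurable_fun setT (fun w => t1 * xi w + t2 * eta w).
  by apply: measurable_funD; apply: measurable_funM.
pose S : {RV Q >-> R} := mfun_Sub (mem_set mS).
have [m [s ms]] := gv (pair2 t1 t2).
have SE D : measurable D -> Q (S @^-1` D) = gaussian_law m s D.
  move=> mD; rewrite -(ms D mD); congr (Q _); apply/seteqP.
  by split => w; rewrite /preimage/= !big_ord_recl big_ord0 addr0.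
have j1 : Q.-integrable setT (EFin \o (fun w => t1 * xi w)).
  by have := integrableZl measurableT t1 ix.
have j2 : Q.-integrable setT (EFin \o (fun w => t2 * eta w)).
  by have := integrableZl measurableT t2 ie.
have iS : Q.-integrable setT (EFin \o S) by have := integrableD measurableT j1 j2.
have k1 : Q.-integrable setT (EFin \o (fun w => t1 ^+ 2 * xi w ^+ 2)).
  by have := integrableZl measurableT (t1 ^+ 2) ix2.
have k2 : Q.-integrable setT (EFin \o (fun w => 2 * t1 * t2 * (xi w * eta w))).
  by have := integrableZl measurableT (2 * t1 * t2) ixe.
have k3 : Q.-integrable setT (EFin \o (fun w => t2 ^+ 2 * eta w ^+ 2)).
  by have := integrableZl measurableT (t2 ^+ 2) ie2.
have k12 : Q.-integrable setT (EFin \o (fun w => t1 ^+ 2 * xi w ^+ 2 + 2 * t1 * t2 * (xi w * eta w))).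
  by have := integrableD measurableT k1 k2.
have S2E w : S w ^+ 2 = t1 ^+ 2 * xi w ^+ 2 + 2 * t1 * t2 * (xi w * eta w) + t2 ^+ 2 * eta w ^+ 2.
  by rewrite /S/=; ring.
have iS2 : Q.-integrable setT (EFin \o (fun w => S w ^+ 2)).
  have := integrableD measurableT k12 k3; congr integrable; apply/funext => w.
  by rewrite /= S2E.
have ES : \int[Q]_w S w = 0.
  by rewrite RintegralD// !RintegralZl// !Rintegral_centered// !mulr0 addr0.
have sq X : \int[Q]_w (X w ^+ 2) = \int[Q]_w (X w * X w).
  by apply: eq_Rintegral => w _; rewrite expr2.
have ES2 : \int[Q]_w (S w ^+ 2) = t1 ^+ 2 * A + 2 * t1 * t2 * B + t2 ^+ 2 * C.
  under eq_Rintegral do rewrite S2E.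
  rewrite RintegralD// RintegralD// !RintegralZl// !sq.
  rewrite (Rintegral_centered_covariance ex ex cxx) (Rintegral_centered_covariance ex ee cxe).
  by rewrite (Rintegral_centered_covariance ee ee cee).
have [m0 sE] := centered_gaussian_law_cos SE iS iS2 ES ES2.
by rewrite m0 in SE; exists s.
Qed.

Lemma centered_gaussian_vector_cos (xi eta : {RV Q >-> R}) (A B C t1 t2 b : R) :
  centered_gaussian_vector (pair2 xi eta) (mx2 A B B C) ->
  \int[Q]_w cos (t1 * xi w + t2 * eta w + b) =
  expR (- ((t1 ^+ 2 * A + 2 * t1 * t2 * B + t2 ^+ 2 * C) / 2)) * cos b.
Proof.
move=> /(centered_gaussian_vector_law t1 t2)[s <- SE].
have mS : measurable_fun setT (fun w => t1 * xi w + t2 * eta w).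
  by apply: measurable_funD; apply: measurable_funM.
pose S : {RV Q >-> R} := mfun_Sub (mem_set mS).
have := @gaussian_law_cos S 0 s 1 b SE.
rewrite expr1n mulr1 mulr0 add0r => <-.
by apply: eq_Rintegral => w _; rewrite mul1r.
Qed.

(** A normal law of nonzero variance is absolutely continuous, so the denominator of the limit
    almost surely does not vanish. *)
Lemma centered_gaussian_vector_neq0 (xi eta : {RV Q >-> R}) (A B C : R) :
  centered_gaussian_vector (pair2 xi eta) (mx2 A B B C) -> C != 0 ->
  Q [set w | eta w = 0] = 0%E.
Proof.
move=> /(centered_gaussian_vector_law 0 1)[s].
rewrite expr0n/= mulr0 !mul0r !add0r expr1n mul1r => sC SE C0.
have s0 : s != 0 by rewrite -sqrf_eq0 sC.
have -> : [set w | eta w = 0] = (fun w => 0 * xi w + 1 * eta w) @^-1` [set 0].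
  by apply/seteqP; split => w /=; rewrite mul0r add0r mul1r.
rewrite SE// /gaussian_law (negbTE s0).
have /null_content_dominatesP := @normal_prob_dominates R 0 s; apply => //.
exact: lebesgue_measure_set1.
Qed.

End gaussian_laws.

(** * Convergence of ratios *)

Definition clamp (R : realDomainType) (K x : R) : R := Num.max (- K) (Num.min K x).

Section clamp.
Context {R : realFieldType}.
Implicit Types K x y : R.

Lemma norm_clamp_le K x : 0 <= K -> `|clamp K x| <= K.
Proof.
move=> K0; rewrite /clamp ler_norml le_max lexx/= ge_max ge_min lexx/= andbT.
by rewrite (le_trans _ K0)// oppr_le0.
Qed.

Lemma clamp_id K x : `|x| <= K -> clamp K x = x.
Proof.
rewrite ler_norml => /andP[h1 h2].
by rewrite /clamp (min_idPr h2) (max_idPr h1).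
Qed.

Lemma max_lipschitz K x y : `|Num.max K x - Num.max K y| <= `|x - y|.
Proof.
have := ler_norm (x - y); have := ler_norm (- (x - y)); rewrite normrN.
move: (`|x - y|) => r h1 h2; rewrite ler_norml.
by case: (leP K x) => ?; case: (leP K y) => ?; apply/andP; split; lra.
Qed.

Lemma min_lipschitz K x y : `|Num.min K x - Num.min K y| <= `|x - y|.
Proof.
have := ler_norm (x - y); have := ler_norm (- (x - y)); rewrite normrN.
move: (`|x - y|) => r h1 h2; rewrite ler_norml.
by case: (leP K x) => ?; case: (leP K y) => ?; apply/andP; split; lra.
Qed.

Lemma clamp_lipschitz K x y : `|clamp K x - clamp K y| <= `|x - y|.
Proof. exact: le_trans (max_lipschitz _ _ _) (min_lipschitz _ _ _). Qed.

End clamp.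

(** * Uniform continuity on the line and on the plane *)

Section uniform_continuity.
Context {R : realType}.

Definition ucont1 (f : R -> R) := forall e : R, 0 < e -> exists2 del : R, 0 < del &
  forall x y, `|x - y| <= del -> `|f x - f y| <= e.

Definition ucont2 (f : R * R -> R) := forall e : R, 0 < e -> exists2 del : R, 0 < del &
  forall p q : R * R, `|p.1 - q.1| <= del -> `|p.2 - q.2| <= del -> `|f p - f q| <= e.

Lemma increasing_seq_ge (f : nat -> nat) : increasing_seq f -> forall n, (n <= f n)%N.
Proof.
move=> fi; elim=> // n IH; apply: (leq_ltn_trans IH).
by have := fi n.+1 n; rewrite !leEnat ltnn => h; rewrite ltnNge h.
Qed.

(** Clamping brings counterexample pairs into [-K, K] without increasing their distance;
    Bolzano-Weierstrass then gives a common limit of both members, where the continuity of f is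
    contradicted. *)
Lemma heine_cantor_clamp (f : R -> R) (K : R) : 0 <= K -> continuous f ->
  ucont1 (f \o clamp K).
Proof.
move=> K0 cf e e0; apply/not_exists2P => H.
have {}H n : exists p : R * R, [/\ `|p.1| <= K, `|p.2| <= K, `|p.1 - p.2| <= n.+1%:R^-1 & e < `|f p.1 - f p.2|].
  have [/negP|/existsNP[x /existsNP[y /not_implyP[xy /negP]]]] := H n.+1%:R^-1.
    by rewrite invr_gt0 ltr0n.
  rewrite -ltNge => fxy; exists (clamp K x, clamp K y); split => //=; try exact: norm_clamp_le.
  by rewrite (le_trans (clamp_lipschitz _ _ _)).
have [u Hu] := choice H.
have bu : bounded_fun (fun n => (u n).1).
  exists K; split; first exact: num_real.
  by move=> M KM n _ /=; have [h _ _ _] := Hu n; rewrite (le_trans h)// ltW.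
have [s si /cvg_ex[/= l sl]] := bolzano_weierstrass bu.
have sge := increasing_seq_ge si.
have h0 : (n.+1%:R^-1 : R) @[n --> \oo] --> (0 : R) by exact: cvg_harmonic.
have dl : ((u (s n)).1 - (u (s n)).2) @[n --> \oo] --> (0 : R).
  apply/norm_cvg0P; apply: (squeeze_cvgr _ (cvg_cst 0) h0).
  apply: nearW => n; rewrite normr_ge0/=; have [_ _ h _] := Hu (s n).
  by rewrite (le_trans h)// lef_pV2 ?posrE// ler_nat ltnS.
have sl2 : (u (s n)).2 @[n --> \oo] --> l.
  have h : (u (s n)).1 - ((u (s n)).1 - (u (s n)).2) @[n --> \oo] --> l - 0.
    by apply: cvgB.
  by rewrite subr0 in h; move: h; apply: cvg_trans; apply: near_eq_cvg; apply: nearW => n; rewrite subKr.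
have fl : `|f (u (s n)).1 - f (u (s n)).2| @[n --> \oo] --> `|f l - f l|.
  by apply: cvg_norm; apply: cvgB; apply: continuous_cvg => //; exact: cf.
rewrite subrr normr0 in fl.
have := ler_cvg_to (cvg_cst e) fl; rewrite leNgt e0 => h.
suff : false by []. apply: h.
by apply: nearW => n; have [_ _ _ /ltW] := Hu (s n).
Qed.

Lemma ucont2_fst (f : R -> R) : ucont1 f -> ucont2 (fun p => f p.1).
Proof. by move=> uf e /uf[d d0 h]; exists d => // p q h1 _; exact: h. Qed.

Lemma ucont2_snd (f : R -> R) : ucont1 f -> ucont2 (fun p => f p.2).
Proof. by move=> uf e /uf[d d0 h]; exists d => // p q _ h1; exact: h. Qed.

Lemma ucont2_comp (f : R -> R) g : ucont1 f -> ucont2 g -> ucont2 (fun p => f (g p)).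
Proof.
move=> uf ug e /uf[d d0 h]; have [d' d'0 h'] := ug _ d0.
by exists d' => // p q h1 h2; apply: h; exact: h'.
Qed.

Lemma ucont2M f g (M : R) : ucont2 f -> ucont2 g ->
  (forall p, `|f p| <= M) -> (forall p, `|g p| <= M) -> ucont2 (fun p => f p * g p).
Proof.
move=> uf ug fM gM e e0.
have M0 : 0 <= M by exact: le_trans (fM (0, 0)).
have e'0 : 0 < e / (2 * (M + 1)) by rewrite divr_gt0// mulr_gt0// ltr_wpDl.
have [d1 d10 h1] := uf _ e'0; have [d2 d20 h2] := ug _ e'0.
exists (Num.min d1 d2); first by rewrite lt_min d10.
move=> p q; rewrite !le_min => /andP[a1 a2] /andP[b1 b2].
have := h1 p q a1 b1; have := h2 p q a2 b2; set e' := _ / _ => k2 k1.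
have ee : e' * (2 * (M + 1)) = e by rewrite divfK// gt_eqF// mulr_gt0// ltr_wpDl.
have -> : f p * g p - f q * g q = f p * (g p - g q) + (f p - f q) * g q by ring.
rewrite (le_trans (ler_normD _ _))// !normrM.
have := ler_pM (normr_ge0 _) (normr_ge0 _) (fM p) k2.
have := ler_pM (normr_ge0 _) (normr_ge0 _) k1 (gM q).
have : 0 < e' by [].
nra.
Qed.

Lemma ucont1_lipschitz (f : R -> R) (c : R) : 0 < c ->
  (forall x y, `|f x - f y| <= c * `|x - y|) -> ucont1 f.
Proof.
move=> c0 h e e0; exists (e / c); first by rewrite divr_gt0.
by move=> x y xy; rewrite (le_trans (h x y))// mulrC -ler_pdivlMr.
Qed.

End uniform_continuity.

(** A / B - U / W equals ((A - U W) W - U (B - W^2)) / (B W). The condition on del keeps B at least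
    1 / (2 N^2), so B != 0 is a conclusion and need not be assumed. *)
Lemma ratio_close (R : realFieldType) (N del A B U W : R) :
  1 <= N -> `|U| <= N + 1 -> `|W| <= N + 1 -> N^-1 <= `|W| ->
  `|A - U * W| <= del -> `|B - W ^+ 2| <= del -> del * (2 * N ^+ 2) <= 1 ->
  B != 0 /\ `|A / B - U / W| <= 4 * del * N ^+ 3 * (N + 1).
Proof.
move=> N1 UN WN WN' Ad Bd dN.
have N0 : 0 < N by exact: lt_le_trans N1.
have d0 : 0 <= del by exact: le_trans Ad.
have W0 : W != 0.
  by rewrite -normr_gt0 (lt_le_trans _ WN')// invr_gt0.
have NW : 1 <= N * `|W| by rewrite -ler_pdivrMl// mulr1.
have W2 : 1 <= N ^+ 2 * W ^+ 2.
  by rewrite -[W ^+ 2]real_normK ?num_real// -exprMn exprn_ege1.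
have hB : 1 <= 2 * N ^+ 2 * B.
  move: Bd; rewrite ler_norml => /andP[b1 b2].
  have := ler_wpM2l (sqr_ge0 N) b1; nra.
have B0 : 0 < B.
  rewrite ltNge; apply/negP => B0.
  have : 2 * N ^+ 2 * B <= 0 by rewrite mulr_ge0_le0// mulr_ge0// sqr_ge0.
  lra.
split; first by rewrite gt_eqF.
have -> : A / B - U / W = ((A - U * W) * W - U * (B - W ^+ 2)) / (B * W).
  by field; rewrite W0 gt_eqF.
have BW0 : 0 < B * `|W| by rewrite mulr_gt0// normr_gt0.
rewrite normrM normfV (normrM B) (gtr0_norm B0) ler_pdivrMr//.
apply: (@le_trans _ _ (2 * del * (N + 1))).
  rewrite (le_trans (ler_normB _ _))// !normrM.
  have := ler_pM (normr_ge0 _) (normr_ge0 _) Ad WN.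
  have := ler_pM (normr_ge0 _) (normr_ge0 _) UN Bd.
  lra.
have h : 1 <= (2 * N ^+ 2 * B) * (N * `|W|) by rewrite mulr_ege1.
have h2 : 0 <= 2 * del * (N + 1) by rewrite !mulr_ge0// ltW// ltr_wpDl// ltW.
have := ler_wpM2l h2 h; rewrite mulr1 => /le_trans; apply.
by rewrite le_eqVlt; apply/orP; left; apply/eqP; ring.
Qed.

(** * Test functions cut off near vanishing denominators *)

Section cutoff.
Context {R : realType}.
Variable N : R.
Hypothesis N1 : 1 <= N.

Let c01 (t : R) := Num.max 0 (Num.min 1 t).

Let c01_ge0 t : 0 <= c01 t. Proof. by rewrite le_max lexx. Qed.

Let c01_le1 t : c01 t <= 1. Proof. by rewrite ge_max ler01 ge_min lexx. Qed.

Let c01_lipschitz s t : `|c01 s - c01 t| <= `|s - t|.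
Proof. exact: le_trans (max_lipschitz _ _ _) (min_lipschitz _ _ _). Qed.

Let c01_eq0 t : t <= 0 -> c01 t = 0.
Proof. by move=> t0; apply/max_idPl; rewrite ge_min t0 orbT. Qed.

Let c01_eq1 t : 1 <= t -> c01 t = 1.
Proof. by move=> t1; rewrite /c01 (min_idPl t1) (max_idPr ler01). Qed.

(* A bump supported where the ratio p.1 / p.2 is under control. *)
Definition cutoff (p : R * R) : R :=
  c01 (N * `|p.2| - 1) * (c01 (N + 1 - `|p.1|) * c01 (N + 1 - `|p.2|)).

Lemma cutoff_ge0 p : 0 <= cutoff p.
Proof. by rewrite /cutoff !mulr_ge0. Qed.

Lemma cutoff_le1 p : cutoff p <= 1.
Proof. by rewrite /cutoff mulr_ile1 ?mulr_ge0// mulr_ile1. Qed.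

Lemma norm_cutoff_le1 p : `|cutoff p| <= 1.
Proof. by rewrite ger0_norm ?cutoff_ge0// cutoff_le1. Qed.

Lemma cutoff_neq0 p : cutoff p != 0 ->
  [/\ `|p.1| <= N + 1, `|p.2| <= N + 1 & N^-1 <= `|p.2|].
Proof.
have N0 : 0 < N by exact: lt_le_trans N1.
rewrite /cutoff !mulf_eq0 !negb_or => /and3P[h1 h2 h3]; split.
- by rewrite leNgt; apply: contraNN h2 => h; rewrite c01_eq0// subr_le0 ltW.
- by rewrite leNgt; apply: contraNN h3 => h; rewrite c01_eq0// subr_le0 ltW.
- rewrite leNgt; apply: contraNN h1 => h; rewrite c01_eq0// subr_le0.
  by rewrite -ler_pdivlMl// mulr1 ltW.
Qed.

Lemma cutoff_eq0 u : cutoff (u, 0) = 0.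
Proof. by rewrite /cutoff/= normr0 mulr0 c01_eq0 ?mul0r// sub0r oppr_le0. Qed.

Lemma cutoff_eq1 p : `|p.1| <= N -> `|p.2| <= N -> 2 <= N * `|p.2| -> cutoff p = 1.
Proof. by move=> h1 h2 h3; rewrite /cutoff !c01_eq1 ?mulr1//; lra. Qed.

Let ucont1_c01 (g : R -> R) (c : R) : 0 < c ->
  (forall x y, `|g x - g y| <= c * `|x - y|) -> ucont1 (fun x => c01 (g x)).
Proof.
move=> c0 gl; apply: (ucont1_lipschitz c0) => x y.
exact: le_trans (c01_lipschitz _ _) (gl x y).
Qed.

Lemma ucont2_cutoff : ucont2 cutoff.
Proof.
have N0 : 0 < N by exact: lt_le_trans N1.
have n1 t : `|c01 t| <= 1 by rewrite ger0_norm.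
have dist x y : `| `|x| - `|y| | <= `|x - y| :> R by exact: ler_dist_dist.
apply: (@ucont2M _ _ _ 1) => //.
- apply: (@ucont2_snd _ (fun x => c01 (N * `|x| - 1))); apply: (ucont1_c01 N0) => x y.
  have -> : N * `|x| - 1 - (N * `|y| - 1) = N * (`|x| - `|y|) by ring.
  by rewrite normrM (gtr0_norm N0) ler_wpM2l// ltW.
- apply: (@ucont2M _ _ _ 1) => //.
  + apply: (@ucont2_fst _ (fun x => c01 (N + 1 - `|x|))); apply: (ucont1_c01 ltr01) => x y.
    have -> : N + 1 - `|x| - (N + 1 - `|y|) = `|y| - `|x| by ring.
    by rewrite mul1r distrC.
  + apply: (@ucont2_snd _ (fun x => c01 (N + 1 - `|x|))); apply: (ucont1_c01 ltr01) => x y.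
    have -> : N + 1 - `|x| - (N + 1 - `|y|) = `|y| - `|x| by ring.
    by rewrite mul1r distrC.
- by move=> p; rewrite normrM mulr_ile1.
Qed.

Let measurable_c01 : measurable_fun setT c01.
Proof. by apply: measurable_maxr => //; exact: measurable_minr. Qed.

Lemma measurable_cutoff : measurable_fun setT cutoff.
Proof.
have m1 : measurable_fun setT (fun p : R * R => `|p.1|).
  by apply: measurableT_comp => //; exact: measurable_fst.
have m2 : measurable_fun setT (fun p : R * R => `|p.2|).
  by apply: measurableT_comp => //; exact: measurable_snd.
apply: measurable_funM; first apply: (measurableT_comp measurable_c01).
  by apply: measurable_funB => //; exact: measurable_funM.
apply: measurable_funM; apply: (measurableT_comp measurable_c01); exact: measurable_funB.
Qed.

Variables (f : R -> R) (M : R).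
Hypotheses (cf : continuous f) (fM : forall x, `|f x| <= M).

(** Equal to 1 / w as soon as |w| >= 1 / N, yet continuous everywhere, including at 0. *)
Let inv_reg (w : R) := w / Num.max (w ^+ 2) (N ^- 2).

Let continuous_inv_reg : continuous inv_reg.
Proof.
have N0 : 0 < N by exact: lt_le_trans N1.
move=> x; apply: cvgM; first exact: cvg_id.
apply: cvgV.
  have : 0 < N ^- 2 by rewrite invr_gt0 exprn_gt0.
  by move=> h; rewrite gt_eqF// lt_max h orbT.
have c1 : {for x, continuous (fun y : R => y ^+ 2 : R^o)} by exact: exprn_continuous.
have c2 : {for x, continuous (fun=> N ^- 2 : R^o)} by exact: cvg_cst.
exact: (continuous_max c1 c2).
Qed.

Let inv_clamp := fun w => clamp N ((inv_reg \o clamp (N + 1)) w).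

(* On the support of the cutoff the clamps are inactive and this is f (p.1 / p.2) times
   the cutoff; they only make the uniform continuity provable factor by factor. *)
Definition ratio_test (p : R * R) : R :=
  (f \o clamp (N * (N + 1))) (clamp (N + 1) p.1 * inv_clamp p.2) * cutoff p.

Let N0 : 0 < N. Proof. exact: lt_le_trans N1. Qed.

Let NS0 : 0 <= N + 1. Proof. by rewrite addr_ge0// ltW. Qed.

Lemma norm_ratio_test p : `|ratio_test p| <= M.
Proof.
rewrite /ratio_test normrM -[leRHS]mulr1.
by apply: ler_pM => //; [exact: fM|exact: norm_cutoff_le1].
Qed.

Lemma ratio_testE p : cutoff p != 0 -> ratio_test p = f (p.1 / p.2) * cutoff p.
Proof.
move=> /cutoff_neq0[h1 h2 h3]; rewrite /ratio_test/=; congr (f _ * _).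
have p20 : p.2 != 0 by rewrite -normr_gt0 (lt_le_trans _ h3)// invr_gt0.
have iE : inv_clamp p.2 = p.2^-1.
  rewrite /inv_clamp/= (clamp_id h2) /inv_reg.
  have /max_idPl -> : N ^- 2 <= p.2 ^+ 2.
    by rewrite -[p.2 ^+ 2]real_normK ?num_real// -exprVn lerXn2r ?nnegrE ?invr_ge0// ltW.
  have -> : p.2 / p.2 ^+ 2 = p.2^-1 by field.
  by rewrite clamp_id// normfV -[leRHS]invrK lef_pV2 ?posrE ?invr_gt0 ?normr_gt0.
rewrite iE (clamp_id h1) clamp_id// normrM mulrC ler_pM//.
by rewrite normfV -[leRHS]invrK lef_pV2 ?posrE ?invr_gt0 ?normr_gt0.
Qed.

Lemma ratio_test_eq0 p : cutoff p = 0 -> ratio_test p = 0.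
Proof. by rewrite /ratio_test => ->; rewrite mulr0. Qed.

Let ucont1_clamp K : ucont1 (clamp K : R -> R).
Proof.
by apply: (ucont1_lipschitz ltr01) => x y; rewrite mul1r; exact: clamp_lipschitz.
Qed.

Lemma ucont2_ratio_test : ucont2 ratio_test.
Proof.
have K0 : 0 <= N * (N + 1) by rewrite mulr_ge0// ltW.
apply: (@ucont2M _ _ _ (Num.max M 1)).
- apply: ucont2_comp; first exact: heine_cantor_clamp.
  apply: (@ucont2M _ _ _ (N + 1)).
  + exact: ucont2_fst.
  + apply: ucont2_snd => e e0.
    have [d d0 h] := heine_cantor_clamp NS0 continuous_inv_reg e0.
    by exists d => // x y xy; rewrite (le_trans (clamp_lipschitz _ _ _))//; exact: h.
  + by move=> p; exact: norm_clamp_le.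
  + by move=> p; rewrite (le_trans (norm_clamp_le _ (ltW N0)))// lerDl.
- exact: ucont2_cutoff.
- by move=> p; rewrite le_max (fM _).
- by move=> p; rewrite le_max norm_cutoff_le1 orbT.
Qed.

Lemma measurable_ratio_test : measurable_fun setT ratio_test.
Proof.
have mclamp K : measurable_fun setT (clamp K : R -> R).
  by apply: measurable_maxr => //; exact: measurable_minr.
have mf : measurable_fun setT f by exact: continuous_measurable_fun.
have mi : measurable_fun setT inv_reg by exact: continuous_measurable_fun.
apply: measurable_funM; last exact: measurable_cutoff.
apply: (measurableT_comp (measurableT_comp mf (mclamp _))).
apply: measurable_funM.
  by apply: (measurableT_comp (mclamp _)); exact: measurable_fst.
have m3 : measurable_fun setT inv_clamp.
  exact: (measurableT_comp (mclamp _) (measurableT_comp mi (mclamp _))).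
by apply: (measurableT_comp m3); exact: measurable_snd.
Qed.

End cutoff.

(** The integral is taken in the extended reals, so that the bound includes integrability. *)
Definition L1_bound d (T : measurableType d) (R : realType) (P : probability T R)
    (X : T -> R) (c : R) : Prop :=
  measurable_fun setT X /\ (\int[P]_w (`|X w|)%:E <= c%:E)%E.

(** An explicit null majorant, required only from some rank on, lets errors be added and scaled
    without evaluating any expectation. *)
Definition L1_small d (T : measurableType d) (R : realType) (P : probability T R)
    (X : nat -> T -> R) : Prop :=
  exists2 c : nat -> R, c n @[n --> \oo] --> 0 &
    \forall n \near \oo, L1_bound P (X n) (c n).

Lemma L1_bound_integrable d (T : measurableType d) (R : realType)
    (P : probability T R) (X : T -> R) (c : R) :
  L1_bound P X c -> P.-integrable setT (EFin \o X).
Proof.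
move=> [mX Xc]; apply/integrableP; split; first exact/measurable_EFinP.
by rewrite (le_lt_trans Xc)// ltry.
Qed.

Lemma L1_bound_Rintegral d (T : measurableType d) (R : realType)
    (P : probability T R) (X : T -> R) (c : R) :
  L1_bound P X c -> \int[P]_w `|X w| <= c.
Proof.
move=> Xc; have [_ h] := Xc; rewrite -lee_fin /Rintegral fineK//.
apply: integrable_fin_num => //.
exact: (integrable_norm (L1_bound_integrable Xc)).
Qed.

Lemma Rintegral_dist_le d (T : measurableType d) (R : realType)
    (P : probability T R) (X Y Z : T -> R) :
  P.-integrable setT (EFin \o X) -> P.-integrable setT (EFin \o Y) ->
  P.-integrable setT (EFin \o Z) -> (forall w, `|X w - Y w| <= Z w) ->
  `|\int[P]_w X w - \int[P]_w Y w| <= \int[P]_w Z w.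
Proof.
move=> iX iY iZ XYZ; rewrite -RintegralB//.
have iXY : P.-integrable setT (EFin \o (fun w => X w - Y w)).
  by have := integrableB measurableT iX iY.
rewrite (le_trans (le_normr_Rintegral measurableT iXY))//.
by apply: le_Rintegral => //; exact: (integrable_norm iXY).
Qed.

Lemma measurable_invr (R : realType) : measurable_fun setT (fun x : R => x^-1).
Proof.
have -> : [set: R] = [set x | x != 0] `|` [set 0].
  by apply/esym/seteqP; split => // x _ /=; case: (eqVneq x 0); [right|left].
have o0 : open [set x : R | x != 0].
  have -> : [set x : R | x != 0] = ~` [set 0] by apply/seteqP; split => x /=/eqP.
  by rewrite openC; exact: closed_eq.
apply/measurable_funU => //; first exact: open_measurable.
split; last exact: measurable_fun_set1.
by apply: open_continuous_measurable_fun => // x; rewrite inE/= => x0; exact: inv_continuous.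
Qed.

Section ratio.
Context d (T : measurableType d) d' (T' : measurableType d') (R : realType)
  (P : probability T R) (Q : probability T' R)
  (U W A B Y : nat -> T -> R) (xi eta : T' -> R).
Hypothesis mU : forall n, measurable_fun setT (U n).
Hypothesis mW : forall n, measurable_fun setT (W n).
Hypothesis mY : forall n, measurable_fun setT (Y n).
Hypothesis mxi : measurable_fun setT xi.
Hypothesis meta : measurable_fun setT eta.
Hypothesis cos_cvg : forall t1 t2 b,
  \int[P]_w cos (t1 * U n w + t2 * W n w + b) @[n --> \oo] -->
  \int[Q]_w cos (t1 * xi w + t2 * eta w + b).
Hypothesis A_UW : L1_small P (fun n w => A n w - U n w * W n w).
Hypothesis B_WW : L1_small P (fun n w => B n w - W n w ^+ 2).
Hypothesis Y_AB : \forall n \near \oo, forall w, B n w != 0 -> Y n w = A n w / B n w.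
Hypothesis eta_neq0 : Q [set w | eta w = 0] = 0%E.

Let cut n (p : R * R) := cutoff n.+1%:R p.

Let N1 n : 1 <= n.+1%:R :> R. Proof. by rewrite ler1n. Qed.

Let mcutQ n : measurable_fun setT (fun w => cut n (xi w, eta w)).
Proof.
by apply: (measurableT_comp (measurable_cutoff _)); exact: measurable_fun_pair.
Qed.

(** As N grows the cutoff tends to 1 where eta != 0 and stays 0 where eta = 0, so the lost mass
    tends to Q (eta = 0) = 0. *)
Let cut_cvg : \int[Q]_w (1 - cut n (xi w, eta w)) @[n --> \oo] --> 0.
Proof.
have norm1 n p : `|1 - cut n p| <= 1.
  have := cutoff_ge0 n.+1%:R p; have := cutoff_le1 n.+1%:R p.
  by rewrite /cut => h1 h2; rewrite ger0_norm ?subr_ge0// gerBl.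
suff H : (\int[Q]_w (1 - cut n (xi w, eta w))%:E)%E @[n --> \oo] --> (0 : R)%:E.
  exact: fine_cvg H.
have -> : (0 : R)%:E = (\int[Q]_w (\1_[set w | eta w = 0] w)%:E)%E.
  have mz : measurable [set w | eta w = 0].
    by rewrite -[X in measurable X]setTI; exact: (meta measurableT (measurable_set1 0)).
  by rewrite integral_indic// setIT; exact/esym.
apply: (@dominated_cvg _ _ _ Q setT measurableT (fun n w => (1 - cut n (xi w, eta w))%:E)
  (fun w => (\1_[set w | eta w = 0] w)%:E) (cst 1%:E)) => //=.
- by move=> n; apply/measurable_EFinP; exact: measurable_funB.
- move=> w _; apply: cvg_EFin; first exact: nearW.
  rewrite indicE; have [w0|w0] := eqVneq (eta w) 0.
    rewrite mem_set//; apply: cvg_near_cst; apply: nearW => n.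
    by rewrite /= /cut w0 cutoff_eq0 subr0.
  rewrite memNset; last by move=> /eqP; rewrite (negbTE w0).
  apply: cvg_near_cst.
  have large c : \forall n \near \oo, c <= n.+1%:R :> R.
    apply: filterS (nbhs_infty_ger c) => n cn.
    by rewrite (le_trans cn)// ler_nat.
  near=> n; rewrite /= /cut cutoff_eq1 ?subrr//=.
  + by near: n; exact: large.
  + by near: n; exact: large.
  + by rewrite -ler_pdivrMr ?normr_gt0//; near: n; exact: large.
- exact: finite_measure_integrable_cst.
- by move=> n w _; rewrite lee_fin.
Unshelve. all: by end_near. Qed.

(** The cutoff makes a test function of the ratio continuous in (U, W), at the price of the mass it
    removes. That mass is made small under Q and transferred to P, since the cutoff is itself a test
    function with bounded support. *)
Theorem cvg_in_distribution_ratio :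
  cvg_in_distribution P Q Y (fun w => xi w / eta w).
Proof.
move=> f cf [M0 [_ /(_ (Num.max M0 0 + 1))]].
set M := Num.max M0 0 + 1 => fM.
have M0M : M0 < M by rewrite (@le_lt_trans _ _ (Num.max M0 0)) ?le_max ?lexx// ltrDl.
have {fM M0M} fM x : `|f x| <= M by apply: fM.
have M_gt0 : 0 < M by rewrite ltr_wpDl// le_max lexx orbT.
have mf : measurable_fun setT f by exact: continuous_measurable_fun.
have mfY n : measurable_fun setT (f \o Y n) by exact: measurableT_comp.
have mfxe : measurable_fun setT (fun w => f (xi w / eta w)).
  apply: (measurableT_comp mf); apply: measurable_funM => //.
  exact: (measurableT_comp (@measurable_invr R)).
have ifY n : P.-integrable setT (EFin \o (f \o Y n)) by apply: (@integrable_bounded _ _ _ _ _ M) => // w; exact: fM.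
have ifxe : Q.-integrable setT (EFin \o (fun w => f (xi w / eta w))).
  by apply: (@integrable_bounded _ _ _ _ _ M) => // w; exact: fM.
suff H : \int[P]_w f (Y n w) @[n --> \oo] --> \int[Q]_w f (xi w / eta w).
  have EE d0 (T0 : measurableType d0) (P0 : probability T0 R) (h : T0 -> R) :
      P0.-integrable setT (EFin \o h) -> 'E_P0[h]%E = (\int[P0]_w h w)%:E.
    by move=> ih; rewrite unlock /Rintegral fineK//; exact: integrable_fin_num.
  rewrite (eq_cvg _ _ (fun n => EE _ _ _ _ (ifY n))) (EE _ _ _ _ ifxe).
  by apply: cvg_EFin; [exact: nearW|exact: H].
apply/cvgrPdist_le => e e0.
(* The budget: M (2 e1) + 2 e1 for passing from Y to (U, W), e1 for the convergence of the test
   function, M e1 for removing the cutoff under Q. *)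
pose e1 := e / (3 * M + 3).
have e10 : 0 < e1 by rewrite divr_gt0// addr_gt0// mulr_gt0.
have eE : e = (3 * M + 3) * e1 by rewrite mulrC divfK// gt_eqF// addr_gt0// mulr_gt0.
have [n0 hn0] : exists n0, \int[Q]_w (1 - cut n0 (xi w, eta w)) <= e1.
  have /cvgrPdist_le/(_ _ e10)[n0 _ h] := cut_cvg.
  by exists n0; have := h n0 (leqnn _); rewrite sub0r normrN => /(le_trans (ler_norm _)).
pose N : R := n0.+1%:R; have N_ge1 : 1 <= N := N1 n0.
have N_gt0 : 0 < N by exact: lt_le_trans N_ge1.
pose g := ratio_test N f.
(* On the support of the cutoff |U / W| is at most N (N + 1), and A / B will be within 1 of it. *)
pose K := N * (N + 1) + 1.
have K0 : 0 <= K by rewrite addr_ge0// mulr_ge0 ?addr_ge0// ltW.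
have [dl dl0 hdl] := heine_cantor_clamp K0 cf e10.
(* The first bound keeps B away from 0 in [ratio_close]; the second makes the two ratios differ by
   at most min 1 dl. *)
pose del := Num.min ((2 * N ^+ 2)^-1) (Num.min 1 dl / (4 * N ^+ 3 * (N + 1))).
have c1 : 0 < 2 * N ^+ 2 by rewrite mulr_gt0// exprn_gt0.
have c2 : 0 < 4 * N ^+ 3 * (N + 1) by rewrite !mulr_gt0 ?exprn_gt0// addr_gt0.
have del0 : 0 < del by rewrite lt_min invr_gt0 c1/= divr_gt0// lt_min ltr01.
have del1 : del * (2 * N ^+ 2) <= 1.
  by rewrite -ler_pdivlMr// div1r ge_min lexx.
have del2 : 4 * del * N ^+ 3 * (N + 1) <= Num.min 1 dl.
  have -> : 4 * del * N ^+ 3 * (N + 1) = del * (4 * N ^+ 3 * (N + 1)) by ring.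
  by rewrite -ler_pdivlMr// ge_min lexx orbT.
pose a n w := A n w - U n w * W n w; pose b n w := B n w - W n w ^+ 2.
have gbound p : `|g p| <= M by exact: norm_ratio_test.
(* If both errors are at most del, [ratio_close] applies. Otherwise the trivial bound 2 M is at most
   2 M / del times the error, as in Markov's inequality. *)
have point n w : (forall w, B n w != 0 -> Y n w = A n w / B n w) ->
  `|f (Y n w) - g (U n w, W n w)| <=
  M * (1 - cut n0 (U n w, W n w)) + (e1 + 2 * M / del * (`|a n w| + `|b n w|)).
  move=> Yn; set u := U n w; set v := W n w.
  have x0 := cutoff_ge0 N (u, v); have x1 := cutoff_le1 N (u, v).
  have ab0 : 0 <= 2 * M / del * (`|a n w| + `|b n w|).
    by apply: mulr_ge0; [rewrite divr_ge0 ?mulr_ge0 ?ltW|rewrite addr_ge0].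
  have [c0|cN0] := eqVneq (cutoff N (u, v)) 0.
    rewrite /g ratio_test_eq0// subr0 /cut -/N c0 subr0 mulr1.
    by rewrite (le_trans (fM _))// lerDl addr_ge0// (ltW e10).
  rewrite /g ratio_testE// /cut -/N/=; set x := cutoff N (u, v).
  have [h1 h2 h3] := cutoff_neq0 N_ge1 cN0.
  suff H : `|f (Y n w) - f (u / v)| <= e1 + 2 * M / del * (`|a n w| + `|b n w|).
    have -> : f (Y n w) - f (u / v) * x = (1 - x) * f (Y n w) + x * (f (Y n w) - f (u / v)).
      by ring.
    rewrite (le_trans (ler_normD _ _))// lerD//.
      rewrite normrM (ger0_norm (_ : 0 <= 1 - x)) ?subr_ge0// mulrC.
      by rewrite ler_wpM2r ?subr_ge0.
    rewrite normrM (ger0_norm x0) (le_trans _ H)//.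
    by rewrite ler_piMl.
  have big t : del <= t -> `|f (Y n w) - f (u / v)| <= e1 + 2 * M / del * t.
    move=> tdel; rewrite (le_trans (ler_normB _ _))//.
    rewrite (@le_trans _ _ (M + M))//; first exact: lerD.
    apply: (ler_wpDl (ltW e10)).
    have -> : M + M = 2 * M / del * del by field; rewrite gt_eqF.
    by rewrite ler_wpM2l// divr_ge0 ?mulr_ge0// ltW.
  have [ad|ad] := leP (`|a n w|) del; last by apply: big; rewrite ler_wpDr// ltW.
  have [bd|bd] := leP (`|b n w|) del; last by apply: big; rewrite ler_wpDl// ltW.
  have [B0 rc] := ratio_close N_ge1 h1 h2 h3 ad bd del1.
  rewrite (Yn _ B0); move: rc => /= /le_trans/(_ del2).
  rewrite le_min => /andP[rc1 rcd].
  have uv : `|u / v| <= N * (N + 1).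
    rewrite normrM mulrC ler_pM// normfV -[leRHS]invrK lef_pV2 ?posrE ?invr_gt0//.
    by rewrite (lt_le_trans _ h3)// invr_gt0.
  have uvK : `|u / v| <= K by rewrite (le_trans uv)// lerDl.
  have ABK : `|A n w / B n w| <= K.
    rewrite -[A n w / B n w](subrK (u / v)) (le_trans (ler_normD _ _))//.
    by rewrite /K addrC lerD.
  have := hdl _ _ rcd; rewrite /= (clamp_id uvK) (clamp_id ABK) => /le_trans; apply.
  by rewrite lerDl.
have pointQ w : `|g (xi w, eta w) - f (xi w / eta w)| <= M * (1 - cut n0 (xi w, eta w)).
  rewrite /cut -/N; set x := cutoff _ _.
  have x0 : 0 <= x := cutoff_ge0 N _; have x1 : x <= 1 := cutoff_le1 N _.
  have [c0|cN0] := eqVneq x 0.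
    by rewrite /g ratio_test_eq0// sub0r normrN c0 subr0 mulr1.
  rewrite /g ratio_testE//= -/x.
  have -> : f (xi w / eta w) * x - f (xi w / eta w) = - (f (xi w / eta w) * (1 - x)) by ring.
  by rewrite normrN normrM (ger0_norm (_ : 0 <= 1 - x)) ?subr_ge0// ler_wpM2r ?subr_ge0.
have iQ1 : Q.-integrable setT (EFin \o (fun w => 1 - cut n0 (xi w, eta w))).
  apply: (@integrable_bounded _ _ _ _ _ 1); first exact: measurable_funB.
  move=> w; have := cutoff_ge0 N (xi w, eta w); have := cutoff_le1 N (xi w, eta w).
  by rewrite /cut => h1 h2; rewrite ger0_norm ?subr_ge0// gerBl.
have mUW n : measurable_fun setT (fun w => (U n w, W n w)) by exact: measurable_fun_pair.
have mcP n : measurable_fun setT (fun w => cut n0 (U n w, W n w)).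
  exact: (measurableT_comp (measurable_cutoff _) (mUW n)).
have iP1 n : P.-integrable setT (EFin \o (fun w => 1 - cut n0 (U n w, W n w))).
  apply: (@integrable_bounded _ _ _ _ _ 1); first exact: measurable_funB.
  move=> w; have := cutoff_ge0 N (U n w, W n w); have := cutoff_le1 N (U n w, W n w).
  by rewrite /cut => h1 h2; rewrite ger0_norm ?subr_ge0// gerBl.
have mg : measurable_fun setT g by exact: measurable_ratio_test.
have igP n : P.-integrable setT (EFin \o (fun w => g (U n w, W n w))).
  by apply: (@integrable_bounded _ _ _ _ _ M) => //; exact: (measurableT_comp mg (mUW n)).
have igQ : Q.-integrable setT (EFin \o (fun w => g (xi w, eta w))).
  apply: (@integrable_bounded _ _ _ _ _ M) => //.
  by apply: (measurableT_comp mg); exact: measurable_fun_pair.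
have B3 : `|\int[Q]_w g (xi w, eta w) - \int[Q]_w f (xi w / eta w)| <= M * e1.
  have iQ2 : Q.-integrable setT (EFin \o (fun w => M * (1 - cut n0 (xi w, eta w)))).
    by have := integrableZl measurableT M iQ1.
  rewrite (le_trans (Rintegral_dist_le igQ ifxe iQ2 pointQ))// RintegralZl//.
  by rewrite ler_wpM2l// ltW.
have gcv : \int[P]_w g (U n w, W n w) @[n --> \oo] --> \int[Q]_w g (xi w, eta w).
  apply: (cvg_expectation_of_cos mU mW mxi meta cos_cvg (M := M) (L := N + 1)) => //.
    move=> p; apply: contraNP => hp; apply/eqP; apply: ratio_test_eq0; apply/eqP.
    by apply: contra_notT hp => /(cutoff_neq0 N_ge1)[].
  exact: (ucont2_ratio_test N_ge1 cf fM).
have ccv : \int[P]_w (1 - cut n0 (U n w, W n w)) @[n --> \oo] --> \int[Q]_w (1 - cut n0 (xi w, eta w)).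
  (* The function 1 - cut has unbounded support; the convergence is proved for the cutoff and
     transferred by total mass 1. *)
  have cutcv : \int[P]_w cut n0 (U n w, W n w) @[n --> \oo] --> \int[Q]_w cut n0 (xi w, eta w).
    apply: (cvg_expectation_of_cos mU mW mxi meta cos_cvg (M := 1) (L := N + 1)).
    - exact: measurable_cutoff.
    - exact: norm_cutoff_le1.
    - by move=> p /(cutoff_neq0 N_ge1)[].
    - exact: (ucont2_cutoff N_ge1).
  have sub1 d0 (T0 : measurableType d0) (P0 : probability T0 R) (u : T0 -> R * R) :
      measurable_fun setT (fun w => cut n0 (u w)) ->
      \int[P0]_w (1 - cut n0 (u w)) = 1 - \int[P0]_w cut n0 (u w).
    move=> mu; rewrite RintegralB ?Rintegral_probability_cst//.
      exact: finite_measure_integrable_cst.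
    by apply: (@integrable_bounded _ _ _ _ _ 1) => // w; exact: norm_cutoff_le1.
  rewrite (eq_cvg _ _ (fun n => sub1 _ _ _ _ (mcP n))) (sub1 _ _ _ _ (mcutQ n0)).
  by apply: cvgB => //; exact: cvg_cst.
case: A_UW => ca ca0 hca; case: B_WW => cb cb0 hcb.
have sm : 2 * M / del * (ca n + cb n) @[n --> \oo] --> 0.
  rewrite -[X in _ --> X](mulr0 (2 * M / del)); apply: cvgM; first exact: cvg_cst.
  by rewrite -[X in _ --> X](addr0 0); exact: cvgD.
move/cvgrPdist_le/(_ _ e10): gcv => gcv.
move/cvgrPdist_le/(_ _ e10): ccv => ccv.
move/cvgrPdist_le/(_ _ e10): sm => sm.
near=> n.
have hg : `|\int[Q]_w g (xi w, eta w) - \int[P]_w g (U n w, W n w)| <= e1 by near: n.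
have hc : `|\int[Q]_w (1 - cut n0 (xi w, eta w)) - \int[P]_w (1 - cut n0 (U n w, W n w))| <= e1 by near: n.
have hs : `|0 - 2 * M / del * (ca n + cb n)| <= e1 by near: n.
have Yn : forall w, B n w != 0 -> Y n w = A n w / B n w by near: n.
have ba : L1_bound P (a n) (ca n) by near: n.
have bb : L1_bound P (b n) (cb n) by near: n.
have ia := L1_bound_integrable ba; have ib := L1_bound_integrable bb.
have B1 : `|\int[P]_w f (Y n w) - \int[P]_w g (U n w, W n w)| <= M * (2 * e1) + (e1 + e1).
  have i1 : P.-integrable setT (EFin \o (fun w => M * (1 - cut n0 (U n w, W n w)))).
    by have := integrableZl measurableT M (iP1 n).
  have i2 : P.-integrable setT (EFin \o (fun w => `|a n w| + `|b n w|)).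
    by have := integrableD measurableT (integrable_norm ia) (integrable_norm ib).
  have i3 : P.-integrable setT (EFin \o (fun w => 2 * M / del * (`|a n w| + `|b n w|))).
    by have := integrableZl measurableT (2 * M / del) i2.
  have i4 : P.-integrable setT (EFin \o (fun=> e1)) by exact: finite_measure_integrable_cst.
  have i5 : P.-integrable setT (EFin \o (fun w => e1 + 2 * M / del * (`|a n w| + `|b n w|))).
    by have := integrableD measurableT i4 i3.
  have i6 : P.-integrable setT (EFin \o (fun w => M * (1 - cut n0 (U n w, W n w)) +
      (e1 + 2 * M / del * (`|a n w| + `|b n w|)))).
    by have := integrableD measurableT i1 i5.
  rewrite (le_trans (Rintegral_dist_le (ifY n) (igP n) i6 (fun w => point n w Yn)))//.
  rewrite (RintegralD measurableT i1 i5) (RintegralD measurableT i4 i3).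
  rewrite (RintegralZl _ measurableT (iP1 n)) (RintegralZl _ measurableT i2).
  rewrite (Rintegral_probability_cst P e1).
  rewrite (RintegralD measurableT (integrable_norm ia) (integrable_norm ib)).
  apply: lerD.
    rewrite ler_wpM2l ?(ltW M_gt0)//; move: hc; rewrite distrC => /ler_normlW; move: hn0; lra.
  rewrite lerD2l; move: hs; rewrite sub0r normrN => /ler_normlW; apply: le_trans.
  apply: ler_wpM2l; first by rewrite divr_ge0 ?mulr_ge0// ltW.
  by apply: lerD; exact: L1_bound_Rintegral.
have := ler_normD (\int[Q]_w f (xi w / eta w) - \int[Q]_w g (xi w, eta w)) (\int[Q]_w g (xi w, eta w) - \int[P]_w g (U n w, W n w) + (\int[P]_w g (U n w, W n w) - \int[P]_w f (Y n w))).
have := ler_normD (\int[Q]_w g (xi w, eta w) - \int[P]_w g (U n w, W n w)) (\int[P]_w g (U n w, W n w) - \int[P]_w f (Y n w)).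
have -> : \int[Q]_w f (xi w / eta w) - \int[Q]_w g (xi w, eta w) + (\int[Q]_w g (xi w, eta w) - \int[P]_w g (U n w, W n w) + (\int[P]_w g (U n w, W n w) - \int[P]_w f (Y n w))) = \int[Q]_w f (xi w / eta w) - \int[P]_w f (Y n w) by ring.
move: B1 B3 hg; rewrite distrC => B1; rewrite distrC => B3 hg; rewrite eE.
lra.
Unshelve. all: by end_near. Qed.

End ratio.

(** * First and second moment bounds *)

Section L1_L2.
Context d (T : measurableType d) (R : realType) (P : probability T R).
Implicit Types (X Y : T -> R) (c : R).

Definition L2_bound X c : Prop :=
  measurable_fun setT X /\ (\int[P]_w (X w ^+ 2)%:E <= c%:E)%E.

Lemma L1_bound_le X c c' : c <= c' -> L1_bound P X c -> L1_bound P X c'.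
Proof. by move=> cc [mX Xc]; split=> //; rewrite (le_trans Xc)// lee_fin. Qed.

Lemma L2_bound_le X c c' : c <= c' -> L2_bound X c -> L2_bound X c'.
Proof. by move=> cc [mX Xc]; split=> //; rewrite (le_trans Xc)// lee_fin. Qed.

Lemma L1_boundZ X c r : L1_bound P X c -> L1_bound P (fun w => r * X w) (`|r| * c).
Proof.
move=> [mX Xc]; split; first exact: measurable_funM.
under eq_integral do rewrite normrM EFinM.
rewrite ge0_integralZl_EFin//; last first.
  by apply/measurable_EFinP; exact: measurableT_comp.
by rewrite EFinM lee_wpmul2l// lee_fin.
Qed.

Lemma L1_boundD X Y c c' : L1_bound P X c -> L1_bound P Y c' ->
  L1_bound P (fun w => X w + Y w) (c + c').
Proof.
move=> [mX Xc] [mY Yc]; split; first exact: measurable_funD.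
have mnX : measurable_fun setT (fun w => (`|X w|)%:E).
  by apply/measurable_EFinP; exact: measurableT_comp.
have mnY : measurable_fun setT (fun w => (`|Y w|)%:E).
  by apply/measurable_EFinP; exact: measurableT_comp.
apply: (@le_trans _ _ (\int[P]_w ((`|X w|)%:E + (`|Y w|)%:E))%E).
  apply: ge0_le_integral => //.
  - by apply/measurable_EFinP; apply: measurableT_comp => //; exact: measurable_funD.
  - exact: emeasurable_funD.
  - by move=> w _; rewrite -EFinD lee_fin ler_normD.
by rewrite ge0_integralD// EFinD leeD.
Qed.

Lemma L1_bound0 : L1_bound P (fun=> 0) 0.
Proof.
split; first exact: measurable_cst.
by under eq_integral do rewrite normr0; rewrite integral0.
Qed.

Lemma L1_bound_sum (n : nat) (X : nat -> T -> R) (c : nat -> R) :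
  (forall k, (1 <= k <= n)%N -> L1_bound P (X k) (c k)) ->
  L1_bound P (fun w => \sum_(1 <= k < n.+1) X k w) (\sum_(1 <= k < n.+1) c k).
Proof.
elim: n => [_|n IH h].
  by rewrite big_geq//; have := L1_bound0; congr L1_bound; apply/funext => w; rewrite big_geq.
rewrite big_nat_recr//=.
have -> : (fun w => \sum_(1 <= k < n.+2) X k w) =
    (fun w => \sum_(1 <= k < n.+1) X k w + X n.+1 w).
  by apply/funext => w; rewrite big_nat_recr.
apply: L1_boundD; last by apply: h; rewrite leqnn.
by apply: IH => k /andP[k1 kn]; apply: h; rewrite k1 ltnW.
Qed.

(** |X Y| <= (X^2 + Y^2) / 2 gives the product the same constant as its two factors. *)
Lemma L2_boundM X Y c : L2_bound X c -> L2_bound Y c ->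
  L1_bound P (fun w => X w * Y w) c.
Proof.
move=> [mX Xc] [mY Yc]; split; first exact: measurable_funM.
have m2 (Z : T -> R) : measurable_fun setT Z ->
    measurable_fun setT (fun w => (2^-1 * Z w ^+ 2)%:E).
  by move=> mZ; apply/measurable_EFinP; apply: measurable_funM => //; exact: measurable_funX.
have half (Z : T -> R) : measurable_fun setT Z ->
    (\int[P]_w (Z w ^+ 2)%:E <= c%:E -> \int[P]_w (2^-1 * Z w ^+ 2)%:E <= (2^-1 * c)%:E)%E.
  move=> mZ Zc; under eq_integral do rewrite EFinM.
  rewrite ge0_integralZl_EFin//; first by rewrite EFinM lee_wpmul2l// lee_fin.
  - by move=> w _; rewrite lee_fin sqr_ge0.
  - by apply/measurable_EFinP; exact: measurable_funX.
have -> : c = 2^-1 * c + 2^-1 * c by field.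
rewrite EFinD; apply: le_trans (leeD (half X mX Xc) (half Y mY Yc)).
rewrite -ge0_integralD//; try exact: m2.
- apply: ge0_le_integral => //.
  + by apply/measurable_EFinP; apply: measurableT_comp => //; exact: measurable_funM.
  + by apply: emeasurable_funD; exact: m2.
  + move=> w _; rewrite -EFinD lee_fin; have := sqr_ge0 (X w - Y w); have := sqr_ge0 (X w + Y w).
    by rewrite ler_norml => *; apply/andP; split; nra.
- by move=> w _; rewrite lee_fin mulr_ge0// sqr_ge0.
- by move=> w _; rewrite lee_fin mulr_ge0// sqr_ge0.
Qed.

Lemma L2_boundZ X c r : L2_bound X c -> L2_bound (fun w => r * X w) (r ^+ 2 * c).
Proof.
move=> [mX Xc]; split; first exact: measurable_funM.
under eq_integral do rewrite exprMn EFinM.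
rewrite ge0_integralZl_EFin//.
- by rewrite [leRHS]EFinM; apply: lee_wpmul2l => //; rewrite lee_fin sqr_ge0.
- by move=> w _; rewrite lee_fin sqr_ge0.
- by apply/measurable_EFinP; exact: measurable_funX.
- by rewrite sqr_ge0.
Qed.

Lemma L2_boundD X Y c c' : L2_bound X c -> L2_bound Y c' ->
  L2_bound (fun w => X w + Y w) (2 * (c + c')).
Proof.
move=> [mX Xc] [mY Yc]; split; first exact: measurable_funD.
have m2 (Z : T -> R) : measurable_fun setT Z -> measurable_fun setT (fun w => (Z w ^+ 2)%:E).
  by move=> mZ; apply/measurable_EFinP; exact: measurable_funX.
have s0 (Z : T -> R) w : setT w -> (0 <= (Z w ^+ 2)%:E)%E by rewrite lee_fin sqr_ge0.
apply: (@le_trans _ _ (\int[P]_w (2%:E * ((X w ^+ 2)%:E + (Y w ^+ 2)%:E)))%E).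
  apply: ge0_le_integral => //.
  - by move=> w _; rewrite lee_fin sqr_ge0.
  - by apply: m2; exact: measurable_funD.
  - by apply: measurable_funeM; apply: emeasurable_funD; exact: m2.
  - move=> w _; rewrite -EFinD -EFinM lee_fin; have := sqr_ge0 (X w - Y w); nra.
rewrite ge0_integralZl_EFin//.
- rewrite EFinM lee_wpmul2l//.
  by rewrite ge0_integralD//; [rewrite EFinD leeD|exact: s0|exact: m2|exact: s0|exact: m2].
- by move=> w _; rewrite -EFinD lee_fin addr_ge0// sqr_ge0.
- by apply: emeasurable_funD; exact: m2.
Qed.

Definition L1_bounded (X : nat -> T -> R) : Prop :=
  exists c, \forall n \near \oo, L1_bound P (X n) c.

Lemma L1_small_eq (X Y : nat -> T -> R) :
  (\forall n \near \oo, forall w, X n w = Y n w) -> L1_small P X -> L1_small P Y.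
Proof.
move=> XY [c c0 hc]; exists c => //; apply: filterS2 XY hc => n XY.
by have -> : X n = Y n by exact/funext.
Qed.

Lemma L1_smallD (X Y : nat -> T -> R) : L1_small P X -> L1_small P Y ->
  L1_small P (fun n w => X n w + Y n w).
Proof.
move=> [c c0 hc] [e e0 he]; exists (fun n => c n + e n).
  by rewrite -[X in _ --> X](addr0 0); exact: cvgD.
by apply: filterS2 hc he => n; exact: L1_boundD.
Qed.

Lemma L1_bounded_smallZ (X : nat -> T -> R) (r : nat -> R) :
  r n @[n --> \oo] --> 0 -> L1_bounded X -> L1_small P (fun n w => r n * X n w).
Proof.
move=> r0 [c hc]; exists (fun n => `|r n| * c).
  rewrite -[X in _ --> X](mul0r c) -(@normr0 _ R).
  by apply: cvgM; [exact: cvg_norm|exact: cvg_cst].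
by apply: filterS hc => n; exact: L1_boundZ.
Qed.

Lemma L1_small_bounded (X : nat -> T -> R) : L1_small P X -> L1_bounded X.
Proof.
move=> [c c0 hc]; exists 1; move/cvgrPdist_le/(_ _ ltr01): c0 => c0.
apply: filterS2 c0 hc => n; rewrite sub0r normrN => /ler_normlW.
exact: L1_bound_le.
Qed.

Lemma L1_boundedD (X Y : nat -> T -> R) : L1_bounded X -> L1_bounded Y ->
  L1_bounded (fun n w => X n w + Y n w).
Proof.
move=> [c hc] [e he]; exists (c + e).
by apply: filterS2 hc he => n; exact: L1_boundD.
Qed.

(* The exploding parts multiply to the second sum; every remaining product pairs at most
   one exploding factor with a stationary one. *)
Lemma cross_sum_L1_bound (a b e f : nat -> T -> R) (p q D : R) (n : nat) :
  0 <= p -> 0 <= q ->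
  (forall k, (1 <= k <= n)%N -> [/\ L2_bound (a k) D, L2_bound (b k) D,
    L2_bound (e k) D & L2_bound (f k) D]) ->
  L1_bound P (fun w => \sum_(1 <= k < n.+1)
       (p ^+ k * a k w + e k w) * (q ^+ k * b k w + f k w) -
     \sum_(1 <= k < n.+1) (p * q) ^+ k * (a k w * b k w))
   (D * (\sum_(1 <= k < n.+1) p ^+ k + \sum_(1 <= k < n.+1) q ^+ k + n%:R)).
Proof.
move=> p0 q0 h.
have := @L1_bound_sum n (fun k w => p ^+ k * (a k w * f k w) + q ^+ k * (e k w * b k w) + e k w * f k w)
  (fun k => `|p ^+ k| * D + `|q ^+ k| * D + D).
have -> : \sum_(1 <= k < n.+1) (`|p ^+ k| * D + `|q ^+ k| * D + D) =
    D * (\sum_(1 <= k < n.+1) p ^+ k + \sum_(1 <= k < n.+1) q ^+ k + n%:R).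
  rewrite !big_split/= sumr_const_nat subn1/= !mulrDr mulr_natr; congr (_ + _ + _);
    by rewrite mulr_sumr; apply: eq_bigr => k _; rewrite ger0_norm ?exprn_ge0// mulrC.
have -> : (fun w => \sum_(1 <= k < n.+1)
       (p ^+ k * a k w + e k w) * (q ^+ k * b k w + f k w) -
     \sum_(1 <= k < n.+1) (p * q) ^+ k * (a k w * b k w)) =
   (fun w => \sum_(1 <= k < n.+1)
     (p ^+ k * (a k w * f k w) + q ^+ k * (e k w * b k w) + e k w * f k w)).
  by apply/funext => w; rewrite -sumrB; apply: eq_bigr => k _; rewrite exprMn; ring.
apply => k /h[ha hb he hf].
by do !apply: L1_boundD; do ?apply: L1_boundZ; exact: L2_boundM.
Qed.

End L1_L2.

(** * Geometric sums *)

(** With x = p^2 and up to the factor s2, a = 0 and a = 2 give the second moments of the discounted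
    sums of V, and a = 1 their covariance. *)
Definition geo (R : realType) (a : nat) (x : R) (n : nat) : R :=
  \sum_(1 <= j < n.+1) j%:R ^+ a * x ^- j.

Section geometric_sums.
Context {R : realType}.
Implicit Types (x y : R).

Lemma geoS a x n : geo a x n.+1 = geo a x n + n.+1%:R ^+ a * x ^- n.+1.
Proof. by rewrite /geo big_nat_recr. Qed.

Lemma geo_nil a x : geo a x 0 = 0.
Proof. by rewrite /geo big_geq. Qed.

(** Multiplying by x - 1 avoids dividing by it; the same form for a = 1, 2 expresses each sum
    through the lower ones and a boundary term. *)
Lemma geo0E x n : x != 0 -> (x - 1) * geo 0 x n = 1 - x ^- n.
Proof.
move=> x0; elim: n => [|n IH]; first by rewrite geo_nil expr0 invr1 mulr0 subrr.
rewrite geoS mulrDr IH expr0 mul1r exprSr; field.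
by rewrite x0 expf_neq0.
Qed.

Lemma geo1E x n : x != 0 -> (x - 1) * geo 1 x n = x * geo 0 x n - n%:R * x ^- n.
Proof.
move=> x0; elim: n => [|n IH]; first by rewrite !geo_nil mulr0 mul0r mulr0 subrr.
rewrite !geoS mulrDr IH expr0 mul1r expr1 (exprSr x) -natr1; field.
by rewrite x0 expf_neq0.
Qed.

Lemma geo2E x n : x != 0 ->
  (x - 1) * geo 2 x n = x * (2 * geo 1 x n - geo 0 x n) - n%:R ^+ 2 * x ^- n.
Proof.
move=> x0; elim: n => [|n IH]; first by rewrite !geo_nil expr0n/= !(mulr0, mul0r, subrr).
rewrite !geoS mulrDr IH expr0 mul1r expr1 (exprSr x) -natr1; field.
by rewrite x0 expf_neq0.
Qed.

(** Reversal j = n + 1 - k: a sum of growing powers is governed by its last terms, and n - k becomes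
    j - 1. *)
Lemma geo_rev a x n : x != 0 ->
  \sum_(1 <= k < n.+1) (n - k)%:R ^+ a * x ^+ k =
  x ^+ n.+1 * \sum_(1 <= j < n.+1) (j - 1)%:R ^+ a * x ^- j.
Proof.
move=> x0; rewrite mulr_sumr big_nat_rev/= big_nat [RHS]big_nat.
apply: eq_bigr => j /andP[j1 jn].
have -> : (1 + n.+1 - j.+1 = n.+1 - j)%N by lia.
have -> : (n - (n.+1 - j) = j - 1)%N by lia.
rewrite mulrCA; congr (_ * _).
by rewrite -{2}(subnK (ltnW jn)) exprD mulfK// expf_neq0.
Qed.

Lemma geo_rev0 x n : x != 0 -> \sum_(1 <= k < n.+1) x ^+ k = x ^+ n.+1 * geo 0 x n.
Proof.
move=> x0; have := geo_rev 0 n x0; under eq_bigr do rewrite expr0 mul1r.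
by move=> ->; congr (_ * _); apply: eq_bigr => j _; rewrite !expr0.
Qed.

Lemma geo_rev1 x n : x != 0 ->
  \sum_(1 <= k < n.+1) (n - k)%:R * x ^+ k = x ^+ n.+1 * (geo 1 x n - geo 0 x n).
Proof.
move=> x0; have := geo_rev 1 n x0; under eq_bigr do rewrite expr1.
move=> ->; congr (_ * _); rewrite -sumrB big_nat [RHS]big_nat; apply: eq_bigr => j /andP[j1 _].
by rewrite natrB// !expr1 expr0; ring.
Qed.

Lemma geo_rev2 x n : x != 0 ->
  \sum_(1 <= k < n.+1) (n - k)%:R ^+ 2 * x ^+ k =
  x ^+ n.+1 * (geo 2 x n - 2 * geo 1 x n + geo 0 x n).
Proof.
move=> x0; rewrite geo_rev//; congr (_ * _); rewrite mulr_sumr -sumrB -big_split/= big_nat [RHS]big_nat.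
by apply: eq_bigr => j /andP[j1 _]; rewrite natrB// expr1 expr0; ring.
Qed.

(** The second-order term matters: the powers must outgrow n / k_n, which a linear bound would only
    match. *)
Lemma quadratic_bernoulli y n : 0 <= y ->
  1 + n%:R * y + n%:R * (n%:R - 1) / 2 * y ^+ 2 <= (1 + y) ^+ n.
Proof.
move=> y0; elim: n => [|n IH]; first by rewrite expr0 !mul0r !addr0.
have y1 : 0 <= 1 + y by rewrite addr_ge0.
rewrite (exprSr (1 + y)) -natr1; apply: le_trans (ler_wpM2r y1 IH).
set m := n%:R in IH *.
have mm : 0 <= m * (m - 1) / 2 * y ^+ 3.
  apply: mulr_ge0; last by rewrite exprn_ge0.
  rewrite divr_ge0// /m; case: (n) => [|j]; first by rewrite mul0r.
  by rewrite mulr_ge0// -natr1 addrK.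
have -> : (1 + m * y + m * (m - 1) / 2 * y ^+ 2) * (1 + y) =
  (1 + (m + 1) * y + (m + 1) * (m + 1 - 1) / 2 * y ^+ 2) + m * (m - 1) / 2 * y ^+ 3 by field.
by rewrite lerDl.
Qed.

End geometric_sums.

Lemma quarter_sqr_le (R : realFieldType) (m : R) : 2 <= m -> m ^+ 2 / 4 <= m * (m - 1) / 2.
Proof. nra. Qed.

Lemma growth_bound (R : realFieldType) (k g m : R) : 0 < k -> 0 < g -> 0 < m ->
  m / k = 4 / g ^+ 2 * (k / m) * (m ^+ 2 / 4 * (g / k) ^+ 2).
Proof. by move=> k0 g0 m0; field; rewrite !gt_eqF. Qed.

Section growth.
Context {R : realType} (kappa : nat -> R) (g : R).
Hypothesis g0 : 0 < g.
Hypothesis kappa_gt0 : \forall n \near \oo, 0 < kappa n.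
Hypothesis kappa_o : kappa n / n%:R @[n --> \oo] --> 0.

Let p n := 1 + g / kappa n.

(** Eventually p^n is at least (g n / k_n)^2 / 4, so the product is at most 4 / g^2 times k_n /
    n. *)
Lemma growth_expV1 : n%:R / kappa n * p n ^- n @[n --> \oo] --> 0.
Proof.
apply: (@squeeze_cvgr _ _ _ _ (fun=> 0) (fun n => 4 / g ^+ 2 * (kappa n / n%:R))).
- near=> n.
  have k0 : 0 < kappa n by near: n.
  have n2 : (2 <= n)%N by near: n; exact: nbhs_infty_ge.
  have y0 : 0 < g / kappa n by rewrite divr_gt0.
  have p0 : 0 < p n ^+ n by rewrite exprn_gt0// ltr_wpDr// ltW.
  have n0 : 0 < n%:R :> R by rewrite ltr0n; lia.
  apply/andP; split; first by rewrite mulr_ge0 ?divr_ge0 ?invr_ge0// ltW.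
  rewrite ler_pdivrMr//.
  have := quadratic_bernoulli n (ltW y0); rewrite -/(p n) => hb.
  have h2 : n%:R ^+ 2 / 4 * (g / kappa n) ^+ 2 <= p n ^+ n.
    apply: le_trans hb; have n2R : 2 <= n%:R :> R by rewrite ler_nat.
    have := sqr_ge0 (g / kappa n); set y2 := _ ^+ 2 => y20.
    have a1 : 0 <= n%:R * (g / kappa n) by rewrite mulr_ge0 ?ltW.
    have a2 : n%:R ^+ 2 / 4 <= n%:R * (n%:R - 1) / 2 :> R by exact: quarter_sqr_le.
    by rewrite (le_trans (ler_wpM2r y20 a2))// lerDr addr_ge0.
  have c0 : 0 <= 4 / g ^+ 2 * (kappa n / n%:R).
    by rewrite mulr_ge0 ?divr_ge0 ?sqr_ge0// ltW.
  by apply: le_trans (ler_wpM2l c0 h2); rewrite -growth_bound.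
- exact: cvg_cst.
- by rewrite -[X in _ --> X](mulr0 (4 / g ^+ 2)); apply: cvgM; [exact: cvg_cst|].
Unshelve. all: by end_near. Qed.

Lemma growth_expV : p n ^- n @[n --> \oo] --> 0.
Proof.
have h : (kappa n / n%:R) * (n%:R / kappa n * p n ^- n) @[n --> \oo] --> 0.
  by rewrite -[X in _ --> X](mulr0 0); apply: cvgM => //; exact: growth_expV1.
apply: cvg_trans h; apply: near_eq_cvg; near=> n.
have k0 : kappa n != 0 by rewrite gt_eqF//; near: n.
have n0 : n%:R != 0 :> R by rewrite pnatr_eq0 -lt0n; near: n; exact: nbhs_infty_ge.
by rewrite !mulrA divfK// divff// mul1r.
Unshelve. all: by end_near. Qed.

End growth.

(** * Limits of geometric sums for bases close to 1 *)

Section geo_limits.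
Context {R : realType} (kappa : nat -> R) (x : nat -> R) (c : R).
Hypothesis c0 : 0 < c.
Hypothesis kappa_gt0 : \forall n \near \oo, 0 < kappa n.
Hypothesis kappaV : (kappa n)^-1 @[n --> \oo] --> 0.
Hypothesis x_cvg : kappa n * (x n - 1) @[n --> \oo] --> c.

Lemma base_cvg1 : x n @[n --> \oo] --> (1 : R).
Proof.
have h : (kappa n)^-1 * (kappa n * (x n - 1)) + 1 @[n --> \oo] --> 0 * c + 1.
  by apply: cvgD; [exact: cvgM|exact: cvg_cst].
rewrite mul0r add0r in h; apply: cvg_trans h; apply: near_eq_cvg; near=> n.
have k0 : kappa n != 0 by rewrite gt_eqF//; near: n.
by rewrite mulKf// subrK.
Unshelve. all: by end_near. Qed.

Let base_near : \forall n \near \oo, [/\ 0 < kappa n, x n != 0 & x n - 1 != 0].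
Proof.
have h1 := cvgr_neq0 _ base_cvg1 (@oner_neq0 R).
have h2 := cvgr_neq0 _ x_cvg (lt0r_neq0 c0).
apply: filterS3 kappa_gt0 (h1 _) (h2 _) => n k0 x0; rewrite mulf_eq0 negb_or => /andP[_ x1].
by split.
Qed.

(** Since x_n is close to exp (c / k_n), this limit and the next two are those of Riemann sums with
    step 1 / k_n for the integrals of t^a exp (- c t), that is a! / c^(a + 1). The decay hypotheses
    remove the boundary terms of the closed forms. *)
Lemma geo0_cvg : x n ^- n @[n --> \oo] --> 0 ->
  geo 0 (x n) n / kappa n @[n --> \oo] --> c^-1.
Proof.
move=> e0.
have h : (1 - x n ^- n) / (kappa n * (x n - 1)) @[n --> \oo] --> (1 - 0) / c.
  by apply: cvgM; [apply: cvgB => //; exact: cvg_cst|apply: cvgV; rewrite ?gt_eqF].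
rewrite subr0 mul1r in h; apply: cvg_trans h; apply: near_eq_cvg.
apply: filterS base_near => n [k0 x0 x1]; rewrite -geo0E//.
by field; rewrite x1 gt_eqF.
Qed.

Lemma geo1_cvg : x n ^- n @[n --> \oo] --> 0 ->
  n%:R / kappa n * x n ^- n @[n --> \oo] --> 0 ->
  geo 1 (x n) n / kappa n ^+ 2 @[n --> \oo] --> c ^- 2.
Proof.
move=> e0 e1.
have h : (x n * (geo 0 (x n) n / kappa n) - n%:R / kappa n * x n ^- n) / (kappa n * (x n - 1))
    @[n --> \oo] --> (1 * c^-1 - 0) / c.
  apply: cvgM; last by apply: cvgV; rewrite ?gt_eqF.
  by apply: cvgB => //; apply: cvgM; [exact: base_cvg1|exact: geo0_cvg].
have -> : c ^- 2 = (1 * c^-1 - 0) / c by field; rewrite gt_eqF.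
apply: cvg_trans h; apply: near_eq_cvg.
apply: filterS base_near => n [k0 x0 x1].
have -> : x n * (geo 0 (x n) n / kappa n) - n%:R / kappa n * x n ^- n =
  (x n * geo 0 (x n) n - n%:R * x n ^- n) / kappa n by ring.
by rewrite -geo1E//; field; rewrite x1 gt_eqF.
Qed.

Lemma geo2_cvg : x n ^- n @[n --> \oo] --> 0 ->
  n%:R / kappa n * x n ^- n @[n --> \oo] --> 0 ->
  (n%:R / kappa n) ^+ 2 * x n ^- n @[n --> \oo] --> 0 ->
  geo 2 (x n) n / kappa n ^+ 3 @[n --> \oo] --> 2 * c ^- 3.
Proof.
move=> e0 e1 e2.
have h : (x n * (2 * (geo 1 (x n) n / kappa n ^+ 2) - (kappa n)^-1 * (geo 0 (x n) n / kappa n))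
     - (n%:R / kappa n) ^+ 2 * x n ^- n) / (kappa n * (x n - 1))
    @[n --> \oo] --> (1 * (2 * c ^- 2 - 0 * c^-1) - 0) / c.
  apply: cvgM; last by apply: cvgV; rewrite ?gt_eqF.
  apply: cvgB => //; apply: cvgM; first exact: base_cvg1.
  apply: cvgB; last by apply: cvgM => //; exact: geo0_cvg.
  by apply: cvgM; [exact: cvg_cst|exact: geo1_cvg].
have -> : 2 * c ^- 3 = (1 * (2 * c ^- 2 - 0 * c^-1) - 0) / c by field; rewrite gt_eqF.
apply: cvg_trans h; apply: near_eq_cvg.
apply: filterS base_near => n [k0 x0 x1].
have -> : x n * (2 * (geo 1 (x n) n / kappa n ^+ 2) - (kappa n)^-1 * (geo 0 (x n) n / kappa n))
     - (n%:R / kappa n) ^+ 2 * x n ^- n =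
  (x n * (2 * geo 1 (x n) n - geo 0 (x n) n) - n%:R ^+ 2 * x n ^- n) / kappa n ^+ 2.
  by field; rewrite ?expf_neq0// gt_eqF.
by rewrite -geo2E//; field; rewrite x1 gt_eqF.
Qed.

End geo_limits.

(** * Autoregressions *)

Lemma sum_shift_le (R : realDomainType) (h : nat -> R) (k n : nat) : (forall i, 0 <= h i) ->
  \sum_(1 <= j < n.+1) (if (k < j)%N then h (j - k)%N else 0) <= \sum_(1 <= j < n.+1) h j.
Proof.
move=> h0.
have -> : \sum_(1 <= j < n.+1) (if (k < j)%N then h (j - k)%N else 0) =
    \sum_(1 <= i < (n - k).+1) h i.
  elim: n => [|n IH]; first by rewrite sub0n !big_geq.
  rewrite big_nat_recr//= IH; case: ltnP => kn.
    by rewrite subSn//= [RHS]big_nat_recr.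
  have -> : (n - k = 0)%N by lia.
  have -> : (n.+1 - k = 0)%N by lia.
  by rewrite addr0.
rewrite [leRHS](big_cat_nat _ (n := (n - k).+1))//=; last by rewrite ltnS leq_subr.
by rewrite lerDl sumr_ge0.
Qed.

(** After the shift from j to j - k the rescaled tail is an initial piece of the full sum, so the
    bound does not depend on k. *)
Lemma tail_geo (R : realType) (a k n : nat) (p : R) : 0 < p ->
  \sum_(1 <= j < n.+1) (if (k < j)%N then p ^+ k * ((j - k)%:R ^+ a * p ^- j) else 0) ^+ 2 <=
  geo (2 * a) (p ^+ 2) n.
Proof.
move=> p0; apply: le_trans (sum_shift_le k n (h := fun i => i%:R ^+ (2 * a) * (p ^+ 2) ^- i) _).
  rewrite le_eqVlt; apply/orP; left; apply/eqP; apply: eq_bigr => j _.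
  case: ltnP => kj; last by rewrite expr0n.
  rewrite mulrCA exprMn; congr (_ * _); first by rewrite -exprM mulnC.
  have -> : p ^+ k / p ^+ j = p ^- (j - k).
    by rewrite -[in LHS](subnKC (ltnW kj)) exprD invfM mulVKf// expf_neq0 ?gt_eqF.
  by rewrite exprVn -!exprM mulnC.
by move=> i; rewrite mulr_ge0 ?exprn_ge0// invr_ge0 !exprn_ge0// ltW.
Qed.

Section arrays.
Context d (T : measurableType d) (R : realType) (P : probability T R)
  (V : nat -> {RV P >-> R}).
Hypothesis indepV : mutually_independent [set i | (1 <= i)%N] V.
Hypothesis idV : identically_distributed [set i | (1 <= i)%N] V.
Variable s2 : R.
Hypothesis iV : forall i, (1 <= i)%N -> P.-integrable setT (EFin \o V i).
Hypothesis iV2 : forall i, (1 <= i)%N -> P.-integrable setT (EFin \o (fun w => V i w ^+ 2)).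
Hypothesis EV : forall i, (1 <= i)%N -> \int[P]_w V i w = 0.
Hypothesis EV2 : forall i, (1 <= i)%N -> \int[P]_w (V i w ^+ 2) = s2.

Lemma second_moment_ge0 : 0 <= s2.
Proof. by rewrite -(EV2 (leqnn 1)) Rintegral_ge0// => w _; exact: sqr_ge0. Qed.

Lemma weighted_sum_L2 a m :
  L2_bound P (weighted_sum V a m) (s2 * \sum_(1 <= j < m.+1) a j ^+ 2).
Proof.
split; first exact: measurable_weighted_sum.
by rewrite (weighted_sum_sqr indepV iV iV2 EV EV2).
Qed.

Lemma weighted_sumZ r a m w :
  weighted_sum V (fun j => r * a j) m w = r * weighted_sum V a m w.
Proof. by rewrite /weighted_sum mulr_sumr; apply: eq_bigr => j _; rewrite mulrA. Qed.

Lemma weighted_sumD a b m w :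
  weighted_sum V (fun j => a j + b j) m w = weighted_sum V a m w + weighted_sum V b m w.
Proof. by rewrite /weighted_sum -big_split/=; apply: eq_bigr => j _; rewrite mulrDl. Qed.

Lemma weighted_sum_tail a k m w : (k <= m)%N ->
  weighted_sum V a k w = weighted_sum V a m w -
    weighted_sum V (fun j => if (k < j)%N then a j else 0) m w.
Proof.
move=> km; rewrite /weighted_sum [X in _ = X - _](big_cat_nat _ (n := k.+1))//=.
rewrite [X in _ = _ - X](big_cat_nat _ (n := k.+1))//=.
have -> : \sum_(1 <= j < k.+1) (if (k < j)%N then a j else 0) * V j w = 0.
  rewrite big_nat_cond big1// => j /andP[/andP[_ jk] _].
  by rewrite ltnNge -ltnS jk/= mul0r.
rewrite add0r; have -> : \sum_(k.+1 <= j < m.+1) (if (k < j)%N then a j else 0) * V j w =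
    \sum_(k.+1 <= j < m.+1) a j * V j w.
  by apply: eq_big_nat => j /andP[-> _].
by rewrite addrK.
Qed.

(* p^k disc p k is the autoregression with root p driven by V, and
   p^k (k disc p k - disc1 p k) is p times the lagged autoregression driven by it. *)
Definition disc (p : R) (m : nat) := weighted_sum V (fun j => p ^- j) m.

Definition disc1 (p : R) (m : nat) := weighted_sum V (fun j => j%:R * p ^- j) m.

Lemma disc_L2 p m : L2_bound P (disc p m) (s2 * geo 0 (p ^+ 2) m).
Proof.
have := weighted_sum_L2 (fun j => p ^- j) m; congr (L2_bound _ _ (_ * _)).
by apply: eq_bigr => j _; rewrite expr0 mul1r -exprVn -!exprM mulnC exprVn.
Qed.

Lemma disc1_L2 p m : L2_bound P (disc1 p m) (s2 * geo 2 (p ^+ 2) m).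
Proof.
have := weighted_sum_L2 (fun j => j%:R * p ^- j) m; congr (L2_bound _ _ (_ * _)).
by apply: eq_bigr => j _; rewrite exprMn -exprVn -!exprM mulnC exprVn.
Qed.

(** The part of an autoregression carried by V_j with k < j <= n; a = 0 serves simple roots, a = 1 a
    double root. The indicator keeps it a weighted sum over all indices, so the second moment
    formula applies. *)
Definition disc_rem (p : R) (a n k : nat) :=
  weighted_sum V (fun j => if (k < j)%N then p ^+ k * ((j - k)%:R ^+ a * p ^- j) else 0) n.

Lemma disc_rem_L2 p a n k : 0 < p ->
  L2_bound P (disc_rem p a n k) (s2 * geo (2 * a) (p ^+ 2) n).
Proof.
move=> p0; apply: L2_bound_le (weighted_sum_L2 _ _).
by rewrite ler_wpM2l ?second_moment_ge0// tail_geo.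
Qed.

Lemma disc_split p n k w : (k <= n)%N ->
  p ^+ k * disc p k w = p ^+ k * disc p n w - disc_rem p 0 n k w.
Proof.
move=> kn; rewrite /disc (weighted_sum_tail _ _ kn) mulrBr; congr (_ - _).
rewrite -weighted_sumZ; apply: eq_bigr => j _; congr (_ * _).
by case: ifP => _; rewrite ?mulr0// expr0 mul1r.
Qed.

(** The two tails combine to coefficients j - k, so no term growing with k is left in the
    remainder. *)
Lemma disc1_split p n k w : (k <= n)%N ->
  p ^+ k * (k%:R * disc p k w - disc1 p k w) =
  p ^+ k * (k%:R * disc p n w - disc1 p n w) + disc_rem p 1 n k w.
Proof.
move=> kn; rewrite /disc /disc1 !(weighted_sum_tail _ _ kn).
have -> : disc_rem p 1 n k w = p ^+ k *
    (weighted_sum V (fun j => if (k < j)%N then j%:R * p ^- j else 0) n w -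
     k%:R * weighted_sum V (fun j => if (k < j)%N then p ^- j else 0) n w).
  rewrite -!weighted_sumZ -mulN1r -weighted_sumZ -weighted_sumD -weighted_sumZ.
  apply: eq_bigr => j _; congr (_ * _).
  case: ltnP => [kj|_]; last by rewrite !mulr0 addr0 mulr0.
  by rewrite expr1 (natrB _ (ltnW kj)) mulN1r mulrBl.
by ring.
Qed.

End arrays.

(** * Powers of the roots 1 + g / k_n *)

Section bases.
Context {R : realType} (kappa : nat -> R).
Hypothesis kappa_gt0 : \forall n \near \oo, 0 < kappa n.
Hypothesis kappaV : (kappa n)^-1 @[n --> \oo] --> 0.
Hypothesis kappa_o : kappa n / n%:R @[n --> \oo] --> 0.

Definition base (g : R) (n : nat) : R := 1 + g / kappa n.

Lemma base_gt0 g : 0 < g -> \forall n \near \oo, 0 < base g n.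
Proof.
move=> g0; apply: filterS kappa_gt0 => n k0.
by rewrite addr_gt0// divr_gt0.
Qed.

Lemma base_prod_cvg g h :
  kappa n * (base g n * base h n - 1) @[n --> \oo] --> g + h.
Proof.
have H : g + h + g * h * (kappa n)^-1 @[n --> \oo] --> g + h + g * h * 0.
  by apply: cvgD; [exact: cvg_cst|apply: cvgM => //; exact: cvg_cst].
rewrite mulr0 addr0 in H; apply: cvg_trans H; apply: near_eq_cvg.
by apply: filterS kappa_gt0 => n k0; rewrite /base; field; rewrite gt_eqF.
Qed.

Lemma base_cvg g : kappa n * (base g n - 1) @[n --> \oo] --> g.
Proof.
apply: cvg_near_cst; apply: filterS kappa_gt0 => n k0.
by rewrite /base; field; rewrite gt_eqF.
Qed.

Lemma base_expV g : 0 < g -> base g n ^- n @[n --> \oo] --> 0.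
Proof. by move=> g0; exact: growth_expV. Qed.

Lemma base_expV1 g : 0 < g -> n%:R / kappa n * base g n ^- n @[n --> \oo] --> 0.
Proof. by move=> g0; exact: growth_expV1. Qed.

Lemma base_geo0_cvg g : 0 < g ->
  geo 0 (base g n) n / kappa n @[n --> \oo] --> g^-1.
Proof.
move=> g0; apply: geo0_cvg => //; [exact: base_cvg|exact: base_expV].
Qed.

Lemma base_prod_geo0_cvg g h : 0 < g -> 0 < h ->
  geo 0 (base g n * base h n) n / kappa n @[n --> \oo] --> (g + h)^-1.
Proof.
move=> g0 h0; apply: geo0_cvg => //; [by rewrite addr_gt0|exact: base_prod_cvg|].
rewrite -[X in _ --> X](mulr0 0).
rewrite (eq_cvg _ _ (g := fun n => base g n ^- n * base h n ^- n)).
  by apply: cvgM; exact: base_expV.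
by move=> n; rewrite exprMn invfM.
Qed.

(* (1 + g / k) / (1 + h / k) = 1 + (g - h) / (k + h). *)
Lemma base_ratio_cvg0 g h : 0 < h -> h < g ->
  (base h n / base g n) ^+ n @[n --> \oo] --> 0.
Proof.
move=> h0 hg; have g0 := lt_trans h0 hg.
have k'0 : \forall n \near \oo, 0 < kappa n + h.
  by apply: filterS kappa_gt0 => n k0; rewrite addr_gt0.
have k'o : (kappa n + h) / n%:R @[n --> \oo] --> 0.
  have nV : (n%:R^-1 : R) @[n --> \oo] --> (0 : R).
    have n0 : \forall n \near \oo, 0 < n%:R :> R.
      by exists 1%N => // n /= n0; rewrite ltr0n.
    exact: (gtr0_cvgV0 n0).2 cvgr_idn.
  have H : kappa n / n%:R + h * n%:R^-1 @[n --> \oo] --> 0 + h * 0.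
    by apply: cvgD => //; apply: cvgM => //; exact: cvg_cst.
  rewrite mulr0 addr0 in H; apply: cvg_trans H; apply: near_eq_cvg.
  by apply: nearW => n; rewrite mulrDl.
have gh0 : 0 < g - h by rewrite subr_gt0.
have := growth_expV gh0 k'0 k'o; apply: cvg_trans; apply: near_eq_cvg.
apply: filterS kappa_gt0 => n k0; rewrite -exprVn; congr (_ ^+ n).
by rewrite /base; field; rewrite !gt_eqF ?addr_gt0.
Qed.

End bases.

(** * Distinct roots *)

Definition L2_bounded d (T : measurableType d) (R : realType) (P : probability T R)
    (X : nat -> T -> R) : Prop :=
  exists c, \forall n \near \oo, L2_bound P (X n) c.

Lemma cvg_le_near (R : realType) (r : nat -> R) (l : R) : r n @[n --> \oo] --> l ->
  \forall n \near \oo, r n <= l + 1.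
Proof.
move=> /cvgrPdist_le/(_ _ ltr01); apply: filterS => n.
by rewrite distrC => /ler_normlW; rewrite lerBlDl.
Qed.

(** Here P and Q are the n-th powers of the roots p and q. The right side consists of factors with
    known limits, and every summand of the last one keeps an inverse P^-1 or Q^-1, which makes the
    error vanish. *)
Lemma cross_error_scaling (R : realType) (g h k s a b p q P Q m G H : R) :
  0 < g -> 0 < h -> 0 < k -> 0 < P -> 0 < Q ->
  `|(g + h) / (k ^+ 2 * P * Q)| * (s * (a + b) * (p * P * G + q * Q * H + m)) =
  (g + h) * (s * (a / k + b / k)) *
    (p * (G / k) * Q^-1 + q * (H / k) * P^-1 + m / k * P^-1 * Q^-1).
Proof.
move=> g0 h0 k0 P0 Q0.
rewrite ger0_norm; first by field; rewrite !gt_eqF.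
by rewrite divr_ge0 ?addr_ge0 ?mulr_ge0 ?exprn_ge0// ltW.
Qed.

Lemma cross_main_scaling (R : realType) (c k x P Q G D : R) : 0 < k -> 0 < P -> 0 < Q ->
  c * (x * (G / k)) * (k^-1 * D) = c / (k ^+ 2 * P * Q) * (x * (P * Q) * G * D).
Proof. by move=> k0 P0 Q0; field; rewrite !gt_eqF. Qed.

(** Numerator and denominator of the estimation error are linear in the cross sums of the two
    autoregressions. In normalised units, each further occurrence of the smaller root costs a factor
    Q / P. *)
Lemma ar_ratio_algebra (R : realType) (g1 g2 k P Q s11 s12 s22 : R) :
  0 < g1 -> 0 < g2 -> 0 < k -> 0 < P -> 0 < Q ->
  [/\ (g1 + g1) / (k ^+ 2 * P * P) * s11 -
        4 * g1 / (g1 + g2) * (Q / P) * ((g1 + g2) / (k ^+ 2 * P * Q) * s12) +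
        g1 / g2 * (Q / P) ^+ 2 * ((g2 + g2) / (k ^+ 2 * Q * Q) * s22) =
      2 * g1 / (k ^+ 2 * P * P) * (s11 - 2 * s12 + s22),
      (g1 + g2) / (k ^+ 2 * P * Q) * s12 -
        (g1 + g2) / (2 * g2) * (Q / P) * ((g2 + g2) / (k ^+ 2 * Q * Q) * s22) =
      (g1 + g2) / (k ^+ 2 * P * Q) * (s12 - s22) &
      forall N S, S != 0 -> (g1 + g2) / (2 * g1) * (P / Q) * (N / S) =
        ((g1 + g2) / (k ^+ 2 * P * Q) * N) / (2 * g1 / (k ^+ 2 * P * P) * S)].
Proof.
move=> g10 g20 k0 P0 Q0; split=> [||N S S0]; field;
  by rewrite ?S0 ?gt_eqF ?addr_gt0.
Qed.

Lemma sqrtV_cvg0 (R : realType) (k : nat -> R) : (k n)^-1 @[n --> \oo] --> 0 ->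
  (Num.sqrt (k n))^-1 @[n --> \oo] --> 0.
Proof.
move=> kV; rewrite -(sqrtr0 R).
rewrite (eq_cvg _ _ (g := fun n => Num.sqrt (k n)^-1)); last first.
  (* For negative k n both sides are 0, because the square root is 0 there and so is the inverse of
     0. *)
  move=> n; have [k0|/ltW k0] := leP 0 (k n); first by rewrite sqrtrV.
  by rewrite !ler0_sqrtr ?invr0 ?invr_le0.
by apply: continuous_cvg => //; exact: sqrt_continuous.
Qed.

Section cross.
Context d (T : measurableType d) (R : realType) (P : probability T R)
  (V : nat -> {RV P >-> R}).
Hypothesis indepV : mutually_independent [set i | (1 <= i)%N] V.
Hypothesis idV : identically_distributed [set i | (1 <= i)%N] V.
Variable s2 : R.
Hypothesis iV : forall i, (1 <= i)%N -> P.-integrable setT (EFin \o V i).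
Hypothesis iV2 : forall i, (1 <= i)%N -> P.-integrable setT (EFin \o (fun w => V i w ^+ 2)).
Hypothesis EV : forall i, (1 <= i)%N -> \int[P]_w V i w = 0.
Hypothesis EV2 : forall i, (1 <= i)%N -> \int[P]_w (V i w ^+ 2) = s2.
Variable kappa : nat -> R.
Hypothesis kappa_gt0 : \forall n \near \oo, 0 < kappa n.
Hypothesis kappaV : (kappa n)^-1 @[n --> \oo] --> 0.
Hypothesis kappa_o : kappa n / n%:R @[n --> \oo] --> 0.

Let s20 : 0 <= s2. Proof. exact: second_moment_ge0 EV2. Qed.

Let base := base kappa.

Lemma L2_boundedM (X Y : nat -> T -> R) : L2_bounded P X -> L2_bounded P Y ->
  L1_bounded P (fun n w => X n w * Y n w).
Proof.
move=> [c hc] [e he]; exists (Num.max c e).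
apply: filterS2 hc he => n hX hY.
by apply: L2_boundM; [apply: L2_bound_le hX|apply: L2_bound_le hY]; rewrite le_max lexx ?orbT.
Qed.

Lemma L2_boundN (X : T -> R) c : L2_bound P X c -> L2_bound P (fun w => - X w) c.
Proof.
move=> /(L2_boundZ (-1)); rewrite sqrrN expr1n mul1r; congr L2_bound.
by apply/funext => w; rewrite mulN1r.
Qed.

Definition scaled_disc (g : R) (n : nat) (w : T) : R :=
  (Num.sqrt (kappa n))^-1 * disc V (base g n) n w.

Lemma scaled_disc_bounded g : 0 < g -> L2_bounded P (scaled_disc g).
Proof.
move=> g0; have := base_prod_geo0_cvg kappa_gt0 kappaV kappa_o g0 g0.
move=> /cvg_le_near; set l := _ + 1 => hl; exists (s2 * l).
apply: filterS2 kappa_gt0 hl => n k0 hn.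
apply: L2_bound_le (L2_boundZ _ (disc_L2 indepV iV iV2 EV EV2 _ _)).
rewrite exprVn (sqr_sqrtr (ltW k0)) mulrCA ler_wpM2l// mulrC.
by move: hn; rewrite -expr2.
Qed.

(** Normalised by the leading order of the sum, k_n (p q)^n / (g + h) from the geometric sum times
    k_n from the product of two discounted sums. *)
Definition ar_cross (g h : R) (n : nat) (w : T) : R :=
  (g + h) / (kappa n ^+ 2 * base g n ^+ n * base h n ^+ n) *
  \sum_(1 <= k < n.+1)
    (base g n ^+ k * disc V (base g n) k w) * (base h n ^+ k * disc V (base h n) k w).

Lemma ar_cross_small g h : 0 < g -> 0 < h ->
  L1_small P (fun n w => ar_cross g h n w - scaled_disc g n w * scaled_disc h n w).
Proof.
move=> g0 h0.
pose r n := (g + h) / (kappa n ^+ 2 * base g n ^+ n * base h n ^+ n).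
(* E is the error of keeping the exploding parts only; t is the normalised geometric sum in front of
   their product and tends to 1. *)
pose E n w := \sum_(1 <= k < n.+1)
    (base g n ^+ k * disc V (base g n) n w + - disc_rem V (base g n) 0 n k w) *
    (base h n ^+ k * disc V (base h n) n w + - disc_rem V (base h n) 0 n k w) -
  \sum_(1 <= k < n.+1) (base g n * base h n) ^+ k *
    (disc V (base g n) n w * disc V (base h n) n w).
pose t n := (g + h) * (base g n * base h n * (geo 0 (base g n * base h n) n / kappa n)).
have S1 : L1_small P (fun n w => r n * E n w).
  exists (fun n => `|r n| * (s2 * (geo 0 (base g n ^+ 2) n + geo 0 (base h n ^+ 2) n) *
    (base g n * base g n ^+ n * geo 0 (base g n) n +
     base h n * base h n ^+ n * geo 0 (base h n) n + n%:R))).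
    pose c n := (g + h) * (s2 * (geo 0 (base g n ^+ 2) n / kappa n + geo 0 (base h n ^+ 2) n / kappa n)) *
      (base g n * (geo 0 (base g n) n / kappa n) * base h n ^- n +
       base h n * (geo 0 (base h n) n / kappa n) * base g n ^- n +
       n%:R / kappa n * base g n ^- n * base h n ^- n).
    have c_cvg : c n @[n --> \oo] --> (g + h) * (s2 * ((g + g)^-1 + (h + h)^-1)) *
        (1 * g^-1 * 0 + 1 * h^-1 * 0 + 0 * 0).
      apply: cvgM.
        apply: cvgM; first exact: cvg_cst.
        apply: cvgM; first exact: cvg_cst.
        by apply: cvgD; exact: base_prod_geo0_cvg.
      have b1 u : 0 < u -> base u n @[n --> \oo] --> (1 : R).
        by move=> u0; apply: base_cvg1 kappa_gt0 kappaV _; exact: base_cvg.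
      apply: cvgD; last by apply: cvgM; [exact: base_expV1|exact: base_expV].
      by apply: cvgD; (apply: cvgM; [apply: cvgM; [exact: b1|exact: base_geo0_cvg]|exact: base_expV]).
    rewrite !(mulr0, addr0) in c_cvg; apply: cvg_trans c_cvg; apply: near_eq_cvg.
    apply: filterS3 kappa_gt0 (base_gt0 kappa_gt0 g0) (base_gt0 kappa_gt0 h0) => n k0 p0 q0.
    by rewrite /r /c cross_error_scaling ?exprn_gt0.
  apply: filterS3 kappa_gt0 (base_gt0 kappa_gt0 g0) (base_gt0 kappa_gt0 h0) => n k0 p0 q0.
  apply: L1_boundZ.
  set D := s2 * _.
  have geo_ge0 u : 0 < base u n -> 0 <= geo 0 (base u n ^+ 2) n.
    move=> u0; apply: sumr_ge0 => j _.
    by rewrite mulr_ge0 ?exprn_ge0// invr_ge0 !exprn_ge0// ltW.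
  have D1 : s2 * geo 0 (base g n ^+ 2) n <= D by rewrite ler_wpM2l// lerDl geo_ge0.
  have D2 : s2 * geo 0 (base h n ^+ 2) n <= D by rewrite ler_wpM2l// lerDr geo_ge0.
  have := @cross_sum_L1_bound _ _ _ P (fun _ => disc V (base g n) n) (fun _ => disc V (base h n) n)
    (fun k w => - disc_rem V (base g n) 0 n k w) (fun k w => - disc_rem V (base h n) 0 n k w)
    (base g n) (base h n) D n (ltW p0) (ltW q0).
  rewrite !geo_rev0 ?gt_eqF// !exprS; apply => k _; split.
  - exact: L2_bound_le D1 (disc_L2 indepV iV iV2 EV EV2 _ _).
  - exact: L2_bound_le D2 (disc_L2 indepV iV iV2 EV EV2 _ _).
  - apply: L2_boundN; apply: L2_bound_le D1 _.
    exact: (disc_rem_L2 indepV iV iV2 EV EV2 0 n k p0).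
  - apply: L2_boundN; apply: L2_bound_le D2 _.
    exact: (disc_rem_L2 indepV iV iV2 EV EV2 0 n k q0).
have S2 : L1_small P (fun n w => (t n - 1) * (scaled_disc g n w * scaled_disc h n w)).
  apply: L1_bounded_smallZ; last by apply: L2_boundedM; exact: scaled_disc_bounded.
  have -> : (0 : R) = (g + h) * (1 * (g + h)^-1) - 1.
    by rewrite mul1r divff ?subrr// gt_eqF// addr_gt0.
  apply: cvgB; last exact: cvg_cst.
  apply: cvgM; first exact: cvg_cst.
  apply: cvgM; last exact: base_prod_geo0_cvg.
  by apply: base_cvg1 kappa_gt0 kappaV _; exact: base_prod_cvg.
apply: L1_small_eq (L1_smallD S1 S2).
apply: filterS3 kappa_gt0 (base_gt0 kappa_gt0 g0) (base_gt0 kappa_gt0 h0) => n k0 p0 q0 w.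
have -> : ar_cross g h n w = r n * (E n w + \sum_(1 <= k < n.+1) (base g n * base h n) ^+ k *
    (disc V (base g n) n w * disc V (base h n) n w)).
  rewrite /ar_cross -/(r n) /E subrK; congr (_ * _).
  rewrite big_nat [RHS]big_nat; apply: eq_bigr => k /andP[_ kn].
  by rewrite !(@disc_split _ _ _ _ _ _ n k).
rewrite [in RHS](mulrDr (r n) (E n w)) (mulrBl _ (t n) 1) mul1r addrA; congr (_ + _ - _).
rewrite -mulr_suml geo_rev0 ?mulf_neq0 ?gt_eqF// (exprS (_ * _)) (exprMn n) /t /r.
rewrite /scaled_disc [X in _ * X](_ : _ = (kappa n)^-1 *
  (disc V (base g n) n w * disc V (base h n) n w)); last first.
  by rewrite mulrACA -invfM -expr2 (sqr_sqrtr (ltW k0)).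
by apply: cross_main_scaling; rewrite ?exprn_gt0.
Qed.

Lemma base_expV_le1 g n j : 0 < g -> 0 < kappa n -> base g n ^- j <= 1.
Proof.
move=> g0 k0; rewrite invf_le1 ?exprn_gt0 ?addr_gt0 ?divr_gt0//.
by rewrite exprn_ege1// lerDl divr_ge0// ltW.
Qed.

(** Powers p^-j are at most 1, so every weight is of order k_n^(-1/2) and the array is negligible;
    the quadratic form is a limit of geometric sums. *)
Lemma scaled_disc_cos g h t1 t2 b : 0 < g -> 0 < h ->
  \int[P]_w cos (t1 * scaled_disc g n w + t2 * scaled_disc h n w + b) @[n --> \oo] -->
  expR (- (s2 * (t1 ^+ 2 / (g + g) + 2 * t1 * t2 / (g + h) + t2 ^+ 2 / (h + h)) / 2)) * cos b.
Proof.
move=> g0 h0.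
pose a n j := (Num.sqrt (kappa n))^-1 * (t1 * base g n ^- j + t2 * base h n ^- j).
have E n : \int[P]_w cos (t1 * scaled_disc g n w + t2 * scaled_disc h n w + b) =
    \int[P]_w cos (weighted_sum V (a n) n w + b).
  congr (Rintegral _ _ _); apply/funext => w; congr (cos (_ + _)).
  rewrite /scaled_disc /disc !mulrA -!weighted_sumZ -weighted_sumD.
  by apply: eq_bigr => j _; congr (_ * _); rewrite /a; ring.
rewrite (eq_cvg _ _ E).
apply: (cos_weighted_sum_cvg indepV idV iV iV2 EV EV2
    (m := fun n => (Num.sqrt (kappa n))^-1 * (`|t1| + `|t2|))).
- apply: filterS kappa_gt0 => n k0 j _.
  have s0 : 0 <= (Num.sqrt (kappa n))^-1 by rewrite invr_ge0 sqrtr_ge0.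
  have e0 u : 0 < u -> 0 <= base u n ^- j.
    by move=> u0; rewrite invr_ge0 exprn_ge0// addr_ge0// divr_ge0// ltW.
  rewrite /a normrM (ger0_norm s0) ler_wpM2l// (le_trans (ler_normD _ _))// !normrM.
  by apply: lerD; rewrite ler_piMr// ger0_norm ?e0// base_expV_le1.
- by move=> n; rewrite mulr_ge0 ?invr_ge0 ?sqrtr_ge0// addr_ge0.
- rewrite -[X in _ --> X](mul0r (`|t1| + `|t2|)).
  by apply: cvgM; [exact: sqrtV_cvg0|exact: cvg_cst].
have H : t1 ^+ 2 * (geo 0 (base g n * base g n) n / kappa n) +
    2 * t1 * t2 * (geo 0 (base g n * base h n) n / kappa n) +
    t2 ^+ 2 * (geo 0 (base h n * base h n) n / kappa n) @[n --> \oo] -->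
    t1 ^+ 2 / (g + g) + 2 * t1 * t2 / (g + h) + t2 ^+ 2 / (h + h).
  by apply: cvgD; [apply: cvgD|]; (apply: cvgM; [exact: cvg_cst|exact: base_prod_geo0_cvg]).
apply: cvg_trans H; apply: near_eq_cvg; apply: filterS kappa_gt0 => n k0.
rewrite !mulrA -!mulrDl /geo !mulr_sumr -!big_split/= mulr_suml; apply: eq_bigr => j _.
rewrite /a (exprMn _ (Num.sqrt _)^-1) exprVn (sqr_sqrtr (ltW k0)) [RHS]mulrC; congr (_ / _).
rewrite !expr0 !mul1r !exprMn !invfM.
by ring.
Qed.

(** Stated for a dominant root g1 and a smaller one g2, to serve both orders of the parameters: U
    comes from g2 and W from g1. *)
Theorem ar_ratio_cvg d' (T' : measurableType d') (Q : probability T' R)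
    (g1 g2 : R) (Y : nat -> T -> R) (xi eta : T' -> R) :
  0 < g2 -> g2 < g1 ->
  (forall n, measurable_fun setT (Y n)) ->
  measurable_fun setT xi -> measurable_fun setT eta ->
  (forall t1 t2 b, \int[Q]_w cos (t1 * xi w + t2 * eta w + b) =
    expR (- (s2 * (t1 ^+ 2 / (g2 + g2) + 2 * t1 * t2 / (g2 + g1) + t2 ^+ 2 / (g1 + g1)) / 2)) * cos b) ->
  Q [set w | eta w = 0] = 0%E ->
  (\forall n \near \oo, forall w,
    \sum_(1 <= k < n.+1) (base g1 n ^+ k * disc V (base g1 n) k w -
       base g2 n ^+ k * disc V (base g2 n) k w) ^+ 2 != 0 ->
    Y n w = (g1 + g2) / (2 * g1) * (base g1 n / base g2 n) ^+ n *
     ((\sum_(1 <= k < n.+1) base g2 n ^+ k * disc V (base g2 n) k w *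
       (base g1 n ^+ k * disc V (base g1 n) k w - base g2 n ^+ k * disc V (base g2 n) k w)) /
      (\sum_(1 <= k < n.+1) (base g1 n ^+ k * disc V (base g1 n) k w -
       base g2 n ^+ k * disc V (base g2 n) k w) ^+ 2))) ->
  cvg_in_distribution P Q Y (fun w => xi w / eta w).
Proof.
move=> g20 g21 mY mxi meta cosQ eta0 hY.
have g10 := lt_trans g20 g21.
pose r n := (base g2 n / base g1 n) ^+ n.
have r0 : r n @[n --> \oo] --> 0 by exact: base_ratio_cvg0.
(* Numerator and denominator in units of [ar_cross]: all but the leading cross sum carry a power of
   r, hence are bounded quantities times a null factor. *)
pose A n w := ar_cross g1 g2 n w - (g1 + g2) / (2 * g2) * r n * ar_cross g2 g2 n w.
pose B n w := ar_cross g1 g1 n w - 4 * g1 / (g1 + g2) * r n * ar_cross g1 g2 n w +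
  g1 / g2 * r n ^+ 2 * ar_cross g2 g2 n w.
have cross_bounded g h : 0 < g -> 0 < h -> L1_bounded P (ar_cross g h).
  move=> g0 h0.
  have [c hc] : L1_bounded P (fun n w => (ar_cross g h n w - scaled_disc g n w * scaled_disc h n w) +
      scaled_disc g n w * scaled_disc h n w).
    apply: L1_boundedD; first by apply: L1_small_bounded; exact: ar_cross_small.
    by apply: L2_boundedM; exact: scaled_disc_bounded.
  exists c; apply: filterS hc => n; congr L1_bound.
  by apply/funext => w; rewrite subrK.
have mS g n : measurable_fun setT (scaled_disc g n).
  by apply: measurable_funM => //; exact: measurable_weighted_sum.
have cr0 c : c * r n @[n --> \oo] --> 0.
  by rewrite -[X in _ --> X](mulr0 c); apply: cvgM => //; exact: cvg_cst.
apply: (@cvg_in_distribution_ratio _ _ _ _ _ P Q (scaled_disc g2) (scaled_disc g1) A B Y xi eta) => //.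
- move=> t1 t2 b; rewrite cosQ; exact: scaled_disc_cos.
- have s1 : L1_small P (fun n w => - ((g1 + g2) / (2 * g2)) * r n * ar_cross g2 g2 n w).
    by apply: L1_bounded_smallZ; [exact: cr0|exact: cross_bounded].
  apply: L1_small_eq (L1_smallD (ar_cross_small g10 g20) s1).
  by apply: nearW => n w; rewrite /A; ring.
- have s1 : L1_small P (fun n w => - (4 * g1 / (g1 + g2)) * r n * ar_cross g1 g2 n w).
    by apply: L1_bounded_smallZ; [exact: cr0|exact: cross_bounded].
  have s2' : L1_small P (fun n w => g1 / g2 * r n ^+ 2 * ar_cross g2 g2 n w).
    apply: L1_bounded_smallZ; last exact: cross_bounded.
    rewrite -[X in _ --> X](mul0r 0); under eq_fun do rewrite expr2 mulrA.
    by apply: cvgM; first exact: cr0.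
  apply: L1_small_eq (L1_smallD (L1_smallD (ar_cross_small g10 g10) s1) s2').
  by apply: nearW => n w; rewrite /B; ring.
- apply: filterS2 kappa_gt0 hY => n k0 hY w.
  pose F k := base g1 n ^+ k * disc V (base g1 n) k w.
  pose G k := base g2 n ^+ k * disc V (base g2 n) k w.
  have p0 : 0 < base g1 n by rewrite addr_gt0// divr_gt0.
  have q0 : 0 < base g2 n by rewrite addr_gt0// divr_gt0.
  pose s11 := \sum_(1 <= k < n.+1) F k * F k.
  pose s12 := \sum_(1 <= k < n.+1) F k * G k.
  pose s22 := \sum_(1 <= k < n.+1) G k * G k.
  have DE : \sum_(1 <= k < n.+1) (F k - G k) ^+ 2 = s11 - 2 * s12 + s22.
    rewrite /s11 /s12 /s22 mulr_sumr -sumrB -big_split/=.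
    by apply: eq_bigr => k _; ring.
  have NE : \sum_(1 <= k < n.+1) G k * (F k - G k) = s12 - s22.
    by rewrite /s12 /s22 -sumrB; apply: eq_bigr => k _; ring.
  have P0 : 0 < base g1 n ^+ n by rewrite exprn_gt0.
  have Q0 : 0 < base g2 n ^+ n by rewrite exprn_gt0.
  have [BE AE RE] := ar_ratio_algebra s11 s12 s22 g10 g20 k0 P0 Q0.
  have rE : r n = base g2 n ^+ n / base g1 n ^+ n by rewrite /r expr_div_n.
  have -> : A n w = (g1 + g2) / (kappa n ^+ 2 * base g1 n ^+ n * base g2 n ^+ n) *
      \sum_(1 <= k < n.+1) G k * (F k - G k).
    by rewrite NE -AE -rE.
  have -> : B n w = 2 * g1 / (kappa n ^+ 2 * base g1 n ^+ n * base g1 n ^+ n) *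
      \sum_(1 <= k < n.+1) (F k - G k) ^+ 2.
    by rewrite DE -BE -rE.
  rewrite mulf_eq0 negb_or => /andP[c0 S0]; rewrite hY// expr_div_n.
  exact: RE.
Qed.

End cross.

(** * Equal roots *)

(** With m = n and P = p^n, every term keeps a factor m / k P^-1, which tends to 0 by the quadratic
    growth bound. *)
Lemma equal_numerator_error (R : realType) (g p s k m G0 G2 G P : R) :
  0 < g -> 0 < p -> 0 < k -> 0 < m -> 0 < P ->
  `|2 * g * p / (m * k ^+ 3 * (P * P))| *
    (2 * (s * (m ^+ 2 * G0 + G2)) * (p * P * G + p * P * G + m)) =
  2 * g * p * (2 * (s * (G0 / k + (k / m) ^+ 2 * (G2 / k ^+ 3)))) *
    (2 * p * (G / k) * (m / k * P^-1) + (m / k * P^-1) ^+ 2).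
Proof.
move=> g0 p0 k0 m0 P0.
rewrite ger0_norm; first by field; rewrite !gt_eqF.
by rewrite divr_ge0 ?mulr_ge0 ?exprn_ge0// ltW.
Qed.

Lemma equal_denominator_error (R : realType) (g p s k m G0 G2 G P : R) :
  0 < g -> 0 < k -> 0 < m -> 0 < P ->
  `|2 * g / (m ^+ 2 * k ^+ 2 * (P * P))| *
    (2 * (s * (m ^+ 2 * G0 + G2)) * (p * P * G + p * P * G + m)) =
  2 * g * (2 * (s * (G0 / k + (k / m) ^+ 2 * (G2 / k ^+ 3)))) *
    (2 * p * (G / k) * P^-1 + (m / k * P^-1) * P^-1).
Proof.
move=> g0 k0 m0 P0.
rewrite ger0_norm; first by field; rewrite !gt_eqF.
by rewrite divr_ge0 ?mulr_ge0 ?exprn_ge0// ltW.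
Qed.

(** s is the square root of k_n, so that the scalings k_n^(1/2) and k_n^(3/2) become polynomial.
    Every term with the factor s^2 / m, which is k_n / n, disappears in the limit. *)
Lemma equal_numerator_main (R : realType) (g p s m P W H t0 t1 t2 : R) :
  0 < s -> 0 < m -> 0 < P ->
  2 * g * p / (m * (s ^+ 2) ^+ 3 * (P * P)) *
    (m * (P * P * (s ^+ 2) ^+ 2 * t1 * (s * W) ^+ 2 + P * P * s ^+ 2 * t0 * ((s * W) * (s ^+ 3 * H))) -
     (P * P * (s ^+ 2) ^+ 3 * t2 * (s * W) ^+ 2 +
      2 * (P * P * (s ^+ 2) ^+ 2 * t1) * ((s * W) * (s ^+ 3 * H)) +
      P * P * s ^+ 2 * t0 * (s ^+ 3 * H) ^+ 2)) =
  (2 * g * p * t1 - 2 * g * p * (s ^+ 2 / m) * t2) * (W * W) +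
  (2 * g * p * t0 - 2 * g * p * (s ^+ 2 / m) * (2 * t1)) * (W * H) +
  - (2 * g * p * (s ^+ 2 / m) * t0) * (H * H).
Proof. by move=> s0 m0 P0; field; rewrite !gt_eqF. Qed.

Lemma equal_denominator_main (R : realType) (g s m P W H t0 t1 t2 : R) :
  0 < s -> 0 < m -> 0 < P ->
  2 * g / (m ^+ 2 * (s ^+ 2) ^+ 2 * (P * P)) *
    (m ^+ 2 * (P * P * s ^+ 2 * t0) * (s * W) ^+ 2 -
     2 * m * (P * P * (s ^+ 2) ^+ 2 * t1 * (s * W) ^+ 2 + P * P * s ^+ 2 * t0 * ((s * W) * (s ^+ 3 * H))) +
     (P * P * (s ^+ 2) ^+ 3 * t2 * (s * W) ^+ 2 +
      2 * (P * P * (s ^+ 2) ^+ 2 * t1) * ((s * W) * (s ^+ 3 * H)) +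
      P * P * s ^+ 2 * t0 * (s ^+ 3 * H) ^+ 2)) =
  (2 * g * t0 - 4 * g * (s ^+ 2 / m) * t1 + 2 * g * (s ^+ 2 / m) ^+ 2 * t2) * (W * W) +
  (4 * g * (s ^+ 2 / m) ^+ 2 * t1 - 4 * g * (s ^+ 2 / m) * t0) * (W * H) +
  2 * g * (s ^+ 2 / m) ^+ 2 * t0 * (H * H).
Proof. by move=> s0 m0 P0; field; rewrite !gt_eqF. Qed.

Lemma geo_rev_scaling (R : realType) (k x X G0 G1 G2 : R) : 0 < k ->
  [/\ x * X * G0 = X * k * (x * (G0 / k)),
      x * X * (G1 - G0) = X * k ^+ 2 * (x * (G1 / k ^+ 2 - k^-1 * (G0 / k))) &
      x * X * (G2 - 2 * G1 + G0) = X * k ^+ 3 *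
        (x * (G2 / k ^+ 3 - 2 * k^-1 * (G1 / k ^+ 2) + k^-1 * k^-1 * (G0 / k)))].
Proof. by move=> k0; split; field; rewrite gt_eqF. Qed.

(** Writing k as n - (n - k) separates powers of n from the T a, whose weights n - k are only of
    order k_n where x^k matters. *)
Lemma equal_sums (R : realType) (n : nat) (x S J : R) :
  let T a := \sum_(1 <= k < n.+1) (n - k)%:R ^+ a * x ^+ k in
  \sum_(1 <= k < n.+1) x ^+ k * (((n - k)%:R * S + J) * (k%:R * S - J)) =
    n%:R * (T 1%N * S ^+ 2 + T 0%N * (S * J)) -
    (T 2%N * S ^+ 2 + 2 * T 1%N * (S * J) + T 0%N * J ^+ 2) /\
  \sum_(1 <= k < n.+1) x ^+ k * ((k%:R * S - J) * (k%:R * S - J)) =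
    n%:R ^+ 2 * T 0%N * S ^+ 2 - 2 * n%:R * (T 1%N * S ^+ 2 + T 0%N * (S * J)) +
    (T 2%N * S ^+ 2 + 2 * T 1%N * (S * J) + T 0%N * J ^+ 2).
Proof.
move=> T; rewrite /T; split.
  rewrite !(mulr_suml, mulr_sumr) -!big_split/= !(mulr_suml, mulr_sumr) -sumrB.
  by rewrite big_nat [RHS]big_nat; apply: eq_bigr => k /andP[_ kn]; rewrite natrB//; ring.
rewrite !(mulr_suml, mulr_sumr) -!big_split/= !(mulr_suml, mulr_sumr) -sumrB -!big_split/=.
by rewrite big_nat [RHS]big_nat; apply: eq_bigr => k /andP[_ kn]; rewrite natrB//; ring.
Qed.

Lemma equal_ratio_algebra (R : realType) (g k m P p N D : R) :
  0 < g -> 0 < k -> 0 < m -> 0 < P -> D != 0 ->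
  m / k * (p * (N / D)) =
  (2 * g * p / (m * k ^+ 3 * (P * P)) * N) / (2 * g / (m ^+ 2 * k ^+ 2 * (P * P)) * D).
Proof. by move=> g0 k0 m0 P0 D0; field; rewrite D0 !gt_eqF. Qed.

Section equal.
Context d (T : measurableType d) (R : realType) (P : probability T R)
  (V : nat -> {RV P >-> R}).
Hypothesis indepV : mutually_independent [set i | (1 <= i)%N] V.
Hypothesis idV : identically_distributed [set i | (1 <= i)%N] V.
Variable s2 : R.
Hypothesis iV : forall i, (1 <= i)%N -> P.-integrable setT (EFin \o V i).
Hypothesis iV2 : forall i, (1 <= i)%N -> P.-integrable setT (EFin \o (fun w => V i w ^+ 2)).
Hypothesis EV : forall i, (1 <= i)%N -> \int[P]_w V i w = 0.
Hypothesis EV2 : forall i, (1 <= i)%N -> \int[P]_w (V i w ^+ 2) = s2.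
Variable kappa : nat -> R.
Hypothesis kappa_gt0 : \forall n \near \oo, 0 < kappa n.
Hypothesis kappaV : (kappa n)^-1 @[n --> \oo] --> 0.
Hypothesis kappa_o : kappa n / n%:R @[n --> \oo] --> 0.
Variable g : R.
Hypothesis g0 : 0 < g.

Let s20 : 0 <= s2. Proof. exact: second_moment_ge0 EV2. Qed.

Let p := base kappa g.

Let x n := p n * p n.

Let gg0 : 0 < g + g. Proof. by rewrite addr_gt0. Qed.

Let p_gt0 : \forall n \near \oo, 0 < p n.
Proof. exact: base_gt0. Qed.

Let pV : p n ^- n @[n --> \oo] --> 0.
Proof. exact: base_expV. Qed.

Let pV1 : n%:R / kappa n * p n ^- n @[n --> \oo] --> 0.
Proof. exact: base_expV1. Qed.

Let geo0x : geo 0 (x n) n / kappa n @[n --> \oo] --> (g + g)^-1.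
Proof. exact: base_prod_geo0_cvg. Qed.

Let xV : x n ^- n @[n --> \oo] --> 0.
Proof.
rewrite -[X in _ --> X](mulr0 0) (eq_cvg _ _ (g := fun n => p n ^- n * p n ^- n)).
  exact: cvgM.
by move=> n; rewrite exprMn invfM.
Qed.

Let xV1 : n%:R / kappa n * x n ^- n @[n --> \oo] --> 0.
Proof.
rewrite -[X in _ --> X](mulr0 0) (eq_cvg _ _ (g := fun n => n%:R / kappa n * p n ^- n * p n ^- n)).
  exact: cvgM.
by move=> n; rewrite exprMn invfM mulrA.
Qed.

Let xV2 : (n%:R / kappa n) ^+ 2 * x n ^- n @[n --> \oo] --> 0.
Proof.
rewrite -[X in _ --> X](mulr0 0).
rewrite (eq_cvg _ _ (g := fun n => (n%:R / kappa n * p n ^- n) * (n%:R / kappa n * p n ^- n))).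
  exact: cvgM.
by move=> n; rewrite expr2 (exprMn n) invfM mulrACA.
Qed.

Let geo1x : geo 1 (x n) n / kappa n ^+ 2 @[n --> \oo] --> (g + g) ^- 2.
Proof. by apply: geo1_cvg => //; exact: base_prod_cvg. Qed.

Let geo2x : geo 2 (x n) n / kappa n ^+ 3 @[n --> \oo] --> 2 * (g + g) ^- 3.
Proof. by apply: geo2_cvg => //; exact: base_prod_cvg. Qed.

Let geo_ge0 a n : 0 < p n -> 0 <= geo a (x n) n.
Proof.
move=> u0; apply: sumr_ge0 => j _.
by rewrite mulr_ge0 ?exprn_ge0// invr_ge0 exprn_ge0// mulr_ge0// ltW.
Qed.

Let W := scaled_disc V kappa g.

(** The squares of the weights j p^-j sum to order k_n^3, whence the normalisation k_n^(3/2). *)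
Definition scaled_disc1 (n : nat) (w : T) : R :=
  (kappa n * Num.sqrt (kappa n))^-1 * disc1 V (p n) n w.

Let H := scaled_disc1.

Let W_bounded : L2_bounded P W.
Proof. exact: (scaled_disc_bounded indepV iV iV2 EV EV2). Qed.

Let H_bounded : L2_bounded P H.
Proof.
have /cvg_le_near := geo2x; set l := _ + 1 => hl; exists (s2 * l).
apply: filterS2 kappa_gt0 hl => n k0 hn.
apply: L2_bound_le (L2_boundZ _ (disc1_L2 indepV iV iV2 EV EV2 _ _)).
rewrite exprVn exprMn (sqr_sqrtr (ltW k0)) -exprSr mulrCA ler_wpM2l// mulrC.
by move: hn; rewrite /x -expr2.
Qed.

Let eps n k w := p n ^+ k * disc V (p n) k w.

Let Z n k w := p n ^+ k * (k%:R * disc V (p n) k w - disc1 V (p n) k w).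

Let S n := disc V (p n) n.

Let J n := disc1 V (p n) n.

(** A common second moment bound for L, M, u and R1: in each of them the order 0 sum has coefficient
    at most n and the order 1 sum coefficient 1, in absolute value. *)
Let D n := 2 * (s2 * (n%:R ^+ 2 * geo 0 (x n) n + geo 2 (x n) n)).

Let L2S n c : 0 < p n -> 0 <= c <= n%:R -> 
  L2_bound P (fun w => c * S n w + J n w) (D n).
Proof.
move=> p0 /andP[c0 cn].
apply: L2_bound_le (L2_boundD (L2_boundZ c (disc_L2 indepV iV iV2 EV EV2 _ _))
  (disc1_L2 indepV iV iV2 EV EV2 _ _)).
rewrite /D ler_wpM2l// mulrCA -mulrDr ler_wpM2l// expr2 -/(x n) lerD2r.
by rewrite ler_wpM2r ?geo_ge0// -[leLHS]expr2 lerXn2r// ?nnegrE.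
Qed.

Let R0 n k := disc_rem V (p n) 0 n k.

Let R1 n k := disc_rem V (p n) 1 n k.

(** L and M are the exploding parts of n eps - Z and of Z, divided by p^k; u and R1 are the matching
    remainders. *)
Let L n k w := (n - k)%:R * S n w + J n w.

Let M n k w := k%:R * S n w - J n w.

Let u n k w := - (n%:R * R0 n k w + R1 n k w).

Let L2L n k : 0 < p n -> L2_bound P (L n k) (D n).
Proof. by move=> p0; apply: L2S => //; rewrite ler0n ler_nat leq_subr. Qed.

Let L2M n k : 0 < p n -> (k <= n)%N -> L2_bound P (M n k) (D n).
Proof.
move=> p0 kn.
have := L2_boundD (L2_boundZ k%:R (disc_L2 indepV iV iV2 EV EV2 (p n) n))
  (L2_boundN (disc1_L2 indepV iV iV2 EV EV2 (p n) n)).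
apply: L2_bound_le; rewrite /D ler_wpM2l// mulrCA -mulrDr ler_wpM2l// expr2 -/(x n) lerD2r.
by rewrite ler_wpM2r ?geo_ge0// -[leLHS]expr2 lerXn2r ?nnegrE// ler_nat.
Qed.

Let L2u n k : 0 < p n -> L2_bound P (u n k) (D n).
Proof.
move=> p0; apply: L2_boundN.
have := L2_boundD (L2_boundZ n%:R (disc_rem_L2 indepV iV iV2 EV EV2 0 n k p0))
  (disc_rem_L2 indepV iV iV2 EV EV2 1 n k p0).
by apply: L2_bound_le; rewrite /D ler_wpM2l// mulrCA -mulrDr.
Qed.

Let L2R1 n k : 0 < p n -> L2_bound P (R1 n k) (D n).
Proof.
move=> p0; have := disc_rem_L2 indepV iV iV2 EV EV2 1 n k p0.
apply: L2_bound_le; rewrite /D mulrDr mulrDr muln1 -/(x n).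
rewrite ler_wpDl ?mulr_ge0 ?geo_ge0 ?exprn_ge0//.
by rewrite ler_peMl ?ler1n// mulr_ge0// geo_ge0.
Qed.

Let errA n w := \sum_(1 <= k < n.+1) (p n ^+ k * L n k w + u n k w) * (p n ^+ k * M n k w + R1 n k w) -
  \sum_(1 <= k < n.+1) (p n * p n) ^+ k * (L n k w * M n k w).

Let errB n w := \sum_(1 <= k < n.+1) (p n ^+ k * M n k w + R1 n k w) * (p n ^+ k * M n k w + R1 n k w) -
  \sum_(1 <= k < n.+1) (p n * p n) ^+ k * (M n k w * M n k w).

(** [cA] and [cB] invert the leading orders n k_n^3 p^(2 n) / (2 g) and n^2 k_n^2 p^(2 n) / (2 g).
    The weight n - k trades one n for one k_n in the numerator; the extra p is the prefactor of the
    centred error. *)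
Let cA n := 2 * g * p n / (n%:R * kappa n ^+ 3 * (p n ^+ n * p n ^+ n)).

Let cB n := 2 * g / (n%:R ^+ 2 * kappa n ^+ 2 * (p n ^+ n * p n ^+ n)).

Let p1 : p n @[n --> \oo] --> (1 : R).
Proof. by apply: base_cvg1 kappa_gt0 kappaV _; exact: base_cvg. Qed.

Let x1 : x n @[n --> \oo] --> (1 : R).
Proof. by apply: base_cvg1 kappa_gt0 kappaV _; exact: base_prod_cvg. Qed.

Let kn20 : (kappa n / n%:R) ^+ 2 @[n --> \oo] --> 0.
Proof.
rewrite -[X in _ --> X](mulr0 0) (eq_cvg _ _ (g := fun n => kappa n / n%:R * (kappa n / n%:R))).
  exact: cvgM.
by move=> n; rewrite expr2.
Qed.

Let n_gt0 : \forall n \near \oo, (0 : R) < n%:R.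
Proof. by exists 1%N => // n /= n0; rewrite ltr0n. Qed.

Let D_cvg : 2 * (s2 * (geo 0 (x n) n / kappa n + (kappa n / n%:R) ^+ 2 * (geo 2 (x n) n / kappa n ^+ 3)))
  @[n --> \oo] --> 2 * (s2 * ((g + g)^-1 + 0 * (2 * (g + g) ^- 3))).
Proof.
apply: cvgM; first exact: cvg_cst.
apply: cvgM; first exact: cvg_cst.
by apply: cvgD => //; exact: cvgM.
Qed.

Let Gp : 2 * p n * (geo 0 (p n) n / kappa n) @[n --> \oo] --> 2 * 1 * g^-1.
Proof.
apply: cvgM; last exact: base_geo0_cvg.
by apply: cvgM => //; exact: cvg_cst.
Qed.

Let errA_small : L1_small P (fun n w => cA n * errA n w).
Proof.
exists (fun n => `|cA n| * (D n * (p n * p n ^+ n * geo 0 (p n) n + p n * p n ^+ n * geo 0 (p n) n + n%:R))).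
  have h : 2 * g * p n * (2 * (s2 * (geo 0 (x n) n / kappa n + (kappa n / n%:R) ^+ 2 * (geo 2 (x n) n / kappa n ^+ 3)))) *
      (2 * p n * (geo 0 (p n) n / kappa n) * (n%:R / kappa n * p n ^- n) +
       (n%:R / kappa n * p n ^- n) * (n%:R / kappa n * p n ^- n)) @[n --> \oo] -->
      2 * g * 1 * (2 * (s2 * ((g + g)^-1 + 0 * (2 * (g + g) ^- 3)))) * (2 * 1 * g^-1 * 0 + 0 * 0).
    apply: cvgM; last by apply: cvgD; exact: cvgM.
    by apply: cvgM => //; apply: cvgM => //; exact: cvg_cst.
  rewrite !(mulr0, addr0) in h; apply: cvg_trans h; apply: near_eq_cvg.
  apply: filterS3 kappa_gt0 n_gt0 p_gt0 => n k0 n0 p0.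
  by rewrite /cA /D equal_numerator_error ?exprn_gt0// expr2.
apply: filterS p_gt0 => n p0; apply: L1_boundZ.
have := @cross_sum_L1_bound _ _ _ P (L n) (M n) (u n) (R1 n) (p n) (p n) (D n) n (ltW p0) (ltW p0).
rewrite !geo_rev0 ?gt_eqF// !exprS; apply => k /andP[_ kn].
by split; [exact: L2L|exact: L2M|exact: L2u|exact: L2R1].
Qed.

Let errB_small : L1_small P (fun n w => cB n * errB n w).
Proof.
exists (fun n => `|cB n| * (D n * (p n * p n ^+ n * geo 0 (p n) n + p n * p n ^+ n * geo 0 (p n) n + n%:R))).
  have h : 2 * g * (2 * (s2 * (geo 0 (x n) n / kappa n + (kappa n / n%:R) ^+ 2 * (geo 2 (x n) n / kappa n ^+ 3)))) *
      (2 * p n * (geo 0 (p n) n / kappa n) * p n ^- n +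
       (n%:R / kappa n * p n ^- n) * p n ^- n) @[n --> \oo] -->
      2 * g * (2 * (s2 * ((g + g)^-1 + 0 * (2 * (g + g) ^- 3)))) * (2 * 1 * g^-1 * 0 + 0 * 0).
    apply: cvgM; last by apply: cvgD; exact: cvgM.
    by apply: cvgM => //; exact: cvg_cst.
  rewrite !(mulr0, addr0) in h; apply: cvg_trans h; apply: near_eq_cvg.
  apply: filterS3 kappa_gt0 n_gt0 p_gt0 => n k0 n0 p0.
  by rewrite /cB /D equal_denominator_error ?exprn_gt0.
apply: filterS p_gt0 => n p0; apply: L1_boundZ.
have := @cross_sum_L1_bound _ _ _ P (M n) (M n) (R1 n) (R1 n) (p n) (p n) (D n) n (ltW p0) (ltW p0).
rewrite !geo_rev0 ?gt_eqF// !exprS; apply => k /andP[_ kn].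
by split; [exact: L2M|exact: L2M|exact: L2R1|exact: L2R1].
Qed.

Let quadratic_small (c1 c2 c3 : nat -> R) :
  c1 n @[n --> \oo] --> 0 -> c2 n @[n --> \oo] --> 0 -> c3 n @[n --> \oo] --> 0 ->
  L1_small P (fun n w => c1 n * (W n w * W n w) + c2 n * (W n w * H n w) + c3 n * (H n w * H n w)).
Proof.
move=> h1 h2 h3; apply: L1_smallD; first apply: L1_smallD.
- by apply: L1_bounded_smallZ => //; exact: L2_boundedM.
- by apply: L1_bounded_smallZ => //; exact: L2_boundedM.
- by apply: L1_bounded_smallZ => //; exact: L2_boundedM.
Qed.

(** t0, t1 and t2 are the sums T a of [equal_sums], divided by p^(2 n) k_n^(a + 1). *)
Let t0 n := x n * (geo 0 (x n) n / kappa n).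

Let t1 n := x n * (geo 1 (x n) n / kappa n ^+ 2 - (kappa n)^-1 * (geo 0 (x n) n / kappa n)).

Let t2 n := x n * (geo 2 (x n) n / kappa n ^+ 3 - 2 * (kappa n)^-1 * (geo 1 (x n) n / kappa n ^+ 2) +
  (kappa n)^-1 * (kappa n)^-1 * (geo 0 (x n) n / kappa n)).

Let t0_cvg : t0 n @[n --> \oo] --> (g + g)^-1.
Proof. by rewrite -[X in _ --> X]mul1r; exact: cvgM. Qed.

Let t1_cvg : t1 n @[n --> \oo] --> (g + g) ^- 2.
Proof.
have h : t1 n @[n --> \oo] --> 1 * ((g + g) ^- 2 - 0 * (g + g)^-1).
  by apply: cvgM => //; apply: cvgB => //; exact: cvgM.
by rewrite mul0r subr0 mul1r in h.
Qed.

Let t2_cvg : t2 n @[n --> \oo] --> 2 * (g + g) ^- 3.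
Proof.
have h : t2 n @[n --> \oo] --> 1 * (2 * (g + g) ^- 3 - 2 * 0 * (g + g) ^- 2 + 0 * 0 * (g + g)^-1).
  apply: cvgM => //; apply: cvgD; last by apply: cvgM => //; exact: cvgM.
  by apply: cvgB => //; apply: cvgM => //; apply: cvgM => //; exact: cvg_cst.
by rewrite !(mulr0, mul0r, subr0, addr0, mul1r) in h.
Qed.

Let scales n w : 0 < kappa n ->
  S n w = Num.sqrt (kappa n) * W n w /\ J n w = Num.sqrt (kappa n) ^+ 3 * H n w.
Proof.
move=> k0; have s0 : 0 < Num.sqrt (kappa n) by rewrite sqrtr_gt0.
rewrite /W /scaled_disc /H /scaled_disc1 mulVKf ?gt_eqF//; split=> //.
rewrite -[X in (X * _)^-1](sqr_sqrtr (ltW k0)) -exprSr mulVKf//.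
by rewrite expf_neq0// gt_eqF.
Qed.

Let sums_scaled n : 0 < kappa n -> 0 < p n -> let k := Num.sqrt (kappa n) ^+ 2 in
  let T a := \sum_(1 <= k < n.+1) (n - k)%:R ^+ a * x n ^+ k in
  let X := p n ^+ n * p n ^+ n in
  [/\ T 0%N = X * k * t0 n, T 1%N = X * k ^+ 2 * t1 n & T 2%N = X * k ^+ 3 * t2 n].
Proof.
move=> k0 p0; have x0 : x n != 0 by rewrite mulf_neq0// gt_eqF.
have [e0 e1 e2] := geo_rev_scaling (x n) (p n ^+ n * p n ^+ n)
  (geo 0 (x n) n) (geo 1 (x n) n) (geo 2 (x n) n) k0.
have E : x n ^+ n.+1 = x n * (p n ^+ n * p n ^+ n) by rewrite exprS exprMn.
split; rewrite (sqr_sqrtr (ltW k0)).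
- by rewrite -e0 -E -geo_rev0//; apply: eq_bigr => k _; rewrite expr0 mul1r.
- by rewrite -e1 -E -geo_rev1//; apply: eq_bigr => k _; rewrite expr1.
- by rewrite -e2 -E -geo_rev2.
Qed.

Let numerator n w := cA n * \sum_(1 <= k < n.+1) (n%:R * eps n k w - Z n k w) * Z n k w.

Let denominator n w := cB n * \sum_(1 <= k < n.+1) Z n k w ^+ 2.

(** W / (2 g) comes from the term T 1 S^2 and H from T 0 S J. *)
Let U n w := (2 * g)^-1 * W n w + H n w.

Let Z_split n k w : (k <= n)%N -> Z n k w = p n ^+ k * M n k w + R1 n k w.
Proof. by move=> kn; rewrite /Z (disc1_split _ _ _ kn). Qed.

Let numerator_small : L1_small P (fun n w => numerator n w - U n w * W n w).
Proof.
have q := @quadratic_small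
  (fun n => 2 * g * p n * t1 n - 2 * g * p n * (kappa n / n%:R) * t2 n - (2 * g)^-1)
  (fun n => 2 * g * p n * t0 n - 2 * g * p n * (kappa n / n%:R) * (2 * t1 n) - 1)
  (fun n => - (2 * g * p n * (kappa n / n%:R) * t0 n)).
have gp : 2 * g * p n @[n --> \oo] --> 2 * g * 1 by apply: cvgM => //; exact: cvg_cst.
have {}q := q _ _ _; apply: L1_small_eq (L1_smallD errA_small (q _ _ _)).
- apply: filterS3 kappa_gt0 n_gt0 p_gt0 => n k0 n0 p0 w.
  have s0 : 0 < Num.sqrt (kappa n) by rewrite sqrtr_gt0.
  have P0 : 0 < p n ^+ n by rewrite exprn_gt0.
  have [SW JH] := scales w k0.
  have [T0 T1 T2] := sums_scaled k0 p0.
  have [mA _] := equal_sums n (x n) (S n w) (J n w).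
  have := equal_numerator_main g (p n) (W n w) (H n w) (t0 n) (t1 n) (t2 n) s0 n0 P0.
  rewrite -T0 -T1 -T2 -SW -JH -mA (sqr_sqrtr (ltW k0)) -/(cA n) => main.
  have -> : numerator n w = cA n * errA n w + cA n *
      \sum_(1 <= k < n.+1) x n ^+ k * (((n - k)%:R * S n w + J n w) * (k%:R * S n w - J n w)).
    rewrite -mulrDr /errA subrK; congr (_ * _); rewrite big_nat [RHS]big_nat.
    apply: eq_bigr => k /andP[_]; rewrite ltnS => kn; rewrite Z_split//; congr (_ * _).
    by rewrite /eps (disc_split _ _ _ kn) /L /M /u natrB// -/(S n w) -/(R0 n k w); ring.
  by rewrite main /U; ring.
- have h : 2 * g * p n * t1 n - 2 * g * p n * (kappa n / n%:R) * t2 n - (2 * g)^-1 @[n --> \oo] -->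
      2 * g * 1 * (g + g) ^- 2 - 2 * g * 1 * 0 * (2 * (g + g) ^- 3) - (2 * g)^-1.
    apply: cvgB; last exact: cvg_cst.
    by apply: cvgB; apply: cvgM => //; exact: cvgM.
  have E : 2 * g * 1 * (g + g) ^- 2 - 2 * g * 1 * 0 * (2 * (g + g) ^- 3) - (2 * g)^-1 = 0.
    by field; rewrite !gt_eqF.
  by rewrite E in h.
- have h : 2 * g * p n * t0 n - 2 * g * p n * (kappa n / n%:R) * (2 * t1 n) - 1 @[n --> \oo] -->
      2 * g * 1 * (g + g)^-1 - 2 * g * 1 * 0 * (2 * (g + g) ^- 2) - 1.
    apply: cvgB; last exact: cvg_cst.
    apply: cvgB; apply: cvgM => //; first exact: cvgM.
    by apply: cvgM => //; exact: cvg_cst.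
  have E : 2 * g * 1 * (g + g)^-1 - 2 * g * 1 * 0 * (2 * (g + g) ^- 2) - 1 = 0.
    by field; rewrite !gt_eqF.
  by rewrite E in h.
- rewrite -oppr0; apply: cvgN.
  have h : 2 * g * p n * (kappa n / n%:R) * t0 n @[n --> \oo] --> 2 * g * 1 * 0 * (g + g)^-1.
    by apply: cvgM => //; exact: cvgM.
  by rewrite mulr0 mul0r in h.
Qed.

Let denominator_small : L1_small P (fun n w => denominator n w - W n w ^+ 2).
Proof.
have q := @quadratic_small
  (fun n => 2 * g * t0 n - 4 * g * (kappa n / n%:R) * t1 n + 2 * g * (kappa n / n%:R) ^+ 2 * t2 n - 1)
  (fun n => 4 * g * (kappa n / n%:R) ^+ 2 * t1 n - 4 * g * (kappa n / n%:R) * t0 n)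
  (fun n => 2 * g * (kappa n / n%:R) ^+ 2 * t0 n).
have c2 c : c * (kappa n / n%:R) ^+ 2 @[n --> \oo] --> c * 0 by apply: cvgM => //; exact: cvg_cst.
have c1 c : c * (kappa n / n%:R) @[n --> \oo] --> c * 0 by apply: cvgM => //; exact: cvg_cst.
have {}q := q _ _ _; apply: L1_small_eq (L1_smallD errB_small (q _ _ _)).
- apply: filterS3 kappa_gt0 n_gt0 p_gt0 => n k0 n0 p0 w.
  have s0 : 0 < Num.sqrt (kappa n) by rewrite sqrtr_gt0.
  have P0 : 0 < p n ^+ n by rewrite exprn_gt0.
  have [SW JH] := scales w k0.
  have [T0 T1 T2] := sums_scaled k0 p0.
  have [_ mB] := equal_sums n (x n) (S n w) (J n w).
  have := equal_denominator_main g (W n w) (H n w) (t0 n) (t1 n) (t2 n) s0 n0 P0.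
  rewrite -T0 -T1 -T2 -SW -JH -mB (sqr_sqrtr (ltW k0)) -/(cB n) => main.
  have -> : denominator n w = cB n * errB n w + cB n *
      \sum_(1 <= k < n.+1) x n ^+ k * ((k%:R * S n w - J n w) * (k%:R * S n w - J n w)).
    rewrite -mulrDr /errB subrK; congr (_ * _); rewrite big_nat [RHS]big_nat.
    by apply: eq_bigr => k /andP[_ kn]; rewrite Z_split.
  by rewrite main; ring.
- have h : 2 * g * t0 n - 4 * g * (kappa n / n%:R) * t1 n + 2 * g * (kappa n / n%:R) ^+ 2 * t2 n - 1
      @[n --> \oo] --> 2 * g * (g + g)^-1 - 4 * g * 0 * (g + g) ^- 2 + 2 * g * 0 * (2 * (g + g) ^- 3) - 1.
    apply: cvgB; last exact: cvg_cst.
    apply: cvgD; last exact: cvgM.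
    by apply: cvgB; apply: cvgM => //; exact: cvg_cst.
  have E : 2 * g * (g + g)^-1 - 4 * g * 0 * (g + g) ^- 2 + 2 * g * 0 * (2 * (g + g) ^- 3) - 1 = 0.
    by field; rewrite !gt_eqF.
  by rewrite E in h.
- have h : 4 * g * (kappa n / n%:R) ^+ 2 * t1 n - 4 * g * (kappa n / n%:R) * t0 n @[n --> \oo] -->
      4 * g * 0 * (g + g) ^- 2 - 4 * g * 0 * (g + g)^-1.
    by apply: cvgB; exact: cvgM.
  by rewrite !(mulr0, mul0r, subr0) in h.
- have h : 2 * g * (kappa n / n%:R) ^+ 2 * t0 n @[n --> \oo] --> 2 * g * 0 * (g + g)^-1.
    exact: cvgM.
  by rewrite !(mulr0, mul0r) in h.
Qed.

(** From (1 + g / k_n)^j >= j g / k_n. It brings the weights of H to order k_n^(-1/2), as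
    negligibility requires. *)
Let base_growth_linear n j : 0 < kappa n -> j%:R * p n ^- j <= kappa n / g.
Proof.
move=> k0; have y0 : 0 < g / kappa n by rewrite divr_gt0.
have p0 : 0 < p n ^+ j by rewrite exprn_gt0// addr_gt0.
rewrite ler_pdivrMr// -invf_div ler_pdivlMl//.
apply: le_trans (quadratic_bernoulli j (ltW y0)).
rewrite mulrC -addrA addrCA lerDl addr_ge0// mulr_ge0 ?sqr_ge0// divr_ge0//.
case: (j) => [|i]; first by rewrite mul0r.
by rewrite mulr_ge0// -natr1 addrK.
Qed.

(** Origin of 5 / 8, per unit s2: the variance of U is the sum of var W / (4 g^2), cov (W, H) / g
    and var H, that is (1/8 + 1/4 + 1/4) / g^3. *)
Let limit_cos s t b :
  \int[P]_w cos (s * U n w + t * W n w + b) @[n --> \oo] -->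
  expR (- (s2 * (5 * s ^+ 2 / (8 * g ^+ 3) + s * t / g ^+ 2 + t ^+ 2 / (2 * g)) / 2)) * cos b.
Proof.
pose c := s / (2 * g) + t.
pose a n j := (Num.sqrt (kappa n))^-1 * (c * p n ^- j + s * (j%:R * p n ^- j / kappa n)).
have E n : \int[P]_w cos (s * U n w + t * W n w + b) = \int[P]_w cos (weighted_sum V (a n) n w + b).
  congr (Rintegral _ _ _); apply/funext => w; congr (cos (_ + _)).
  have -> : s * U n w + t * W n w = c * W n w + s * H n w by rewrite /U /c; ring.
  rewrite /W /H /scaled_disc /scaled_disc1 /disc /disc1 !mulrA -!weighted_sumZ -weighted_sumD.
  by apply: eq_bigr => j _; congr (_ * _); rewrite /a invfM; ring.
rewrite (eq_cvg _ _ E).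
have -> : 5 * s ^+ 2 / (8 * g ^+ 3) + s * t / g ^+ 2 + t ^+ 2 / (2 * g) =
    c ^+ 2 * (g + g)^-1 + 2 * c * s * (g + g) ^- 2 + s ^+ 2 * (2 * (g + g) ^- 3).
  by rewrite /c; field; rewrite !gt_eqF.
apply: (cos_weighted_sum_cvg indepV idV iV iV2 EV EV2
    (m := fun n => (Num.sqrt (kappa n))^-1 * (`|c| + `|s| * g^-1))).
- apply: filterS kappa_gt0 => n k0 j _.
  have s0 : 0 <= (Num.sqrt (kappa n))^-1 by rewrite invr_ge0 sqrtr_ge0.
  have e0 : 0 <= p n ^- j.
    by rewrite invr_ge0 exprn_ge0// addr_ge0// divr_ge0// ltW.
  rewrite /a normrM (ger0_norm s0) ler_wpM2l// (le_trans (ler_normD _ _))// !(normrM c, normrM s).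
  apply: lerD.
    by rewrite ler_piMr// ger0_norm// base_expV_le1.
  rewrite ler_wpM2l// ger0_norm; last by rewrite mulr_ge0 ?invr_ge0 ?mulr_ge0// ltW.
  by rewrite ler_pdivrMr// [leRHS]mulrC base_growth_linear.
- move=> n; rewrite mulr_ge0 ?invr_ge0 ?sqrtr_ge0// addr_ge0// mulr_ge0// invr_ge0.
  exact: ltW.
- rewrite -[X in _ --> X](mul0r (`|c| + `|s| * g^-1)).
  by apply: cvgM; [exact: sqrtV_cvg0|exact: cvg_cst].
have h : c ^+ 2 * (geo 0 (x n) n / kappa n) + 2 * c * s * (geo 1 (x n) n / kappa n ^+ 2) +
    s ^+ 2 * (geo 2 (x n) n / kappa n ^+ 3) @[n --> \oo] -->
    c ^+ 2 * (g + g)^-1 + 2 * c * s * (g + g) ^- 2 + s ^+ 2 * (2 * (g + g) ^- 3).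
  by apply: cvgD; [apply: cvgD|]; (apply: cvgM; [exact: cvg_cst|]).
apply: cvg_trans h; apply: near_eq_cvg; apply: filterS kappa_gt0 => n k0.
rewrite /geo !mulr_suml !mulr_sumr -!big_split/=; apply: eq_bigr => j _.
rewrite /a (exprMn _ (Num.sqrt _)^-1) exprVn (sqr_sqrtr (ltW k0)).
rewrite (exprMn j) invfM expr0 expr1.
by move: (p n ^- j) => e; field; rewrite gt_eqF.
Qed.

Theorem equal_ratio_cvg d' (T' : measurableType d') (Q : probability T' R)
    (Y : nat -> T -> R) (xi eta : T' -> R) :
  (forall n, measurable_fun setT (Y n)) ->
  measurable_fun setT xi -> measurable_fun setT eta ->
  (forall s t b, \int[Q]_w cos (s * xi w + t * eta w + b) =
    expR (- (s2 * (5 * s ^+ 2 / (8 * g ^+ 3) + s * t / g ^+ 2 + t ^+ 2 / (2 * g)) / 2)) * cos b) ->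
  Q [set w | eta w = 0] = 0%E ->
  (\forall n \near \oo, forall w,
    \sum_(1 <= k < n.+1)
      (base kappa g n ^+ k * (k%:R * disc V (base kappa g n) k w - disc1 V (base kappa g n) k w)) ^+ 2 != 0 ->
    Y n w = n%:R / kappa n * (base kappa g n *
     ((\sum_(1 <= k < n.+1)
       (n%:R * (base kappa g n ^+ k * disc V (base kappa g n) k w) -
        base kappa g n ^+ k * (k%:R * disc V (base kappa g n) k w - disc1 V (base kappa g n) k w)) *
       (base kappa g n ^+ k * (k%:R * disc V (base kappa g n) k w - disc1 V (base kappa g n) k w))) /
      (\sum_(1 <= k < n.+1)
      (base kappa g n ^+ k * (k%:R * disc V (base kappa g n) k w - disc1 V (base kappa g n) k w)) ^+ 2)))) ->
  cvg_in_distribution P Q Y (fun w => xi w / eta w).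
Proof.
move=> mY mxi meta cosQ eta0 hY.
have mW n : measurable_fun setT (W n).
  by apply: measurable_funM => //; exact: measurable_weighted_sum.
have mU n : measurable_fun setT (U n).
  apply: measurable_funD; apply: measurable_funM => //; exact: measurable_weighted_sum.
have cosU s t b : \int[P]_w cos (s * U n w + t * W n w + b) @[n --> \oo] -->
    \int[Q]_w cos (s * xi w + t * eta w + b).
  by rewrite cosQ; exact: limit_cos.
apply: (cvg_in_distribution_ratio mU mW mY mxi meta cosU numerator_small denominator_small _ eta0).
apply: filterS2 (filterI kappa_gt0 n_gt0) (filterI p_gt0 hY) => n [k0 n0] [p0 {}hY] w.
rewrite /denominator mulf_eq0 negb_or => /andP[c0 S0]; rewrite hY// /numerator.
have P0 : 0 < p n ^+ n by rewrite exprn_gt0.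
apply: equal_ratio_algebra => //.
Qed.

End equal.

(** * The least squares estimator *)

(** The ratio theorems take the denominator as second component; the covariance matrices may list it
    first. *)
Lemma centered_gaussian_vector_swap d (T : measurableType d) (R : realType)
    (Q : probability T R) (xi eta : {RV Q >-> R}) (A B C : R) :
  centered_gaussian_vector (pair2 xi eta) (mx2 A B B C) ->
  centered_gaussian_vector (pair2 eta xi) (mx2 C B B A).
Proof.
pose tau (i : 'I_2) : 'I_2 := if i == ord0 then ord_max else ord0.
have tauE i : pair2 eta xi i = pair2 xi eta (tau i).
  by rewrite /tau /pair2; case: (i == ord0).
move=> [gv ev cv]; split=> [a|i|i j].
- have [m [s ms]] := gv (fun i => a (tau i)); exists m, s => D mD; rewrite -(ms D mD).
  have -> : (fun w => \sum_(i < 2) a i * pair2 eta xi i w) =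
      (fun w => \sum_(i < 2) a (tau i) * pair2 xi eta i w); last by [].
  apply/funext => w; rewrite !big_ord_recl !big_ord0 !addr0 addrC.
  by have -> : lift ord0 ord0 = ord_max :> 'I_2 by exact: val_inj.
- by rewrite tauE.
- rewrite !tauE cv !mxE; congr (_%:E).
  by rewrite /tau /pair2; case: (i == ord0); case: (j == ord0).
Qed.

(** A multiple v of the lagged process may replace it, at the price of the factor c, and a may be
    any coefficient for which u is the residual. If the sum of v^2 is nonzero so is the genuine
    denominator, and the estimator is then its quotient. *)
Lemma least_squares_error (R : realFieldType) (x u v : nat -> R) (a c : R) (n : nat) :
  (forall j, (1 <= j <= n)%N -> x j = a * x j.-1 + u j) ->
  (forall j, (1 <= j <= n)%N -> c * x j.-1 = v j) ->
  \sum_(1 <= j < n.+1) v j ^+ 2 != 0 ->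
  \sum_(1 <= j < n.+1) x j.-1 ^+ 2 != 0 /\
  (\sum_(1 <= j < n.+1) x j * x j.-1) / (\sum_(1 <= j < n.+1) x j.-1 ^+ 2) =
  a + c * ((\sum_(1 <= j < n.+1) u j * v j) / (\sum_(1 <= j < n.+1) v j ^+ 2)).
Proof.
move=> xu cv; set s := \sum_(1 <= j < n.+1) x j.-1 ^+ 2.
have -> : \sum_(1 <= j < n.+1) v j ^+ 2 = c ^+ 2 * s.
  by rewrite mulr_sumr; apply: eq_big_nat => j jn; rewrite -cv// exprMn.
have -> : \sum_(1 <= j < n.+1) u j * v j = c * \sum_(1 <= j < n.+1) u j * x j.-1.
  by rewrite mulr_sumr; apply: eq_big_nat => j jn; rewrite -cv// mulrCA.
have -> : \sum_(1 <= j < n.+1) x j * x j.-1 = a * s + \sum_(1 <= j < n.+1) u j * x j.-1.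
  rewrite mulr_sumr -big_split/=; apply: eq_big_nat => j jn.
  by rewrite xu// mulrDl expr2 mulrA.
rewrite mulf_eq0 negb_or expf_eq0/= => /andP[c0 s0]; split=> //.
by field; rewrite s0 c0.
Qed.

(** * Closed forms of the two-stage autoregression *)

Section ar_process.
Context d (T : measurableType d) (R : realType) (P : probability T R)
  (V : nat -> {RV P >-> R}).

Lemma disc_recr (p : R) k w : p != 0 ->
  p ^+ k.+1 * disc V p k.+1 w = p * (p ^+ k * disc V p k w) + V k.+1 w.
Proof.
move=> p0; rewrite /disc weighted_sumS mulrDr exprS [in RHS]mulrA; congr (_ + _).
by rewrite mulrA divff ?mul1r// mulf_neq0// expf_neq0.
Qed.

Lemma disc0 (p : R) w : disc V p 0 w = 0.
Proof. by rewrite /disc /weighted_sum big_geq. Qed.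

Lemma disc1_recr (p : R) k w :
  p ^+ k.+1 * (k.+1%:R * disc V p k.+1 w - disc1 V p k.+1 w) =
  p * (p ^+ k * (k%:R * disc V p k w - disc1 V p k w) + p ^+ k * disc V p k w).
Proof. by rewrite /disc /disc1 !weighted_sumS exprS -natr1; ring. Qed.

Lemma ar_closed_form (p : R) (e : nat -> R) n w : p != 0 -> e 0%N = 0 ->
  (forall j, (1 <= j <= n)%N -> e j = p * e j.-1 + V j w) ->
  forall j, (j <= n)%N -> e j = p ^+ j * disc V p j w.
Proof.
move=> p0 e0 he; elim=> [|j IH] jn; first by rewrite e0 disc0 mulr0.
by rewrite he//= IH ?(ltnW jn)// disc_recr.
Qed.

(* y_j - q y_(j-1) is an autoregression with root p: the two roots play symmetric roles,
   so that case (2) is case (1) with the roots exchanged. *)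
Lemma ar2_closed_form (p q : R) (y e : nat -> R) n w : p != 0 -> q != 0 -> y 0%N = 0 ->
  (forall j, (1 <= j <= n)%N -> y j = p * y j.-1 + e j) ->
  (forall j, (j <= n)%N -> e j = q ^+ j * disc V q j w) ->
  forall j, (1 <= j <= n)%N ->
    (p - q) * y j.-1 = p ^+ j * disc V p j w - q ^+ j * disc V q j w.
Proof.
move=> p0 q0 y0 hy he; case=> // j /=.
elim: j => [|j IH] jn.
  by rewrite y0 mulr0 !disc_recr// !disc0 !mulr0 !add0r subrr.
rewrite hy//=; last exact: ltnW.
rewrite mulrDr mulrCA IH ?(ltnW jn)// he; last exact: ltnW.
rewrite (disc_recr j.+1 w p0) (disc_recr j.+1 w q0); ring.
Qed.

(** Resonance of the equal roots: driving an autoregression by another one with the same root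
    produces the factor j. *)
Lemma ar2_equal_closed_form (p : R) (y e : nat -> R) n w : y 0%N = 0 ->
  (forall j, (1 <= j <= n)%N -> y j = p * y j.-1 + e j) ->
  (forall j, (j <= n)%N -> e j = p ^+ j * disc V p j w) ->
  forall j, (1 <= j <= n)%N ->
    p * y j.-1 = p ^+ j * (j%:R * disc V p j w - disc1 V p j w).
Proof.
move=> y0 hy he; case=> // j /=.
elim: j => [|j IH] jn.
  rewrite y0 mulr0 disc1_recr disc0 /disc1 /weighted_sum big_geq//.
  by rewrite !(mulr0, subrr, addr0).
rewrite hy//=; last exact: ltnW.
rewrite IH ?(ltnW jn)// he; last exact: ltnW.
by rewrite [RHS]disc1_recr.
Qed.

End ar_process.

Lemma normalized_error_gt (R : realFieldType) (g1 g2 k a b A B r : R) :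
  0 < g1 -> g2 < g1 -> 0 < k -> B != 0 -> a - b = (g1 - g2) / k ->
  (g1 + g2) / (2 * g1 * (g1 - g2)) * k * A / B * (a + (a - b) * r - a) =
  (g1 + g2) / (2 * g1) * (A / B) * r.
Proof.
move=> g10 g21 k0 B0 ab; rewrite (addrC a) addrK ab; field.
by rewrite B0 subr_eq0 !gt_eqF.
Qed.

(** The regression is expanded around the larger root b, so k (b - a) cancels the centring g2 -
    g1. *)
Lemma normalized_error_lt (R : realFieldType) (g1 g2 k a b A B r : R) :
  0 < g2 -> g1 < g2 -> 0 < k -> B != 0 -> b - a = (g2 - g1) / k ->
  (g1 + g2) / (2 * g2 * (g2 - g1)) * A / B *
    (k * (b + (b - a) * r - a) - (g2 - g1)) =
  (g2 + g1) / (2 * g2) * (A / B) * r.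
Proof.
move=> g20 g12 k0 B0 ab.
have -> : b + (b - a) * r - a = (b - a) * (1 + r) by ring.
rewrite ab; field.
by rewrite B0 subr_eq0 !gt_eqF.
Qed.

(** Subtracting p amounts to replacing m e by m e - z in the numerator; for m = n this removes its
    leading term. *)
Lemma normalized_error_eq (R : realFieldType) (k m p : R) (e z : nat -> R) (n : nat) :
  \sum_(1 <= j < n.+1) z j ^+ 2 != 0 ->
  m / k * (m * (p + p * ((\sum_(1 <= j < n.+1) e j * z j) / (\sum_(1 <= j < n.+1) z j ^+ 2)) - p) - p) =
  m / k * (p * ((\sum_(1 <= j < n.+1) (m * e j - z j) * z j) / (\sum_(1 <= j < n.+1) z j ^+ 2))).
Proof.
move=> D0; have -> : \sum_(1 <= j < n.+1) (m * e j - z j) * z j =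
    m * (\sum_(1 <= j < n.+1) e j * z j) - \sum_(1 <= j < n.+1) z j ^+ 2.
  by rewrite mulr_sumr -sumrB; apply: eq_bigr => j _; ring.
by rewrite mulrBl divff// (addrC p) addrK; ring.
Qed.

Theorem theorem2p1 (R : realType)
    (d : measure_display) (T : measurableType d) (P : probability T R)
    (V : nat -> {RV P >-> R}) (sigma : R)
    (hV_iid : iid [set i | (1 <= i)%N] V)
    (hV_mean : forall i, (1 <= i)%N -> ('E_P[V i] = 0)%E)
    (hV_var : forall i, (1 <= i)%N -> ('V_P[V i] = (sigma ^+ 2)%:E)%E)
    (hsigma : 0 < sigma ^+ 2)
    (k : nat -> R)
    (hk_pos : forall n, (1 <= n)%N -> 0 < k n)
    (hk_incr : forall m n, (1 <= m)%N -> (m <= n)%N -> k m <= k n)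
    (hk_infty : k n @[n --> \oo] --> +oo)
    (hk_o : k =o_\oo (fun n : nat => n%:R : R))
    (gamma1 gamma2 : R) (hgamma1 : 0 < gamma1) (hgamma2 : 0 < gamma2)
    (theta rho : nat -> R)
    (htheta : forall n, (1 <= n)%N -> theta n = 1 + gamma1 / k n)
    (hrho : forall n, (1 <= n)%N -> rho n = 1 + gamma2 / k n)
    (X eps : nat -> nat -> T -> R)
    (hX0 : forall n w, (1 <= n)%N -> X n 0%N w = 0)
    (heps0 : forall n w, (1 <= n)%N -> eps n 0%N w = 0)
    (hX : forall n j w, (1 <= j <= n)%N ->
       X n j w = theta n * X n j.-1 w + eps n j w)
    (heps : forall n j w, (1 <= j <= n)%N ->
       eps n j w = rho n * eps n j.-1 w + V j w)
    (thetahat : nat -> {RV P >-> R})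
    (hthetahat : forall n w, (1 <= n)%N ->
       \sum_(1 <= j < n.+1) X n j.-1 w ^+ 2 != 0 ->
       thetahat n w = (\sum_(1 <= j < n.+1) X n j w * X n j.-1 w) /
                      (\sum_(1 <= j < n.+1) X n j.-1 w ^+ 2))
    (d' : measure_display) (T' : measurableType d') (Q : probability T' R) :
  [/\ gamma2 < gamma1 ->
      forall xi_theta xi_rho : {RV Q >-> R},
      centered_gaussian_vector (pair2 xi_theta xi_rho)
        (mx2 (sigma ^+ 2 / (2 * gamma1)) (sigma ^+ 2 / (gamma1 + gamma2))
             (sigma ^+ 2 / (gamma1 + gamma2)) (sigma ^+ 2 / (2 * gamma2))) ->
      cvg_in_distribution P Q
        (fun n w => (gamma1 + gamma2) / (2 * gamma1 * (gamma1 - gamma2)) *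
                    k n * theta n ^+ n * rho n ^- n *
                    (thetahat n w - theta n))
        (fun w => xi_rho w / xi_theta w),
      gamma1 < gamma2 ->
      forall xi_theta xi_rho : {RV Q >-> R},
      centered_gaussian_vector (pair2 xi_theta xi_rho)
        (mx2 (sigma ^+ 2 / (2 * gamma1)) (sigma ^+ 2 / (gamma1 + gamma2))
             (sigma ^+ 2 / (gamma1 + gamma2)) (sigma ^+ 2 / (2 * gamma2))) ->
      cvg_in_distribution P Q
        (fun n w => (gamma1 + gamma2) / (2 * gamma2 * (gamma2 - gamma1)) *
                    rho n ^+ n * theta n ^- n *
                    (k n * (thetahat n w - theta n) - (gamma2 - gamma1)))
        (fun w => xi_theta w / xi_rho w) &
      forall gamma : R, gamma1 = gamma -> gamma2 = gamma ->
      forall phi_theta zeta_theta : {RV Q >-> R},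
      centered_gaussian_vector (pair2 phi_theta zeta_theta)
        (mx2 (sigma ^+ 2 / (2 * gamma)) (sigma ^+ 2 / (2 * gamma ^+ 2))
             (sigma ^+ 2 / (2 * gamma ^+ 2))
             (5 * sigma ^+ 2 / (8 * gamma ^+ 3))) ->
      cvg_in_distribution P Q
        (fun n w => n%:R / k n * (n%:R * (thetahat n w - theta n) - theta n))
        (fun w => zeta_theta w / phi_theta w)].
Proof.
case: hV_iid => indepV idV.
have iV2 i : (1 <= i)%N -> P.-integrable setT (EFin \o (fun w => V i w ^+ 2)).
  by move=> i1; apply: (centered_integrable_sqr (hV_mean _ i1) (hV_var _ i1)).
have iV i : (1 <= i)%N -> P.-integrable setT (EFin \o V i).
  by move=> i1; apply: integrable_of_sqr; exact: iV2.
have EV i : (1 <= i)%N -> \int[P]_w V i w = 0.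
  by move=> i1; apply: Rintegral_centered; exact: hV_mean.
have EV2 i : (1 <= i)%N -> \int[P]_w (V i w ^+ 2) = sigma ^+ 2.
  move=> i1; rewrite -(Rintegral_centered_covariance (hV_mean _ i1) (hV_mean _ i1) (hV_var _ i1)).
  by apply: eq_Rintegral => w _; rewrite expr2.
(* The value k 0 is unconstrained, so facts about k hold from rank 1 on. *)
have k_gt0 : \forall n \near \oo, 0 < k n by exists 1%N => // n /=; exact: hk_pos.
have kV : (k n)^-1 @[n --> \oo] --> 0 by exact: (gtr0_cvgV0 k_gt0).2 hk_infty.
have k_o : k n / n%:R @[n --> \oo] --> 0.
  apply/cvgrPdist_le => e e0; move/eqoP: hk_o => /(_ e e0) he.
  near=> n; have n0 : 0 < n%:R :> R by rewrite ltr0n; near: n; exact: nbhs_infty_gt.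
  rewrite sub0r normrN normrM normfV ler_pdivrMr ?normr_gt0 ?gt_eqF//.
  by near: n.
have near1 : \forall n \near \oo, (1 <= n)%N by exact: nbhs_infty_ge.
have thetaE n : (1 <= n)%N -> theta n = base k gamma1 n by exact: htheta.
have rhoE n : (1 <= n)%N -> rho n = base k gamma2 n by exact: hrho.
have base0 g n : 0 < g -> (1 <= n)%N -> base k g n != 0.
  by move=> g0 n1; rewrite gt_eqF// addr_gt0// divr_gt0// hk_pos.
have epsE n w : (1 <= n)%N -> forall j, (j <= n)%N ->
    eps n j w = base k gamma2 n ^+ j * disc V (base k gamma2 n) j w.
  move=> n1; apply: (@ar_closed_form _ _ _ _ V _ (fun j => eps n j w)).
  - exact: base0.
  - exact: heps0.
  - by move=> j jn; rewrite -rhoE//; exact: heps.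
have XE n w : (1 <= n)%N -> forall j, (1 <= j <= n)%N ->
    X n j w = base k gamma1 n * X n j.-1 w + eps n j w.
  by move=> n1 j jn; rewrite -thetaE//; exact: hX.
have XE2 n w : (1 <= n)%N -> forall j, (1 <= j <= n)%N ->
    (base k gamma1 n - base k gamma2 n) * X n j.-1 w =
    base k gamma1 n ^+ j * disc V (base k gamma1 n) j w -
    base k gamma2 n ^+ j * disc V (base k gamma2 n) j w.
  move=> n1; apply: (@ar2_closed_form _ _ _ _ V _ _ (fun j => X n j w) (fun j => eps n j w)).
  - exact: base0.
  - exact: base0.
  - exact: hX0.
  - exact: XE.
  - exact: epsE.
split.
(* The dominant root is theta, so the denominator of the limit is the first component and the vector
   is swapped. *)
- move=> g21 xi_theta xi_rho /centered_gaussian_vector_swap gv.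
  apply: (ar_ratio_cvg indepV idV iV iV2 EV EV2 k_gt0 kV k_o hgamma2 g21) => //.
  + move=> n; apply: measurable_funM => //; exact: measurable_funB.
  + move=> t1 t2 b; rewrite (centered_gaussian_vector_cos t1 t2 b gv).
    congr (expR (- (_ / 2)) * _); field; rewrite !gt_eqF ?addr_gt0//.
  + apply: (centered_gaussian_vector_neq0 gv).
    by rewrite mulf_neq0 ?invr_eq0 ?gt_eqF// mulr_gt0.
  + apply: filterS near1 => n n1 w S0.
    have XE' j : (1 <= j <= n)%N -> X n j w = base k gamma1 n * X n j.-1 w +
        base k gamma2 n ^+ j * disc V (base k gamma2 n) j w.
      by move=> jn; rewrite XE// epsE//; case/andP: jn.
    have [X0 XR] := least_squares_error XE' (XE2 n w n1) S0.
    rewrite hthetahat// XR thetaE// rhoE// expr_div_n normalized_error_gt ?hk_pos//.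
      by rewrite expf_neq0// base0.
    by rewrite /base opprD addrACA subrr add0r -mulrBl.
- move=> g12 xi_theta xi_rho gv.
  apply: (ar_ratio_cvg indepV idV iV iV2 EV EV2 k_gt0 kV k_o hgamma1 g12) => //.
  + by move=> n; apply: measurable_funM => //; apply: measurable_funB => //;
      apply: measurable_funM => //; exact: measurable_funB.
  + move=> t1 t2 b; rewrite (centered_gaussian_vector_cos t1 t2 b gv).
    by congr (expR (- (_ / 2)) * _); field; rewrite !gt_eqF ?addr_gt0.
  + apply: (centered_gaussian_vector_neq0 gv).
    by rewrite mulf_neq0 ?invr_eq0 ?gt_eqF// mulr_gt0.
  + apply: filterS near1 => n n1 w S0.
    (* X is also an autoregression with root rho, driven by the autoregression with root theta: the
       residual changes by (theta - rho) X_(j-1), which [XE2] expresses by the two. *)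
    have XE' j : (1 <= j <= n)%N -> X n j w = base k gamma2 n * X n j.-1 w +
        base k gamma1 n ^+ j * disc V (base k gamma1 n) j w.
      move=> jn; have jn' : (j <= n)%N by case/andP: jn.
      have /eqP := XE2 n w n1 j jn; rewrite mulrBl subr_eq => /eqP h.
      by rewrite (XE n w n1 j jn) (epsE n w n1 j jn') h addrAC subrK addrC.
    have XE2' j : (1 <= j <= n)%N -> (base k gamma2 n - base k gamma1 n) * X n j.-1 w =
        base k gamma2 n ^+ j * disc V (base k gamma2 n) j w -
        base k gamma1 n ^+ j * disc V (base k gamma1 n) j w.
      by move=> jn; rewrite -opprB mulNr (XE2 n w n1 j jn) opprB.
    have [X0 XR] := least_squares_error XE' XE2' S0.
    rewrite hthetahat// XR thetaE// rhoE// expr_div_n normalized_error_lt ?hk_pos//.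
      by rewrite expf_neq0// base0.
    by rewrite /base opprD addrACA subrr add0r -mulrBl.
- move=> gamma g1 g2 phi zeta /centered_gaussian_vector_swap gv.
  subst gamma2; subst gamma1.
  apply: (equal_ratio_cvg indepV idV iV iV2 EV EV2 k_gt0 kV k_o hgamma1) => //.
  + by move=> n; apply: measurable_funM => //; apply: measurable_funB => //;
      apply: measurable_funM => //; exact: measurable_funB.
  + move=> t1 t2 b; rewrite (centered_gaussian_vector_cos t1 t2 b gv).
    by congr (expR (- (_ / 2)) * _); field; rewrite !gt_eqF ?addr_gt0.
  + apply: (centered_gaussian_vector_neq0 gv).
    by rewrite mulf_neq0 ?invr_eq0 ?gt_eqF// mulr_gt0.
  + apply: filterS near1 => n n1 w S0.
    (* At equal roots theta - rho vanishes and [XE2] says nothing about X; the lagged process is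
       recovered with the factor theta instead. *)
    have XE3 := @ar2_equal_closed_form _ _ _ _ V _ (fun j => X n j w) (fun j => eps n j w) n w
      (hX0 n w n1) (XE n w n1) (epsE n w n1).
    have [X0 XR] := least_squares_error (XE n w n1) XE3 S0.
    rewrite hthetahat// XR thetaE//.
    have E j : (1 <= j < n.+1)%N -> eps n j w = base k gamma n ^+ j * disc V (base k gamma n) j w.
      by case/andP=> _ jn; exact: epsE.
    have -> : \sum_(1 <= j < n.+1) eps n j w *
        (base k gamma n ^+ j * (j%:R * disc V (base k gamma n) j w - disc1 V (base k gamma n) j w)) =
        \sum_(1 <= j < n.+1) base k gamma n ^+ j * disc V (base k gamma n) j w *
        (base k gamma n ^+ j * (j%:R * disc V (base k gamma n) j w - disc1 V (base k gamma n) j w)).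
      by apply: eq_big_nat => j jn; rewrite E.
    exact: normalized_error_eq.
Unshelve. all: by end_near. Qed.
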